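(* For each $z\in\mathbb{Z}^2$ the limit $$v(z)=\lim_{R\to\infty}R^{1/2}\,\mathbf{P}^z\{\sigma_R<\tau_+\}$$ exists. Moreover, there exists $c<\infty$ such that for all $z\in\mathbb{Z}^2\setminus\{0\}$, $$\left|v(z)-\frac4\pi\,\mathrm{Im}\,\sqrt z\right|\le c\,\frac{\sin(\theta_z/2)}{|z|^{1/2}}.$$
   Context: $\mathbb{Z}^2=\mathbb{Z}+i\mathbb{Z}\subset\mathbb{C}$. $S$ is simple random walk on $\mathbb{Z}^2$ and $\mathbf{P}^z$ its law started from $z$. $\tau_+=\min\{j\ge0:S_j\in\mathbb{Z}_+\}$ with $\mathbb{Z}_+=\{0,1,2,\ldots\}$, and $\sigma_R=\min\{j\ge0:|S_j|\ge R\}$. $\theta_z=\arg z\in[0,2\pi)$ and $\mathrm{Im}\sqrt z=|z|^{1/2}\sin(\theta_z/2)$. *)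

(* Defs.v *)
From HB Require Import structures.
From mathcomp Require Import all_boot all_order all_algebra.
From mathcomp Require Import all_classical all_reals all_analysis.

Set Implicit Arguments.
Unset Strict Implicit.
Unset Printing Implicit Defensive.

Import Order.TTheory GRing.Theory Num.Theory.
Import numFieldNormedType.Exports.

Local Open Scope classical_set_scope.
Local Open Scope ring_scope.

(* The pair (x, y) stands for the complex number x + i y. *)
Notation Z2 := (int * int)%type.

Definition modulus {R : realType} (z : Z2) : R :=
  Num.sqrt (z.1%:~R ^+ 2 + z.2%:~R ^+ 2).

(* The argument in [0, 2 pi[, see arg_polar and arg_unique; at the origin the
   value is a junk one. *)
Definition arg {R : realType} (z : Z2) : R :=
  let t := acos (z.1%:~R / modulus z) in
  if 0 <= z.2 then t else 2 * pi - t.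

Definition Im_sqrt {R : realType} (z : Z2) : R :=
  Num.sqrt (modulus z) * sin (arg z / 2).

Definition Zplus : set Z2 := [set z | 0 <= z.1 /\ z.2 = 0].

Definition outside {R : realType} (r : R) : set Z2 := [set z | r <= modulus z].

(* The first time j >= 0 at which S is in A, +oo if there is none. *)
Definition hitting_time {R : realType} {T : Type} (S : nat -> T -> Z2)
    (A : set Z2) (t : T) : \bar R :=
  ereal_inf [set j%:R%:E | j in [set j | A (S j t)]].

Definition tau_plus (R : realType) {T : Type} (S : nat -> T -> Z2) (t : T) :
  \bar R := hitting_time S Zplus t.

Definition sigma {R : realType} {T : Type} (S : nat -> T -> Z2) (r : R)
  (t : T) : \bar R := hitting_time S (outside r) t.

Definition unit_steps : set Z2 := [set (1, 0); (-1, 0); (0, 1); (0, -1)].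

Definition increment {T : Type} (S : nat -> T -> Z2) (j : nat) (t : T) : Z2 :=
  S j.+1 t - S j t.

(* Taking some of the A j to be setT gives the product rule for every finite
   subfamily of X. *)
Definition independent_sequence {d : measure_display} {T : measurableType d}
    {R : realType} (P : probability T R) (X : nat -> T -> Z2) : Prop :=
  forall (n : nat) (A : nat -> set Z2),
    P (\bigcap_(j in `I_n) (X j @^-1` A j)) =
    (\prod_(j < n) P (X j @^-1` A j))%E.

Definition simple_random_walk {d : measure_display} {T : measurableType d}
    {R : realType} (P : probability T R) (z : Z2) (S : nat -> T -> Z2) : Prop :=
  [/\ forall (j : nat) (w : Z2), measurable (S j @^-1` [set w]),
      P (S 0 @^-1` [set z]) = 1%E,
      forall (j : nat) (e : Z2), unit_steps e ->
        P (increment S j @^-1` [set e]) = (1 / 4)%:E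
    & independent_sequence P (increment S)].

Section arg_theory.
Variable R : realType.

Let sqr_modulus (z : Z2) :
  (modulus z : R) ^+ 2 = z.1%:~R ^+ 2 + z.2%:~R ^+ 2.
Proof. by rewrite sqr_sqrtr // addr_ge0 ?sqr_ge0. Qed.

Let modulus_gt0 (z : Z2) : z != 0 -> 0 < (modulus z : R).
Proof.
move=> z0; rewrite sqrtr_gt0 lt_neqAle addr_ge0 ?sqr_ge0 // andbT eq_sym.
rewrite paddr_eq0 ?sqr_ge0 // !sqrf_eq0 !intr_eq0; apply: contra z0.
by case: z => x y /= /andP[/eqP -> /eqP ->].
Qed.

Lemma arg_polar (z : Z2) : z != 0 ->
  [/\ 0 <= (arg z : R) < 2 * pi,
      z.1%:~R = modulus z * cos (arg z) :> R
    & z.2%:~R = modulus z * sin (arg z) :> R].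
Proof.
move=> z0; have m0 := modulus_gt0 z0.
have m2 := sqr_modulus z; rewrite /arg /=.
set m := modulus z in m0 m2 *; set c := _ / m.
have mn0 : m != 0 by rewrite gt_eqF.
have xE : z.1%:~R = m * c by rewrite /c mulrCA mulfV // mulr1.
have y2 : z.2%:~R ^+ 2 = m ^+ 2 * (1 - c ^+ 2).
  by rewrite mulrBr mulr1 -exprMn -xE m2 addrC addKr.
have c2 : c ^+ 2 <= 1.
  rewrite -subr_ge0 -(pmulr_rge0 _ (exprn_gt0 2 m0)) -y2; exact: sqr_ge0.
have c1 : -1 <= c <= 1.
  by rewrite -ler_norml -(@ler_pXn2r _ 2) ?nnegrE // real_normK ?num_real// expr1n.
have sE : m * Num.sqrt (1 - c ^+ 2) = `|z.2%:~R|.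
  by rewrite -(sqrtr_sqr z.2%:~R) y2 sqrtrM ?sqr_ge0 // sqrtr_sqr gtr0_norm.
have pi0 := pi_gt0 R.
case: ifPn => [y0|]; last rewrite -ltNge => y0.
- split; last 2 first.
  + by rewrite acosK.
  + by rewrite sin_acos // sE ger0_norm // ler0z.
  rewrite acos_ge0 //=; apply: le_lt_trans (acos_lepi c1) _.
  by rewrite mulr_natl mulr2n ltrDl.
- have y0' : (z.2%:~R : R) < 0 by rewrite ltrz0.
  split; last 2 first.
  + by rewrite addrC mulr_natl cosD2pi cosN acosK.
  + by rewrite addrC mulr_natl sinD2pi sinN sin_acos // mulrN sE ltr0_norm // opprK.
  rewrite subr_ge0 (le_trans (acos_lepi c1)) ?mulr_natl ?mulr2n ?lerDl ?ltW //=.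
  rewrite ltrBlDr ltrDl acos_gt0 //; case/andP: c1 => -> c1 /=.
  rewrite lt_neqAle c1 andbT; apply: contraTneq y0' => ce.
  rewrite -leNgt le_eqVlt eq_sym -sqrf_eq0 y2 ce.
  by rewrite expr1n subrr mulr0 eqxx.
Qed.

Lemma arg_unique (z : Z2) (t : R) : z != 0 -> 0 <= t < 2 * pi ->
  z.1%:~R = modulus z * cos t -> z.2%:~R = modulus z * sin t -> t = arg z.
Proof.
move=> z0 /andP[t0 t2] xE yE; have m0 := modulus_gt0 z0.
have cE : z.1%:~R / modulus z = cos t.
  by rewrite xE mulrAC mulfV ?mul1r // gt_eqF.
rewrite /arg cE; have [tpi|tpi] := leP t pi.
  rewrite cosK ?in_itv /= ?t0 //.
  by rewrite -(ler0z R) yE mulr_ge0 ?(ltW m0) // sin_ge0_pi ?in_itv /= ?t0.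
have tE : cos (2 * pi - t) = cos t.
  by rewrite addrC mulr_natl cosD2pi cosN.
have sE : sin t = - sin (2 * pi - t).
  by rewrite addrC mulr_natl sinD2pi sinN opprK.
have s0 : 0 < sin (2 * pi - t).
  apply: sin_gt0_pi; rewrite ?in_itv /= subr_gt0 t2 /=.
  by rewrite ltrBlDr mulr_natl mulr2n ltrD2l.
rewrite leNgt -(ltrz0 R) yE sE mulrN oppr_lt0 mulr_gt0 //=.
rewrite -tE cosK ?subKr // in_itv /= subr_ge0 (ltW t2) /=.
by rewrite lerBlDr mulr_natl mulr2n lerD2l ltW.
Qed.

End arg_theory.

(* Main.v *)
Require Import Defs.
From HB Require Import structures.
From mathcomp Require Import all_boot all_order all_algebra.
From mathcomp Require Import all_classical all_reals all_analysis.
From mathcomp Require Import ring lra zify.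
From mathcomp.real_closed Require Import complex.

Set Implicit Arguments.
Unset Strict Implicit.
Unset Printing Implicit Defensive.

Import Order.TTheory GRing.Theory Num.Theory.
Import numFieldNormedType.Exports.
Import Normc.

Local Open Scope classical_set_scope.
Local Open Scope ring_scope.

Local Notation Re := complex.Re.
Local Notation Im := complex.Im.

(** Let w = sqrt z, so that Im w is the positive harmonic function of the slit
    plane.  The discrete Laplacian of Im w, and of the other half-integer powers
    Im (w^(2m+1)), is smaller than the function by a factor |z|^-4, and still
    vanishes at the slit like Im w (phi_laplacian_far); this is proved by algebra
    on the square roots at the four neighbours, within a class of tame functions
    that records the vanishing of imaginary parts at the slit.

    The function beta = sin(arg z / 2) / |z|^(1/2) = - Im (1 / w) is harmonic as
    well, and 2 beta - beta^3 is superharmonic far from the origin, with a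
    Laplacian of order Im w / |z|^4.  Corrected near the origin it becomes a
    global barrier Psi = O(beta) (barrier_global).  It dominates the Laplacian of
    Im w, and iterating the killed walk between Im w - C Psi and Im w + C Psi
    produces a function h, harmonic for the walk, zero on the half-line, with
    |h - Im w| = O(beta) (harmonic_sqrt).  The limit of the theorem is
    v = 4 / pi * h, which gives the error bound.

    For the limit, let p(z) be the probability of leaving the disc of radius R
    before hitting the half-line.  In the continuum, in the variable
    w / sqrt R, it is the harmonic measure of the upper semicircle of the unit
    disc, and it has the sine expansion 4 / pi * (Im w + Im w^3 / 3 + ...).  A
    truncation of this series, with h in place of Im w, is discrete harmonic
    up to small errors and close to 1 on the circle, except near the corner
    where the circle meets the half-line; the contribution of the corner is
    controlled with the logarithmic potential (corner_function).  The maximum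
    principle then compares it with p (squeeze).  After multiplication by
    sqrt R only the first term survives at a fixed point, and its coefficient is
    4 / pi (exit_probability_scaling). *)

(** * Real and imaginary parts of complex numbers *)

Section complex_norm.
Variable R : realType.
Implicit Types x y : R[i].

Lemma normc_ge0 x : 0 <= normc x.
Proof. by case: x => a b; exact: sqrtr_ge0. Qed.

Lemma normc_sqr x : normc x ^+ 2 = Re x ^+ 2 + Im x ^+ 2.
Proof. by case: x => a b /=; rewrite sqr_sqrtr // addr_ge0 ?sqr_ge0. Qed.

Lemma Im_le_normc x : `|Im x| <= normc x.
Proof.
rewrite -(ler_pXn2r (n := 2)) ?nnegrE ?normc_ge0 //.
by rewrite normc_sqr real_normK ?num_real // lerDr sqr_ge0.
Qed.

Lemma Re_le_normc x : `|Re x| <= normc x.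
Proof.
rewrite -(ler_pXn2r (n := 2)) ?nnegrE ?normc_ge0 //.
by rewrite normc_sqr real_normK ?num_real // lerDl sqr_ge0.
Qed.

Lemma normcD_le x y : normc (x + y) <= normc x + normc y.
Proof. exact: le_normcD. Qed.

Lemma normc_opp x : normc (- x) = normc x.
Proof. exact: normcN. Qed.

Lemma normcX x n : normc (x ^+ n) = normc x ^+ n.
Proof.
by elim: n => [|n IH]; rewrite ?expr0 ?normc1// !exprS normcM IH.
Qed.

Lemma normc_real (a : R) : normc a%:C%C = `|a|.
Proof. by rewrite /= expr0n addr0 sqrtr_sqr. Qed.

Lemma ImcM x y : Im (x * y) = Re x * Im y + Im x * Re y.
Proof. by case: x => a b; case: y => c d. Qed.

Lemma RecM x y : Re (x * y) = Re x * Re y - Im x * Im y.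
Proof. by case: x => a b; case: y => c d. Qed.

Lemma RecD x y : Re (x + y) = Re x + Re y.
Proof. by case: x => a b; case: y => c d. Qed.

Lemma ImcD x y : Im (x + y) = Im x + Im y.
Proof. by case: x => a b; case: y => c d. Qed.

Lemma ImcN x : Im (- x) = - Im x.
Proof. by case: x => a b. Qed.

Lemma RecN x : Re (- x) = - Re x.
Proof. by case: x => a b. Qed.

Lemma ImcV x : Im x^-1 = - Im x / normc x ^+ 2.
Proof. by case: x => a b; rewrite normc_sqr mulNr. Qed.

Lemma RecV x : Re x^-1 = Re x / normc x ^+ 2.
Proof. by case: x => a b; rewrite normc_sqr. Qed.

Lemma Rec_div x y : Re (x / y) = (Re x * Re y + Im x * Im y) / normc y ^+ 2.
Proof. by rewrite RecM RecV ImcV mulNr mulrN opprK !mulrA -mulrDl. Qed.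

Lemma Imc_div x y : Im (x / y) = (Im x * Re y - Re x * Im y) / normc y ^+ 2.
Proof. by rewrite ImcM RecV ImcV mulNr mulrN !mulrA addrC -mulrBl. Qed.

Lemma Im_realM (a : R) x : Im (a%:C%C * x) = a * Im x.
Proof. by rewrite ImcM /= mul0r addr0. Qed.

Lemma cofrealM (a b : R) : (a * b)%:C%C = a%:C%C * b%:C%C :> R[i].
Proof. exact: (rmorphM (real_complex R)). Qed.

Lemma cofrealV (a : R) : a^-1%:C%C = (a%:C%C)^-1 :> R[i].
Proof. exact: (fmorphV (real_complex R)). Qed.

Lemma cofrealX (a : R) n : (a ^+ n)%:C%C = a%:C%C ^+ n :> R[i].
Proof. exact: (rmorphXn (real_complex R)). Qed.

Lemma cofreal_nat n : (n%:R)%:C%C = n%:R :> R[i].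
Proof. exact: (rmorph_nat (real_complex R)). Qed.

Lemma Im_exp_real x n : Im x = 0 -> Im (x ^+ n) = 0.
Proof.
move=> x0; elim: n => [|n IH]; first by rewrite expr0.
by rewrite exprS ImcM x0 IH mulr0 mul0r addr0.
Qed.

End complex_norm.

(** * The square root on the slit lattice *)

Section square_root.
Variable R : realType.
Implicit Types z e : Z2.
Local Notation C := R[i].

Definition embed z : C := Complex z.1%:~R z.2%:~R.

Definition sqrtz z : C :=
  Complex (Num.sqrt (modulus z) * cos (arg z / 2)) (Im_sqrt z).

(** The decidable form of the half-line, for case analysis. *)
Definition slit z := (0 <= z.1) && (z.2 == 0).

Lemma slitP z : reflect (Zplus z) (slit z).
Proof.
apply: (iffP andP) => [[x0 /eqP y0]|[x0 y0]]; first by split.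
by split=> //; apply/eqP.
Qed.

Lemma modulus_ge0 z : 0 <= modulus z :> R.
Proof. exact: sqrtr_ge0. Qed.

Lemma modulus_sqr z : modulus z ^+ 2 = z.1%:~R ^+ 2 + z.2%:~R ^+ 2 :> R.
Proof. by rewrite sqr_sqrtr // addr_ge0 ?sqr_ge0. Qed.

Lemma normc_embed z : normc (embed z) = modulus z.
Proof. by []. Qed.

Lemma embedD z e : embed (z + e) = embed z + embed e.
Proof. by rewrite /embed /= !rmorphD /=. Qed.

Lemma modulus0 : modulus 0 = 0 :> R.
Proof. by rewrite /modulus /= !expr0n addr0 sqrtr0. Qed.

Lemma modulus_ge1 z : z != 0 -> 1 <= modulus z :> R.
Proof.
move=> z0; rewrite -(@ler_pXn2r _ 2) ?nnegrE ?modulus_ge0 // expr1n modulus_sqr.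
have -> : z.1%:~R ^+ 2 + z.2%:~R ^+ 2 = (z.1 ^+ 2 + z.2 ^+ 2)%:~R :> R.
  by rewrite intrD -!rmorphXn.
rewrite ler1z -gtz0_ge1 lt_neqAle addr_ge0 ?sqr_ge0 // andbT eq_sym.
rewrite paddr_eq0 ?sqr_ge0 // !sqrf_eq0; apply: contra z0.
by case: z => x y /= /andP[/eqP -> /eqP ->].
Qed.

Lemma slit_neq0 z : ~~ slit z -> z != 0.
Proof. by apply: contra => /eqP ->. Qed.

Lemma modulus_off_slit z : ~~ slit z -> 1 <= modulus z :> R.
Proof. by move/slit_neq0; exact: modulus_ge1. Qed.

Lemma sqrtz_sqr z : sqrtz z ^+ 2 = embed z.
Proof.
have [->|z0] := eqVneq z 0.
  rewrite /sqrtz /embed /Im_sqrt modulus0 sqrtr0 !mul0r expr2.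
  by congr Complex => /=; rewrite !mul0r ?subr0 ?addr0.
have [_ xE yE] := arg_polar R z0.
have m2 : Num.sqrt (modulus z) ^+ 2 = modulus z :> R.
  by rewrite sqr_sqrtr ?modulus_ge0.
rewrite /sqrtz /embed /Im_sqrt xE yE.
have -> : (arg z : R) = arg z / 2 + arg z / 2 by field.
set t := (arg z / 2 + arg z / 2) / 2; have -> : t = arg z / 2 by rewrite /t; field.
move: (arg z / 2) => u; rewrite cosD sinD -[in RHS]m2 expr2.
by congr Complex => /=; ring.
Qed.

Lemma normc_sqrtz z : normc (sqrtz z) = Num.sqrt (modulus z).
Proof.
apply/eqP; rewrite -(@eqrXn2 _ 2) ?normc_ge0 ?sqrtr_ge0 //.
by rewrite -normcX sqrtz_sqr sqr_sqrtr ?modulus_ge0.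
Qed.

Lemma sin_half_arg_ge0 z : z != 0 -> 0 <= sin (arg z / 2) :> R.
Proof.
move=> z0; have [/andP[t0 t2] _ _] := arg_polar R z0.
by apply: sin_ge0_pi; apply/andP; split; lra.
Qed.

Lemma Im_sqrt_ge0 z : 0 <= Im_sqrt z :> R.
Proof.
have [->|z0] := eqVneq z 0; first by rewrite /Im_sqrt modulus0 sqrtr0 mul0r.
by rewrite /Im_sqrt mulr_ge0 ?sqrtr_ge0 ?sin_half_arg_ge0.
Qed.

Lemma arg_slit z : slit z -> z != 0 -> arg z = 0 :> R.
Proof.
move=> /andP[x0 /eqP y0] z0; symmetry; apply: arg_unique => //.
- by rewrite lexx mulr_gt0 ?pi_gt0.
- rewrite cos0 mulr1 /modulus y0 expr0n addr0 sqrtr_sqr ger0_norm //.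
  by rewrite ler0z.
- by rewrite y0 sin0 mulr0.
Qed.

Lemma Im_sqrt_slit z : slit z -> Im_sqrt z = 0 :> R.
Proof.
have [->|z0] := eqVneq z 0; first by rewrite /Im_sqrt modulus0 sqrtr0 mul0r.
by move=> sz; rewrite /Im_sqrt arg_slit // mul0r sin0 mulr0.
Qed.

Lemma embed_parts z :
  z.1%:~R = Re (sqrtz z) ^+ 2 - Im_sqrt z ^+ 2 :> R /\
  z.2%:~R = 2 * Re (sqrtz z) * Im_sqrt z :> R.
Proof.
have := sqrtz_sqr z; rewrite expr2 => /eqP; rewrite eq_complex RecM ImcM /=.
move=> /andP[/eqP <- /eqP <-]; split; rewrite /sqrtz /=; ring.
Qed.

Lemma Im_sqrt_gt0 z : ~~ slit z -> 0 < Im_sqrt z :> R.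
Proof.
move=> sz; rewrite lt_neqAle Im_sqrt_ge0 andbT eq_sym.
apply: contra sz => /eqP b0; have [xE yE] := embed_parts z.
rewrite b0 mulr0 in yE; rewrite b0 expr0n subr0 in xE.
apply/andP; split; first by rewrite -(ler0z R) xE sqr_ge0.
by rewrite -(intr_eq0 R) yE.
Qed.

Lemma sqrt_modulus_gt0 z : z != 0 -> 0 < Num.sqrt (modulus z) :> R.
Proof. by move=> z0; rewrite sqrtr_gt0 (lt_le_trans ltr01) ?modulus_ge1. Qed.

Lemma sin_half_argE z :
  z != 0 -> sin (arg z / 2) = Im_sqrt z / Num.sqrt (modulus z) :> R.
Proof.
move=> z0; have s0 := sqrt_modulus_gt0 z0.
by rewrite /Im_sqrt mulrAC mulfV ?mul1r // gt_eqF.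
Qed.

(** The distance from a lattice point off the slit to the slit is at least one,
    and the square root turns this into a lower bound: either
    2 Re(w) Im(w) is a nonzero integer, or w is purely imaginary with w^2
    a nonzero integer. *)
Lemma Im_sqrt_lb z : ~~ slit z -> 1 / 2 <= Im_sqrt z * Num.sqrt (modulus z) :> R.
Proof.
move=> sz; have b0 := Im_sqrt_gt0 sz; have [xE yE] := embed_parts z.
have ra := Re_le_normc (sqrtz z); rewrite normc_sqrtz in ra.
have rb := Im_le_normc (sqrtz z); rewrite normc_sqrtz /= in rb.
have [y0|y0] := eqVneq z.2 0.
  have a0 : Re (sqrtz z) = 0.
    have /eqP : Re (sqrtz z) * Im_sqrt z = 0.
      by move: yE; rewrite y0 => yE; lra.
    by rewrite mulf_eq0 (gt_eqF b0) orbF => /eqP.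
  have x0 : z.1 <= -1.
    move: sz; rewrite /slit y0 eqxx andbT -ltNge => x0.
    by lia.
  have : z.1%:~R <= -1 :> R by rewrite -[-1]/((-1)%:~R) ler_int.
  rewrite xE a0 expr0n /= sub0r lerN2 => b1.
  rewrite (@le_trans _ _ (Im_sqrt z ^+ 2)) //; first by lra.
  rewrite expr2 ler_pM2l // (le_trans _ rb) //; exact: ler_norm.
have : 1 <= `|z.2%:~R| :> R.
  by rewrite -intr_norm ler1z -gtz0_ge1 normr_gt0.
rewrite yE normrM (ger0_norm (ltW b0)) normrM (ger0_norm (ler0n _ 2)) => H.
have := ler_wpM2l (ltW b0) ra; nra.
Qed.

End square_root.

(** * Square roots at neighbouring points *)

Section neighbours.
Variable R : realType.
Implicit Types z e : Z2.
Local Notation C := R[i].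

Lemma unit_stepsP e : unit_steps e ->
  [\/ e = (1, 0), e = (-1, 0), e = (0, 1) | e = (0, -1)].
Proof.
by move=> [[[->|->]|->]|->]; [apply: Or41|apply: Or42|apply: Or43|apply: Or44].
Qed.

Lemma normc_embed_step e : unit_steps e -> normc (embed R e) = 1.
Proof.
by move=> /unit_stepsP[] ->; rewrite /embed /normc /= ?mulr0z ?mulrN1z ?mulr1z
  ?sqrrN ?expr1n ?expr0n ?addr0 ?add0r sqrtr1.
Qed.

Lemma modulus_step z e : unit_steps e -> modulus (z + e) <= modulus z + 1 :> R.
Proof.
move=> he; rewrite -[modulus (z + e)]normc_embed embedD.
by rewrite (le_trans (normcD_le _ _)) // (normc_embed_step he).
Qed.

Definition nbr_avg (f : Z2 -> R) z : R :=
  (f (z + (1, 0)) + f (z + (-1, 0)) + f (z + (0, 1)) + f (z + (0, -1))) / 4.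

(** The square root of z + e that lies in the same half plane as the one of z.
    It continues the branch along the step; on the slit, where the two sides
    of the cut carry opposite roots, it may be the opposite of sqrtz. *)
Definition nbr_root e z : C :=
  let v := sqrtz R (z + e) in let w := sqrtz R z in
  if 0 <= Re v * Re w + Im v * Im w then v else - v.

Lemma nbr_root_sqr e z : nbr_root e z ^+ 2 = embed R (z + e).
Proof. by rewrite /nbr_root; case: ifP => _; rewrite ?sqrrN sqrtz_sqr. Qed.

Lemma nbr_root_aligned e z :
  0 <= Re (nbr_root e z) * Re (sqrtz R z) + Im (nbr_root e z) * Im (sqrtz R z).
Proof.
rewrite /nbr_root; case: ifP => // /negbT; rewrite -ltNge RecN ImcN => h.
by rewrite !mulNr -opprD oppr_ge0 ltW.
Qed.

(** A unit step cannot bring a lattice point strictly across the real axis.  If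
    the aligned root fell in the lower half plane, the alignment would force
    2 Re(w) Im(w) and 2 Re(w') Im(w'), the imaginary parts of z and z + e, to
    have strictly opposite signs. *)
Lemma Im_nbr_root_ge0 e z : unit_steps e -> ~~ slit z -> 0 <= Im (nbr_root e z).
Proof.
move=> he sz; have b0 := Im_sqrt_gt0 R sz.
have al := nbr_root_aligned e z; have vE := nbr_root_sqr e z.
have [_ yE] := embed_parts R z.
have yvE : (z.2 + e.2)%:~R = 2 * Re (nbr_root e z) * Im (nbr_root e z) :> R.
  by rewrite -[LHS]/(Im (embed R (z + e))) -vE expr2 ImcM; ring.
have same_side : 0 <= z.2%:~R * (z.2 + e.2)%:~R :> R.
  rewrite -rmorphM ler0z; case: (ltgtP z.2 0) => h; case/unit_stepsP: he => -> /=;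
    by nia.
rewrite leNgt; apply/negP => v0; move: same_side; rewrite leNgt => /negP; apply.
move: al yvE yE => /=.
set a := Re (sqrtz R z); set a' := Re (nbr_root e z).
set b := Im_sqrt z in b0 *; set b' := Im (nbr_root e z) in v0 *.
rewrite -[X in a' * X]/a => al -> ->.
have bb : b' * b < 0 by rewrite nmulr_rlt0.
have aa : 0 < a' * a by lra.
have -> : 2 * a * b * (2 * a' * b') = 4 * (a' * a) * (b' * b) by ring.
by rewrite nmulr_llt0 // mulr_gt0.
Qed.

(** Two opposite numbers both in the closed upper half plane are real, so the
    choice of branch is invisible to the imaginary part of any power. *)
Lemma nbr_root_real_flip e z : unit_steps e -> ~~ slit z ->
  nbr_root e z = sqrtz R (z + e) \/
  nbr_root e z = - sqrtz R (z + e) /\ Im (sqrtz R (z + e)) = 0.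
Proof.
move=> he sz; have := Im_nbr_root_ge0 he sz.
rewrite /nbr_root; case: ifP => _; first by left.
rewrite ImcN oppr_ge0 => v0; right; split=> //.
by apply/eqP; rewrite eq_le v0 Im_sqrt_ge0.
Qed.

Lemma Im_nbr_rootX e z n : unit_steps e -> ~~ slit z ->
  Im (nbr_root e z ^+ n) = Im (sqrtz R (z + e) ^+ n).
Proof.
move=> he sz; have [->//|[-> v0]] := nbr_root_real_flip he sz.
by rewrite !Im_exp_real // ImcN v0 oppr0.
Qed.

Lemma Im_nbr_rootV e z : unit_steps e -> ~~ slit z ->
  Im (nbr_root e z)^-1 = Im (sqrtz R (z + e))^-1.
Proof.
move=> he sz; have [->//|[-> v0]] := nbr_root_real_flip he sz.
by rewrite !ImcV ImcN v0 !oppr0 !mul0r.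
Qed.

Definition nbr_ratio e z : C := nbr_root e z / sqrtz R z.

Lemma sqrtz_neq0 z : ~~ slit z -> sqrtz R z != 0.
Proof.
move=> sz; have b0 := Im_sqrt_gt0 R sz; apply: contraTneq b0 => /(congr1 (@Im R)).
by rewrite /= => ->; rewrite ltxx.
Qed.

Lemma embed_neq0 z : ~~ slit z -> embed R z != 0.
Proof. by move=> sz; rewrite -sqrtz_sqr expf_neq0 // sqrtz_neq0. Qed.

Lemma nbr_ratio_sqr e z : ~~ slit z ->
  nbr_ratio e z ^+ 2 = 1 + embed R e / embed R z.
Proof.
move=> sz; rewrite /nbr_ratio expr_div_n nbr_root_sqr sqrtz_sqr embedD mulrDl.
by rewrite divff // embed_neq0.
Qed.

Lemma Re_nbr_ratio_ge0 e z : 0 <= Re (nbr_ratio e z).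
Proof.
by rewrite /nbr_ratio Rec_div divr_ge0 ?nbr_root_aligned // sqr_ge0.
Qed.

Lemma normcD1_ge (x : C) : 0 <= Re x -> 1 <= normc (x + 1).
Proof.
move=> x0; apply: le_trans (Re_le_normc _); rewrite RecD /=.
by rewrite ger0_norm; lra.
Qed.

(** From (u - 1)(u + 1) = e / z, where the factor u + 1 has modulus at least 1
    because Re u >= 0. *)
Lemma nbr_ratio_near1 e z : unit_steps e -> ~~ slit z ->
  normc (nbr_ratio e z - 1) <= (modulus z)^-1.
Proof.
move=> he sz; have m1 := modulus_off_slit R sz.
have u1 := normcD1_ge (Re_nbr_ratio_ge0 e z).
have : normc ((nbr_ratio e z - 1) * (nbr_ratio e z + 1)) = (modulus z)^-1.
  rewrite -subr_sqr nbr_ratio_sqr // expr1n addrAC subrr add0r normcM.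
  by rewrite normcV normc_embed_step // mul1r.
rewrite normcM => <-; rewrite ler_peMr ?normc_ge0 //.
Qed.

(** A step moves the square root by at most |z|^(-1/2), which Im_sqrt_lb bounds
    by twice the imaginary part. *)
Lemma Im_sqrt_step e z : unit_steps e -> ~~ slit z ->
  Im (nbr_root e z) <= 3 * Im_sqrt z.
Proof.
move=> he sz; have b0 := Im_sqrt_gt0 R sz; have lb := Im_sqrt_lb R sz.
have z0 := slit_neq0 sz; have s0 := sqrt_modulus_gt0 R z0.
have w0 := sqrtz_neq0 sz.
have : normc (nbr_root e z - sqrtz R z) <= (Num.sqrt (modulus z))^-1.
  have -> : nbr_root e z - sqrtz R z = (nbr_ratio e z - 1) * sqrtz R z.
    by rewrite mulrBl mul1r /nbr_ratio mulfVK.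
  rewrite normcM normc_sqrtz.
  rewrite (le_trans (ler_wpM2r (ltW s0) (nbr_ratio_near1 he sz))) //.
  by rewrite -{1}[modulus z]sqr_sqrtr ?modulus_ge0 // expr2 invfM mulfVK // gt_eqF.
have : (Num.sqrt (modulus z))^-1 <= 2 * Im_sqrt z :> R.
  by rewrite -(ler_pM2r s0) mulVf ?gt_eqF //; lra.
have := Im_le_normc (nbr_root e z - sqrtz R z).
rewrite ImcD ImcN => h1 h2 h3.
have := le_trans (ler_norm _) (le_trans h1 (le_trans h3 h2)).
by rewrite /=; lra.
Qed.

End neighbours.

(** * Tame functions *)

Section tame_functions.
Variable R : realType.
Implicit Types z e : Z2.
Local Notation C := R[i].
Implicit Types X Y : Z2 -> C.

(** The threshold 10 puts the four ratios within 1/10 of 1, which keeps every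
    denominator met below away from zero. *)
Definition far z := ~~ slit z && (10 <= modulus z :> R).

Definition sinhalf z : R := sin (arg z / 2).

Lemma sinhalf_gt0 z : ~~ slit z -> 0 < sinhalf z.
Proof.
move=> sz; have z0 := slit_neq0 sz.
by rewrite /sinhalf sin_half_argE // divr_gt0 ?Im_sqrt_gt0 ?sqrt_modulus_gt0.
Qed.

Lemma Im_sqrtE z : Im_sqrt z = Num.sqrt (modulus z) * sinhalf z.
Proof. by []. Qed.

(** A bounded expression in sqrt z with real coefficients is almost real near the
    slit.  Tameness retains just this: the imaginary part carries a factor
    sin(arg z / 2).  It is what produces the factor Im (sqrt z) in the estimates
    of discrete Laplacians, uniformly up to the slit, and it is preserved by
    the field operations. *)
Definition tame Y := exists K : R, forall z, far z ->
  normc (Y z) <= K /\ `|Im (Y z)| <= K * sinhalf z.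

Lemma tame_ge0 Y : tame Y -> exists2 K : R, 0 <= K & forall z, far z ->
  normc (Y z) <= K /\ `|Im (Y z)| <= K * sinhalf z.
Proof.
move=> [K HK]; exists `|K| => // z fz; have [h1 h2] := HK z fz.
split; first exact: le_trans h1 (ler_norm _).
rewrite (le_trans h2) // ler_wpM2r ?ler_norm //.
by case/andP: fz => /sinhalf_gt0/ltW.
Qed.

Lemma eq_tame X Y : (forall z, far z -> X z = Y z) -> tame Y -> tame X.
Proof. by move=> XY [K HK]; exists K => z fz; rewrite XY //; exact: HK. Qed.

Lemma tame_real (a : R) : tame (fun=> a%:C%C).
Proof.
exists `|a| => z /andP[sz _]; rewrite normc_real lexx /= normr0; split=> //.
by rewrite mulr_ge0 ?normr_ge0 // ltW ?sinhalf_gt0.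
Qed.

Lemma tame_nat n : tame (fun=> n%:R).
Proof.
apply: eq_tame (tame_real n%:R) => z _.
by rewrite rmorph_nat.
Qed.

Lemma tame1 : tame (fun=> 1).
Proof. exact: (tame_nat 1). Qed.

Lemma tameD X Y : tame X -> tame Y -> tame (fun z => X z + Y z).
Proof.
move=> [K HK] [L HL]; exists (K + L) => z fz.
have [a b] := HK z fz; have [c d] := HL z fz; split.
  by rewrite (le_trans (normcD_le _ _)) // lerD.
by rewrite ImcD (le_trans (ler_normD _ _)) // mulrDl lerD.
Qed.

Lemma tameN X : tame X -> tame (fun z => - X z).
Proof.
by move=> [K HK]; exists K => z fz; rewrite normc_opp ImcN normrN; exact: HK.
Qed.

Lemma tameB X Y : tame X -> tame Y -> tame (fun z => X z - Y z).
Proof. by move=> tX tY; apply: tameD => //; exact: tameN. Qed.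

Lemma tameM X Y : tame X -> tame Y -> tame (fun z => X z * Y z).
Proof.
move=> /tame_ge0[K K0 HK] /tame_ge0[L L0 HL].
exists (K * L + K * L) => z fz.
have s0 : 0 <= sinhalf z by case/andP: fz => /sinhalf_gt0/ltW.
have [a b] := HK z fz; have [c d] := HL z fz; split.
  rewrite normcM (le_trans (ler_pM (normc_ge0 _) (normc_ge0 _) a c)) //.
  by rewrite lerDl mulr_ge0.
rewrite ImcM (le_trans (ler_normD _ _)) // mulrDl lerD // normrM.
  rewrite -mulrA ler_pM ?normr_ge0 //.
  exact: le_trans (Re_le_normc _) a.
rewrite mulrAC ler_pM ?normr_ge0 //.
exact: le_trans (Re_le_normc _) c.
Qed.

Lemma tameX X n : tame X -> tame (fun z => X z ^+ n).
Proof.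
move=> tX; elim: n => [|n IH].
  by apply: eq_tame (tame_nat 1) => z _; rewrite expr0.
by apply: eq_tame (tameM tX IH) => z _; rewrite exprS.
Qed.

Lemma tameV (c : R) X : 0 < c -> (forall z, far z -> c <= Re (X z)) -> tame X ->
  tame (fun z => (X z)^-1).
Proof.
move=> c0 cX /tame_ge0[K K0 HK]; exists (c^-1 + K / c ^+ 2) => z fz.
have s0 : 0 <= sinhalf z by case/andP: fz => /sinhalf_gt0/ltW.
have cn : c <= normc (X z).
  by apply: le_trans (Re_le_normc _); rewrite (le_trans (cX z fz)) ?ler_norm.
have n0 := lt_le_trans c0 cn; have [_ b] := HK z fz; split.
  rewrite normcV (@le_trans _ _ c^-1) ?lef_pV2 ?posrE //.
  by rewrite lerDl divr_ge0 ?sqr_ge0.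
rewrite ImcV mulNr normrN normrM mulrDl ler_wpDl //.
  by rewrite mulr_ge0 // invr_ge0 ltW.
rewrite [leRHS]mulrAC ler_pM ?normr_ge0 // normfV ger0_norm ?sqr_ge0 //.
by rewrite lef_pV2 ?posrE ?exprn_gt0 // ler_pXn2r // nnegrE ltW.
Qed.

(** The direction of sqrt z. *)
Definition dirz z : C := sqrtz R z / (Num.sqrt (modulus z))%:C%C.

Lemma normc_dirz z : z != 0 -> normc (dirz z) = 1.
Proof.
move=> z0; have s0 := sqrt_modulus_gt0 R z0.
by rewrite /dirz normcM normcV normc_real normc_sqrtz ger0_norm ?ltW // divff // gt_eqF.
Qed.

Lemma Im_dirz z : z != 0 -> Im (dirz z) = sinhalf z.
Proof.
move=> z0; rewrite /dirz mulrC -fmorphV Im_realM mulrC /=.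
by rewrite /sinhalf sin_half_argE.
Qed.

Lemma tame_dirz : tame dirz.
Proof.
exists 1 => z /andP[sz _]; have z0 := slit_neq0 sz; rewrite mul1r.
by rewrite normc_dirz // Im_dirz // ger0_norm // ltW // sinhalf_gt0.
Qed.

Lemma tame_dirzV : tame (fun z => (dirz z)^-1).
Proof.
exists 1 => z /andP[sz _]; have z0 := slit_neq0 sz; rewrite mul1r.
rewrite ImcV normcV normc_dirz // Im_dirz // expr1n !invr1 mulr1 normrN.
by rewrite ger0_norm // ltW // sinhalf_gt0.
Qed.

Lemma sqrtz_dirz z : z != 0 -> sqrtz R z = (Num.sqrt (modulus z))%:C%C * dirz z.
Proof.
move=> z0; rewrite /dirz mulrC mulfVK //.
by rewrite fmorph_eq0 gt_eqF ?sqrt_modulus_gt0.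
Qed.

Lemma embed_dirz z : z != 0 -> embed R z = (modulus z)%:C%C * dirz z ^+ 2.
Proof.
move=> z0; rewrite -sqrtz_sqr (sqrtz_dirz z0) exprMn -rmorphXn /=.
by rewrite sqr_sqrtr ?modulus_ge0.
Qed.

Lemma tame_embedV : tame (fun z => (embed R z)^-1).
Proof.
have tV : tame (fun z => (modulus z)^-1%:C%C).
  exists 1 => z /andP[sz _]; rewrite normc_real /= normr0 mul1r.
  have m1 := modulus_off_slit R sz.
  split; last by rewrite ltW // sinhalf_gt0.
  by rewrite ger0_norm ?invr_ge0 ?modulus_ge0 // invf_le1 // (lt_le_trans ltr01).
apply: eq_tame (tameM tV (tameX 2 tame_dirzV)) => z /andP[sz _].
by rewrite embed_dirz ?slit_neq0 // invfM exprVn fmorphV.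
Qed.

(** Factoring out the real scale |z|^(1/2 + m - n) leaves a tame function, and
    |z|^(1/2) sin(arg z / 2) is Im (sqrt z). *)
Lemma Im_power_tame Y m n : tame Y -> exists2 K : R, 0 <= K & forall z, far z ->
  `|Im (sqrtz R z * embed R z ^+ m * (embed R z)^-1 ^+ n * Y z)| * modulus z ^+ n
    <= K * Im_sqrt z * modulus z ^+ m.
Proof.
move=> tY.
have /tame_ge0[K K0 HK] := tameM (tameM (tameM tame_dirz
  (tameX m (tameX 2 tame_dirz))) (tameX n (tameX 2 tame_dirzV))) tY.
exists K => // z fz; have [_ h] := HK z fz; case/andP: fz => sz _.
have z0 := slit_neq0 sz; have m1 := modulus_off_slit R sz.
have m0 : 0 < modulus z :> R := lt_le_trans ltr01 m1.
set D := (X in `|Im X| <= _) in h.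
have -> : sqrtz R z * embed R z ^+ m * (embed R z)^-1 ^+ n * Y z =
    (Num.sqrt (modulus z) * modulus z ^+ m / modulus z ^+ n)%:C%C * D.
  rewrite {1}sqrtz_dirz // {1 2}embed_dirz // /D.
  move: (dirz z) (Y z) (modulus z) (Num.sqrt (modulus z)) => u y a s.
  rewrite cofrealM cofrealM cofrealV !cofrealX.
  move: a%:C%C s%:C%C => {}a {}s.
  rewrite invfM -[(u ^+ 2)^-1]exprVn -[(a ^+ n)^-1]exprVn.
  by move: u^-1 a^-1 => v c; rewrite !exprMn; ring.
rewrite Im_realM normrM ger0_norm; last first.
  by rewrite !mulr_ge0 ?sqrtr_ge0 ?invr_ge0 ?exprn_ge0 ?modulus_ge0.
rewrite Im_sqrtE mulrAC mulfVK ?gt_eqF ?exprn_gt0 //.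
rewrite [leRHS](_ : _ = Num.sqrt (modulus z) * modulus z ^+ m * (K * sinhalf z)).
  by rewrite ler_wpM2l // mulr_ge0 ?sqrtr_ge0 ?exprn_ge0 ?modulus_ge0.
by ring.
Qed.

(** The imaginary part of w'/w is that of w' times the conjugate of w, divided by
    |w|^2; each of the two terms has a factor Im w or Im w' <= 3 Im w. *)
Lemma tame_ratio e : unit_steps e -> tame (nbr_ratio R e).
Proof.
move=> he; exists 5 => z /andP[sz m10].
have z0 := slit_neq0 sz; have s0 := sqrt_modulus_gt0 R z0.
have b0 := Im_sqrt_gt0 R sz.
have n2 : normc (nbr_ratio R e z) <= 2.
  rewrite -(subrK 1 (nbr_ratio R e z)) (le_trans (normcD_le _ _)) // normc1.
  rewrite (_ : 2 = 1 + 1 :> R) ?lerD2r //.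
  rewrite (le_trans (nbr_ratio_near1 R he sz)) //.
  by rewrite invf_le1 ?(lt_le_trans ltr01) // modulus_off_slit.
split; first by rewrite (le_trans n2) // ler_nat.
have nv : normc (nbr_root R e z) <= 2 * Num.sqrt (modulus z).
  have -> : nbr_root R e z = nbr_ratio R e z * sqrtz R z.
    by rewrite /nbr_ratio mulfVK // sqrtz_neq0.
  by rewrite normcM normc_sqrtz ler_wpM2r // ltW.
rewrite /nbr_ratio Imc_div normrM normfV (ger0_norm (sqr_ge0 _)).
rewrite ler_pdivrMr ?normc_sqrtz ?exprn_gt0 //.
rewrite [leRHS](_ : _ =
  3 * Im_sqrt z * Num.sqrt (modulus z) + 2 * Num.sqrt (modulus z) * Im_sqrt z);
  last by rewrite Im_sqrtE; ring.
rewrite (le_trans (ler_normB _ _)) // lerD // normrM ler_pM //.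
- by rewrite ger0_norm ?Im_nbr_root_ge0 // Im_sqrt_step.
- by rewrite -normc_sqrtz Re_le_normc.
- exact: le_trans (Re_le_normc _) nv.
- by rewrite ger0_norm //= ltW.
Qed.

End tame_functions.

(** * Discrete Laplacians of half-integer powers *)

Section discrete_laplacian.
Variable R : realType.
Implicit Types z e : Z2.
Local Notation C := R[i].
Local Notation tame := (@tame R).
Local Notation far := (far R).
Local Notation E := (embed R).

(* The ratios for the steps 1, -1, i, -i; with t = 1 / z their squares are
   1 + t, 1 - t, 1 + i t, 1 - i t. *)
Let p := nbr_ratio R (1, 0).
Let q := nbr_ratio R (-1, 0).
Let f := nbr_ratio R (0, 1).
Let g := nbr_ratio R (0, -1).

Let step1 : unit_steps (1, 0). Proof. by do 3!left. Qed.
Let stepN1 : unit_steps (-1, 0). Proof. by do 2!left; right. Qed.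
Let stepi : unit_steps (0, 1). Proof. by left; right. Qed.
Let stepNi : unit_steps (0, -1). Proof. by right. Qed.

Let tp : tame p. Proof. exact: tame_ratio. Qed.
Let tq : tame q. Proof. exact: tame_ratio. Qed.
Let tf : tame f. Proof. exact: tame_ratio. Qed.
Let tg : tame g. Proof. exact: tame_ratio. Qed.

Let I : C := Complex 0 1.

Lemma I_sqr : I ^+ 2 = -1.
Proof. by rewrite sqr_i. Qed.

Lemma embed_steps : [/\ E (1, 0) = 1, E (-1, 0) = -1, E (0, 1) = I & E (0, -1) = - I].
Proof.
split; rewrite /embed /I /=.
- by rewrite mulr1z.
- by apply/eqP; rewrite eq_complex /= mulrN1z oppr0 !eqxx.
- by rewrite mulr1z.
- by apply/eqP; rewrite eq_complex /= mulrN1z oppr0 !eqxx.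
Qed.

Lemma far_off z : far z -> ~~ slit z. Proof. by case/andP. Qed.

Lemma ratio_sqrs z : far z -> [/\ p z ^+ 2 = 1 + (E z)^-1, q z ^+ 2 = 1 - (E z)^-1,
  f z ^+ 2 = 1 + I * (E z)^-1 & g z ^+ 2 = 1 - I * (E z)^-1].
Proof.
move=> /far_off sz; have [e1 e2 e3 e4] := embed_steps.
by split; rewrite nbr_ratio_sqr // ?e1 ?e2 ?e3 ?e4 ?mul1r ?mulNr ?mul1r.
Qed.

Lemma ratio_close e z : unit_steps e -> far z -> normc (nbr_ratio R e z - 1) <= 1 / 10.
Proof.
move=> he /andP[sz m10]; rewrite (le_trans (nbr_ratio_near1 R he sz)) // div1r.
by rewrite lef_pV2 // posrE // (lt_le_trans _ m10).
Qed.

Lemma Re_near1 (x : C) (c : R) : normc (x - 1) <= c -> 1 - c <= Re x.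
Proof.
move=> h; have := le_trans (Re_le_normc _) h; rewrite RecD RecN /= ler_norml.
by move=> /andP[a _]; lra.
Qed.

Lemma prod_near1 (x y : C) : normc (x - 1) <= 1 / 10 -> normc (y - 1) <= 1 / 10 ->
  normc (x * y - 1) <= 3 / 10.
Proof.
move=> hx hy; have -> : x * y - 1 = (x - 1) * (y - 1) + (x - 1) + (y - 1) by ring.
rewrite (le_trans (normcD_le _ _)) //.
have h1 : normc ((x - 1) * (y - 1)) <= 1 / 10.
  rewrite normcM (le_trans _ hx) // ler_piMr ?normc_ge0 //.
  by rewrite (le_trans hy) //; lra.
have := normcD_le ((x - 1) * (y - 1)) (x - 1); lra.
Qed.

(* Sums and products of opposite ratios are expressions in z with real
   coefficients, although f and g taken alone are not: Qx^2 = 1 - t^2,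
   Qy^2 = 1 + t^2, Sx^2 = 2 + 2 Qx, Sy^2 = 2 + 2 Qy. *)
Let Sx z := p z + q z.
Let Sy z := f z + g z.
Let Qx z := p z * q z.
Let Qy z := f z * g z.

Let pos_Re : forall z, far z ->
  [/\ 3 / 2 <= Re (Sx z), 3 / 2 <= Re (Sy z), 1 / 2 <= Re (Qx z) & 1 / 2 <= Re (Qy z)].
Proof.
move=> z fz.
have [hp hq] := (ratio_close step1 fz, ratio_close stepN1 fz).
have [hf hg] := (ratio_close stepi fz, ratio_close stepNi fz).
have ep := Re_near1 hp; have eq := Re_near1 hq.
have ef := Re_near1 hf; have eg := Re_near1 hg.
have ex := Re_near1 (prod_near1 hp hq); have ey := Re_near1 (prod_near1 hf hg).
rewrite -/p in hp ep ex; rewrite -/q in hq eq ex.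
rewrite -/f in hf ef ey; rewrite -/g in hg eg ey.
split.
- by rewrite /Sx RecD; lra.
- by rewrite /Sy RecD; lra.
- by rewrite /Qx; lra.
- by rewrite /Qy; lra.
Qed.

Let neq0_of_Re (x : C) : 0 < Re x -> x != 0.
Proof. by apply: contraTneq => ->; rewrite ltxx. Qed.

Let tSx : tame Sx. Proof. exact: tameD. Qed.
Let tSy : tame Sy. Proof. exact: tameD. Qed.
Let tQx : tame Qx. Proof. exact: tameM. Qed.
Let tQy : tame Qy. Proof. exact: tameM. Qed.

Let tSx2V : tame (fun z => (Sx z + 2)^-1).
Proof.
apply: (@tameV _ 1) => // [z /pos_Re[h _ _ _]|].
  by rewrite RecD (_ : Re 2 = 2) //; lra.
by apply: tameD => //; exact: tame_nat.
Qed.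

Let tSy2V : tame (fun z => (Sy z + 2)^-1).
Proof.
apply: (@tameV _ 1) => // [z /pos_Re[_ h _ _]|].
  by rewrite RecD (_ : Re 2 = 2) //; lra.
by apply: tameD => //; exact: tame_nat.
Qed.

Let tQx1V : tame (fun z => (Qx z + 1)^-1).
Proof.
apply: (@tameV _ 1) => // [z /pos_Re[_ _ h _]|].
  by rewrite RecD (_ : Re 1 = 1) //; lra.
by apply: tameD => //; exact: tame1.
Qed.

Let tQy1V : tame (fun z => (Qy z + 1)^-1).
Proof.
apply: (@tameV _ 1) => // [z /pos_Re[_ _ _ h]|].
  by rewrite RecD (_ : Re 1 = 1) //; lra.
by apply: tameD => //; exact: tame1.
Qed.

Let tSxV : tame (fun z => (Sx z)^-1).
Proof. by apply: (@tameV _ 1) => // z /pos_Re[h _ _ _]; lra. Qed.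

Let tSyV : tame (fun z => (Sy z)^-1).
Proof. by apply: (@tameV _ 1) => // z /pos_Re[_ h _ _]; lra. Qed.

Let tQxV : tame (fun z => (Qx z)^-1).
Proof. by apply: (@tameV _ (1/2)) => // z /pos_Re[]. Qed.

Let tQyV : tame (fun z => (Qy z)^-1).
Proof. by apply: (@tameV _ (1/2)) => // z /pos_Re[]. Qed.

Let tQQV : tame (fun z => (Qx z + Qy z)^-1).
Proof.
apply: (@tameV _ 1) => // [z /pos_Re[_ _ h h']|]; first by rewrite RecD; lra.
exact: tameD.
Qed.

Let tSSV : tame (fun z => (Sx z + Sy z)^-1).
Proof.
apply: (@tameV _ 1) => // [z /pos_Re[h h' _ _]|]; first by rewrite RecD; lra.
exact: tameD.
Qed.

(** A tame function times z^-n: the order of decay, together with the control of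
    the imaginary part. *)
Definition small n (X : Z2 -> C) := tame (fun z => X z * E z ^+ n).

Let nz z : far z -> [/\ E z != 0, Sx z != 0, Sy z != 0, Sx z + 2 != 0 & Sy z + 2 != 0] /\
  [/\ Qx z + 1 != 0, Qy z + 1 != 0, Qx z + Qy z != 0, Sx z + Sy z != 0 & Qx z != 0] /\
  Qy z != 0.
Proof.
move=> fz; have [a b c d] := pos_Re fz.
have r2 : Re (2 : C) = 2 by [].
have r1 : Re (1 : C) = 1 by [].
have E0 : E z != 0 by apply: embed_neq0; exact: far_off.
have add (x y : C) : 0 < Re x + Re y -> x + y != 0.
  by rewrite -RecD; exact: neq0_of_Re.
split; [split=> //|split; [split|]].
- by apply: neq0_of_Re; lra.
- by apply: neq0_of_Re; lra.
- by apply: add; rewrite r2; lra.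
- by apply: add; rewrite r2; lra.
- by apply: add; rewrite r1; lra.
- by apply: add; rewrite r1; lra.
- by apply: add; lra.
- by apply: add; lra.
- by apply: neq0_of_Re; lra.
- by apply: neq0_of_Re; lra.
Qed.

Let Qx_m1 z : far z -> Qx z - 1 = - (E z)^-1 ^+ 2 / (Qx z + 1).
Proof.
move=> fz; have [_ [[h _ _ _ _] _]] := nz fz; have [hp hq _ _] := ratio_sqrs fz.
apply: (mulIf h); rewrite mulfVK // -[LHS](_ : Qx z ^+ 2 - 1 = _); last by ring.
by rewrite /Qx exprMn hp hq; ring.
Qed.

Let Qy_m1 z : far z -> Qy z - 1 = (E z)^-1 ^+ 2 / (Qy z + 1).
Proof.
move=> fz; have [_ [[_ h _ _ _] _]] := nz fz; have [_ _ hp hq] := ratio_sqrs fz.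
apply: (mulIf h); rewrite mulfVK // -[LHS](_ : Qy z ^+ 2 - 1 = _); last by ring.
rewrite /Qy exprMn hp hq -[LHS](_ : - I ^+ 2 * (E z)^-1 ^+ 2 = _); last by ring.
by rewrite I_sqr; ring.
Qed.

Let QB z : far z -> Qx z - Qy z = - (2 * (E z)^-1 ^+ 2) / (Qx z + Qy z).
Proof.
move=> fz; have [_ [[_ _ h _ _] _]] := nz fz; have [hp hq hf hg] := ratio_sqrs fz.
apply: (mulIf h); rewrite mulfVK // -[LHS](_ : Qx z ^+ 2 - Qy z ^+ 2 = _); last by ring.
rewrite /Qx /Qy [(p z * q z) ^+ 2]exprMn [(f z * g z) ^+ 2]exprMn hp hq hf hg.
rewrite -[LHS](_ : (I ^+ 2 - 1) * (E z)^-1 ^+ 2 = _); last by ring.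
by rewrite I_sqr; ring.
Qed.

Let Sx_m2 z : far z -> Sx z - 2 = 2 * (Qx z - 1) / (Sx z + 2).
Proof.
move=> fz; have [[_ _ _ h _] _] := nz fz; have [hp hq _ _] := ratio_sqrs fz.
apply: (mulIf h); rewrite mulfVK //.
rewrite -[LHS](_ : p z ^+ 2 + q z ^+ 2 + 2 * Qx z - 4 = _); last first.
  by rewrite /Qx /Sx; ring.
by rewrite hp hq; ring.
Qed.

Let Sy_m2 z : far z -> Sy z - 2 = 2 * (Qy z - 1) / (Sy z + 2).
Proof.
move=> fz; have [[_ _ _ _ h] _] := nz fz; have [_ _ hp hq] := ratio_sqrs fz.
apply: (mulIf h); rewrite mulfVK //.
rewrite -[LHS](_ : f z ^+ 2 + g z ^+ 2 + 2 * Qy z - 4 = _); last first.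
  by rewrite /Qy /Sy; ring.
by rewrite hp hq; ring.
Qed.

Let SB z : far z -> Sx z - Sy z = 2 * (Qx z - Qy z) / (Sx z + Sy z).
Proof.
move=> fz; have [_ [[_ _ _ h _] _]] := nz fz; have [hp hq hf hg] := ratio_sqrs fz.
apply: (mulIf h); rewrite mulfVK //.
rewrite -[LHS](_ : p z ^+ 2 + q z ^+ 2 - f z ^+ 2 - g z ^+ 2 + 2 * (Qx z - Qy z) = _); last first.
  by rewrite /Qy /Sy /Qx /Sx; ring.
by rewrite hp hq hf hg; ring.
Qed.

Let small_QB : small 2 (fun z => Qx z - Qy z).
Proof.
apply: eq_tame (tameM (tameN (tame_nat R 2)) tQQV) => z fz /=.
rewrite QB //; have [[h _ _ _ _] [[_ _ h' _ _] _]] := nz fz.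
by field; rewrite h h'.
Qed.

Let small_SB : small 2 (fun z => Sx z - Sy z).
Proof.
apply: eq_tame (tameM (tameM (tame_nat R 2) small_QB) tSSV) => z fz /=.
by rewrite SB //; ring.
Qed.

Let small_Qx : small 2 (fun z => Qx z - 1).
Proof.
apply: eq_tame (tameN tQx1V) => z fz /=.
rewrite Qx_m1 //; have [[h _ _ _ _] [[h' _ _ _ _] _]] := nz fz.
by field; rewrite h h'.
Qed.

Let small_Qy : small 2 (fun z => Qy z - 1).
Proof.
apply: eq_tame tQy1V => z fz /=.
rewrite Qy_m1 //; have [[h _ _ _ _] [[_ h' _ _ _] _]] := nz fz.
by field; rewrite h h'.
Qed.

Let small_Sx : small 2 (fun z => Sx z - 2).
Proof.
apply: eq_tame (tameM (tameM (tame_nat R 2) small_Qx) tSx2V) => z fz /=.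
by rewrite Sx_m2 //; ring.
Qed.

Let small_Sy : small 2 (fun z => Sy z - 2).
Proof.
apply: eq_tame (tameM (tameM (tame_nat R 2) small_Qy) tSy2V) => z fz /=.
by rewrite Sy_m2 //; ring.
Qed.

(** The average over the four steps e of e^j u_e (1 + e / z)^m, with u_e the
    ratios.  Then sqrt z * z^m * moment m 0 is the average over the neighbours
    z' of z of z'^(m + 1/2), and the auxiliary index j makes the family closed
    under incrementing m. *)
Definition moment m j z : C :=
  (p z * (1 + (E z)^-1) ^+ m + (-1) ^+ j * q z * (1 - (E z)^-1) ^+ m +
   I ^+ j * f z * (1 + I * (E z)^-1) ^+ m +
   (- I) ^+ j * g z * (1 - I * (E z)^-1) ^+ m) / 4.

Lemma momentS m j z : moment m.+1 j z = moment m j z + (E z)^-1 * moment m j.+1 z.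
Proof. by rewrite /moment !exprS; ring. Qed.

Lemma moment4 m z : moment m 4 z = moment m 0 z.
Proof.
rewrite /moment (_ : I ^+ 4 = 1); last by rewrite (exprM _ 2 2) I_sqr; ring.
rewrite (_ : (- I) ^+ 4 = 1); last by rewrite (exprM _ 2 2) sqrrN I_sqr; ring.
by rewrite !expr0; ring.
Qed.

(** All cancellations come from differences of squares, which turn into
    quotients with tame denominators; for instance
    Sx - Sy = 2 (Qx - Qy) / (Sx + Sy) and Qx - Qy = - 2 t^2 / (Qx + Qy). *)
Let moments0 : [/\ small 4 (fun z => moment 0 0 z - 1), small 3 (moment 0 1),
  small 2 (moment 0 2) & small 1 (moment 0 3)].
Proof.
have two_neq0 : (2 : C) != 0 by rewrite pnatr_eq0.
have pq z : far z -> p z - q z = 2 * (E z)^-1 / Sx z.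
  move=> fz; have [[_ h _ _ _] _] := nz fz; have [hp hq _ _] := ratio_sqrs fz.
  apply: (mulIf h); rewrite mulfVK // -[LHS](_ : p z ^+ 2 - q z ^+ 2 = _).
    by rewrite hp hq; ring.
  by rewrite /Sx; ring.
have fg z : far z -> f z - g z = 2 * I * (E z)^-1 / Sy z.
  move=> fz; have [[_ _ h _ _] _] := nz fz; have [_ _ hp hq] := ratio_sqrs fz.
  apply: (mulIf h); rewrite mulfVK // -[LHS](_ : f z ^+ 2 - g z ^+ 2 = _).
    by rewrite hp hq; ring.
  by rewrite /Sy; ring.
split.
- have t1 : tame (fun z => ((Qx z - Qy z) * E z ^+ 2 * (Sx z + 2) +
      (Qy z + 1) * ((Sx z - Sy z) * E z ^+ 2)) *
      ((Qx z + 1)^-1 * (Sx z + 2)^-1 * ((Qy z + 1)^-1 * (Sy z + 2)^-1)) * (1/2)%:C%C).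
    apply: tameM; last exact: tame_real.
    apply: tameM; last by do 2!apply: tameM => //.
    apply: tameD; first by apply: tameM => //; apply: tameD => //; exact: tame_nat.
    by apply: tameM => //; apply: tameD => //; exact: tame1.
  apply: eq_tame t1 => z fz.
  have [[h1 _ _ h2 h3] [[h4 h5 _ _ _] _]] := nz fz.
  have -> : moment 0 0 z - 1 = ((Sx z - 2) + (Sy z - 2)) / 4.
    by rewrite /moment /Sx /Sy !expr0; field.
  rewrite Sx_m2 // Sy_m2 // Qx_m1 // Qy_m1 // cofrealM cofrealV (cofreal_nat R 2) ?mul1r.
  rewrite -[(Qx z - Qy z) * _ * _](_ : (Qx z + 1 - (Qy z + 1)) * E z ^+ 2 * (Sx z + 2) = _); last by ring.
  rewrite -[Sx z - Sy z](_ : (Sx z + 2) - (Sy z + 2) = _); last by ring.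
  move: h2 h3 h4 h5; move: (Sx z + 2) (Sy z + 2) (Qx z + 1) (Qy z + 1) => a b c d h2 h3 h4 h5.
  by field; rewrite h1 h2 h3 h4 h5.
- have t1 : tame (fun z => - ((Sx z - Sy z) * E z ^+ 2) * ((Sx z)^-1 * (Sy z)^-1) * (1/2)%:C%C).
    apply: tameM; last exact: tame_real.
    by apply: tameM; [exact: tameN|exact: tameM].
  apply: eq_tame t1 => z fz.
  have [[h1 h2 h3 _ _] _] := nz fz.
  have -> : moment 0 1 z = ((p z - q z) + I * (f z - g z)) / 4.
    by rewrite /moment !expr0 !expr1; field.
  rewrite pq // fg // cofrealM cofrealV (cofreal_nat R 2) ?mul1r.
  rewrite [I * _](_ : _ = I ^+ 2 * (2 * (E z)^-1 / Sy z)); last by ring.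
  by rewrite I_sqr; field; rewrite h1 h2 h3.
- have t1 := tameM small_SB (tame_real (1/4)).
  apply: eq_tame t1 => z fz; rewrite cofrealM cofrealV (cofreal_nat R 4) ?mul1r.
  by rewrite /moment !expr0 sqrrN (sqrrN I) I_sqr expr1n /Sx /Sy; field.
- have t1 := tameM (tameD tSxV tSyV) (tame_real (1/2)).
  apply: eq_tame t1 => z fz; rewrite cofrealM cofrealV (cofreal_nat R 2) ?mul1r.
  have [[h1 h2 h3 _ _] _] := nz fz.
  have -> : moment 0 3 z = ((p z - q z) - I * (f z - g z)) / 4.
    rewrite /moment !expr0 (exprS (- I) 2) (exprS I 2) sqrrN I_sqr.
    by rewrite (exprS _ 2) sqrrN expr1n; field.
  rewrite pq // fg //.
  rewrite [I * _](_ : _ = I ^+ 2 * (2 * (E z)^-1 / Sy z)); last by ring.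
  by rewrite I_sqr; field; rewrite h1 h2 h3.
Qed.

(** The four steps are the fourth roots of unity: only the coefficients of t^i
    with i + j divisible by 4 survive in the average, which leaves O(t^(4 - j))
    for j = 1, 2, 3 and 1 + O(t^4) for j = 0.  These orders are stable under the
    recursion on m, which closes up because e^4 = 1. *)
Lemma moment_small m : [/\ small 4 (fun z => moment m 0 z - 1), small 3 (moment m 1),
  small 2 (moment m 2) & small 1 (moment m 3)].
Proof.
elim: m => [//|m [h0 h1 h2 h3]].
have E0 z : far z -> E z != 0 by move/far_off/embed_neq0.
split.
- apply: eq_tame (tameD h0 h1) => z fz; rewrite momentS.
  by field; exact: E0.
- apply: eq_tame (tameD h1 h2) => z fz; rewrite momentS.
  by field; exact: E0.
- apply: eq_tame (tameD h2 h3) => z fz; rewrite momentS.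
  by field; exact: E0.
- have t0 : tame (moment m 0).
    apply: eq_tame (tameD (tameM h0 (tameX 4 (tame_embedV R))) (tame1 R)) => z fz.
    by field; exact: E0.
  apply: eq_tame (tameD h3 t0) => z fz; rewrite momentS moment4.
  by field; exact: E0.
Qed.

Lemma inv_pair_small : small 2 (fun z => (p z)^-1 + (q z)^-1 - 2) /\
  small 2 (fun z => (f z)^-1 + (g z)^-1 - 2).
Proof.
split.
- have t1 := tameM (tameB small_Sx (tameM (tame_nat R 2) small_Qx)) tQxV.
  apply: eq_tame t1 => z fz; have [_ [[_ _ _ _ h] _]] := nz fz.
  move: (h); rewrite /Qx mulf_eq0 negb_or => /andP[hp hq].
  by rewrite /Sx; field; rewrite hp hq.
- have t1 := tameM (tameB small_Sy (tameM (tame_nat R 2) small_Qy)) tQyV.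
  apply: eq_tame t1 => z fz; have [_ [_ h]] := nz fz.
  move: (h); rewrite /Qy mulf_eq0 negb_or => /andP[hp hq].
  by rewrite /Sy; field; rewrite hp hq.
Qed.

Lemma ratio_neq0 e z : unit_steps e -> far z -> nbr_ratio R e z != 0.
Proof.
move=> he fz; have := Re_near1 (ratio_close he fz) => h.
by apply: neq0_of_Re; lra.
Qed.

(** The average of e^j / u_e: the moments for m = -1. *)
Let imoment j z : C :=
  ((p z)^-1 + (-1) ^+ j * (q z)^-1 + I ^+ j * (f z)^-1 + (- I) ^+ j * (g z)^-1) / 4.

Let imoment_rec j z : far z ->
  imoment j z + (E z)^-1 * imoment j.+1 z = moment 0 j z.
Proof.
move=> fz; have [hp hq hf hg] := ratio_sqrs fz.
have [np nq] := (ratio_neq0 step1 fz, ratio_neq0 stepN1 fz).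
have [nf ng] := (ratio_neq0 stepi fz, ratio_neq0 stepNi fz).
rewrite -/p in np; rewrite -/q in nq; rewrite -/f in nf; rewrite -/g in ng.
have -> : moment 0 j z = (p z ^+ 2 * (p z)^-1 + (-1) ^+ j * (q z ^+ 2 * (q z)^-1) +
   I ^+ j * (f z ^+ 2 * (f z)^-1) + (- I) ^+ j * (g z ^+ 2 * (g z)^-1)) / 4.
  by rewrite /moment !expr0; field; rewrite np nq nf ng.
by rewrite hp hq hf hg /imoment !exprS; ring.
Qed.

(** The four relations a_j + t a_(j+1) = moment 0 j, closed by a_4 = a_0, give
    (1 - t^4) a_0 as an alternating sum of the moments. *)
Lemma imoment_small : small 4 (fun z => imoment 0 z - 1).
Proof.
have [h0 h1 h2 h3] := moments0.
have E0 z : far z -> E z != 0 by move/far_off/embed_neq0.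
have t4 : tame (fun z => (1 - (E z)^-1 ^+ 4)^-1).
  apply: (@tameV _ (1 / 2)) => // [z fz|]; last first.
    by apply: tameB; [exact: tame1|apply: tameX; exact: tame_embedV].
  rewrite RecD RecN (_ : Re 1 = 1) //.
  have : normc ((E z)^-1 ^+ 4) <= 1 / 2.
    rewrite normcX normcV normc_embed; case/andP: fz => _ m10.
    have m0 : 0 < modulus z :> R by apply: lt_le_trans m10.
    have i0 : 0 <= (modulus z)^-1 :> R by rewrite invr_ge0 ltW.
    have i1 : (modulus z)^-1 <= 1 / 2 :> R.
      by rewrite -[1/2]invrK lef_pV2 ?posrE // ?invr_gt0 ?invf_div ?divr1; lra.
    rewrite exprS (le_trans _ i1) // ler_piMr // exprn_ile1 //; lra.
  by have := Re_le_normc ((E z)^-1 ^+ 4); rewrite ler_norml => /andP[_ a b]; lra.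
have t1 := tameM (tameD (tameB (tameD (tameB h0 h1) h2) h3) (tame1 R)) t4.
apply: eq_tame t1 => z fz /=.
have [r0 r1 r2 r3] : [/\ imoment 0 z + (E z)^-1 * imoment 1 z = moment 0 0 z,
  imoment 1 z + (E z)^-1 * imoment 2 z = moment 0 1 z,
  imoment 2 z + (E z)^-1 * imoment 3 z = moment 0 2 z &
  imoment 3 z + (E z)^-1 * imoment 4 z = moment 0 3 z].
  by split; exact: imoment_rec.
have r4 : imoment 4 z = imoment 0 z.
  rewrite /imoment (_ : I ^+ 4 = 1); last by rewrite (exprM _ 2 2) I_sqr; ring.
  rewrite (_ : (- I) ^+ 4 = 1); last by rewrite (exprM _ 2 2) sqrrN I_sqr; ring.
  by rewrite !expr0; ring.
rewrite -r0 -r1 -r2 -r3 r4.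
have n4 : 1 - (E z)^-1 ^+ 4 != 0.
  apply: contraTneq (fz) => h; apply/negP => /andP[_ m10].
  have : normc ((E z)^-1 ^+ 4) = 1.
    by rewrite (_ : _ ^+ 4 = 1) ?normc1 //; apply/esym/eqP; rewrite -subr_eq0 h.
  rewrite normcX normcV normc_embed => /eqP; rewrite pexpr_eq1 ?invr_ge0 ?modulus_ge0 //.
  by rewrite invr_eq1 => /eqP m1; move: m10; rewrite m1; lra.
move: (imoment 0 z) (imoment 1 z) (imoment 2 z) (imoment 3 z) => a b c d.
have e0 := E0 z fz; field.
rewrite e0 /=; apply: contraNneq n4 => h.
by rewrite exprVn subr_eq0 eq_sym invr_eq1 -subr_eq0 h.
Qed.

(** The imaginary part of z^(m + 1/2), harmonic in the slit plane and zero on the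
    slit. *)
Definition phi m z : R := Im (sqrtz R z ^+ m.*2.+1).

Lemma phi0 z : phi 0 z = Im_sqrt z.
Proof. by rewrite /phi expr1. Qed.

Let nbr_rootE e z : far z -> nbr_root R e z = nbr_ratio R e z * sqrtz R z.
Proof. by move=> fz; rewrite /nbr_ratio mulfVK // sqrtz_neq0 // far_off. Qed.

Lemma phi_step m e z : unit_steps e -> far z -> phi m (z + e) =
  Im (sqrtz R z * E z ^+ m * (nbr_ratio R e z * (nbr_ratio R e z ^+ 2) ^+ m)).
Proof.
move=> he fz; rewrite /phi -Im_nbr_rootX ?far_off // nbr_rootE //; congr Im.
rewrite exprS -mul2n exprM (exprMn 2 (nbr_ratio R e z)) sqrtz_sqr.
by rewrite (exprMn m (nbr_ratio R e z ^+ 2)); ring.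
Qed.

Lemma Im_sum4 (x y u v : C) :
  (Im x + Im y + Im u + Im v) / 4 = Im ((x + y + u + v) / 4).
Proof.
have -> : (x + y + u + v) / 4 = (1 / 4)%:C%C * (x + y + u + v).
  by rewrite cofrealM cofrealV (cofreal_nat R 4); field.
by rewrite Im_realM !ImcD; ring.
Qed.

Lemma nbr_avg_phi m z : far z ->
  nbr_avg (phi m) z = Im (sqrtz R z * E z ^+ m * moment m 0 z).
Proof.
move=> fz; have [hp hq hf hg] := ratio_sqrs fz.
rewrite /nbr_avg !phi_step // Im_sum4 -/p -/q -/f -/g hp hq hf hg; congr Im.
by rewrite /moment !expr0; ring.
Qed.

(** On harmonic functions the discrete and the continuous Laplacians agree to
    order four, whence the gain |z|^-4; tameness of the correction provides the
    factor Im (sqrt z). *)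
Lemma phi_laplacian_far m : exists2 K : R, 0 <= K & forall z, far z ->
  `|phi m z - nbr_avg (phi m) z| * modulus z ^+ 4 <= K * Im_sqrt z * modulus z ^+ m.
Proof.
have [h0 _ _ _] := moment_small m.
have [K K0 HK] := Im_power_tame m 4 h0; exists K => // z fz.
rewrite (le_trans _ (HK z fz)) // ler_wpM2r ?exprn_ge0 ?modulus_ge0 //.
rewrite nbr_avg_phi // /phi -ImcN -ImcD -normrN -ImcN le_eqVlt; apply/orP; left.
apply/eqP; congr (`|Im _|).
have e0 : E z != 0 by exact/embed_neq0/far_off.
rewrite exprS -mul2n exprM sqrtz_sqr.
by field.
Qed.

(** The function sin(arg z / 2) / |z|^(1/2) = - Im (z^(-1/2)), which measures the
    error in the theorem and is also harmonic in the slit plane. *)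
Definition beta z : R := Im_sqrt z / modulus z.

Lemma betaE z : beta z = - Im (sqrtz R z)^-1.
Proof.
rewrite ImcV normc_sqrtz sqr_sqrtr ?modulus_ge0 //.
by rewrite mulNr opprK.
Qed.

Lemma beta_step e z : unit_steps e -> far z -> beta (z + e) =
  - Im ((sqrtz R z)^-1 * (nbr_ratio R e z)^-1).
Proof.
move=> he fz; rewrite betaE -Im_nbr_rootV ?far_off // nbr_rootE //.
by rewrite invfM mulrC.
Qed.

Lemma Im_inv_tame Y n : tame Y -> exists2 K : R, 0 <= K & forall z, far z ->
  `|Im ((sqrtz R z)^-1 * ((E z)^-1 ^+ n * Y z))| * modulus z ^+ n.+1
    <= K * Im_sqrt z.
Proof.
move=> tY; have [K K0 HK] := Im_power_tame 0 n.+1 tY; exists K => // z fz.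
apply: (@le_trans _ _ (K * Im_sqrt z * modulus z ^+ 0)); last by rewrite expr0 mulr1.
rewrite (le_trans _ (HK z fz)) // ler_wpM2r ?exprn_ge0 ?modulus_ge0 //.
rewrite le_eqVlt; apply/orP; left; apply/eqP; congr (`|Im _|).
have w0 : sqrtz R z != 0 by exact/sqrtz_neq0/far_off.
have wE : sqrtz R z * (E z)^-1 = (sqrtz R z)^-1.
  by rewrite -sqrtz_sqr; field.
by rewrite expr0 (exprS _ n) mulr1 -!mulrA [in RHS]mulrA wE.
Qed.

Lemma nbr_avg_beta z : far z ->
  nbr_avg beta z = - Im ((sqrtz R z)^-1 * imoment 0 z).
Proof.
move=> fz; rewrite /nbr_avg !beta_step // -/p -/q -/f -/g -!opprD mulNr Im_sum4.
by congr (- Im _); rewrite /imoment !expr0; ring.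
Qed.

Lemma beta_laplacian_far : exists2 K : R, 0 <= K & forall z, far z ->
  `|beta z - nbr_avg beta z| * modulus z ^+ 5 <= K * Im_sqrt z.
Proof.
have [K K0 HK] := Im_inv_tame 4 imoment_small; exists K => // z fz.
rewrite (le_trans _ (HK z fz)) // ler_wpM2r ?exprn_ge0 ?modulus_ge0 //.
have sub (x y : C) : - Im x - - Im y = Im (y - x).
  by rewrite ImcD ImcN opprK addrC.
rewrite nbr_avg_beta // betaE sub.
rewrite le_eqVlt; apply/orP; left; apply/eqP; congr (`|Im _|).
have e0 : E z != 0 by exact/embed_neq0/far_off.
have w0 : sqrtz R z != 0 by exact/sqrtz_neq0/far_off.
by field; rewrite e0 w0.
Qed.

(** Each second difference, along one axis, has to be controlled with the factor
    Im (sqrt z): it multiplies the cubic terms of the Laplacian of beta^3. *)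
Lemma beta_second_difference : exists2 K : R, 0 <= K & forall z, far z ->
  `|beta (z + (1, 0)) + beta (z + (-1, 0)) - 2 * beta z| * modulus z ^+ 3
    <= K * Im_sqrt z /\
  `|beta (z + (0, 1)) + beta (z + (0, -1)) - 2 * beta z| * modulus z ^+ 3
    <= K * Im_sqrt z.
Proof.
have [tx ty] := inv_pair_small.
have [K K0 HK] := Im_inv_tame 2 tx; have [L L0 HL] := Im_inv_tame 2 ty.
have ImR2 (x y u : C) : - Im x + - Im y - 2 * - Im u = - Im (x + y - 2 * u).
  by rewrite !ImcD ImcN -(cofreal_nat R 2) Im_realM; ring.
exists (K + L) => [|z fz]; first by rewrite addr_ge0.
have e0 : E z != 0 by exact/embed_neq0/far_off.
have w0 : sqrtz R z != 0 by exact/sqrtz_neq0/far_off.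
have b0 := Im_sqrt_ge0 R z.
split.
- rewrite (@le_trans _ _ (K * Im_sqrt z)) // ?ler_wpM2r ?lerDl //.
  rewrite (le_trans _ (HK z fz)) // ler_wpM2r ?exprn_ge0 ?modulus_ge0 //.
  rewrite !beta_step // betaE -/p -/q ImR2 normrN.
  rewrite le_eqVlt; apply/orP; left; apply/eqP; congr (`|Im _|).
  move: (p z)^-1 (q z)^-1 => a b.
  by field; rewrite e0 w0.
- rewrite (@le_trans _ _ (L * Im_sqrt z)) // ?ler_wpM2r ?lerDr //.
  rewrite (le_trans _ (HL z fz)) // ler_wpM2r ?exprn_ge0 ?modulus_ge0 //.
  rewrite !beta_step // betaE -/f -/g ImR2 normrN.
  rewrite le_eqVlt; apply/orP; left; apply/eqP; congr (`|Im _|).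
  move: (f z)^-1 (g z)^-1 => a b.
  by field; rewrite e0 w0.
Qed.

End discrete_laplacian.

(** * A superharmonic function away from the origin *)

Section barrier_far.
Variable R : realType.
Implicit Types z e : Z2.
Local Notation C := R[i].
Local Notation far := (far R).
Local Notation E := (embed R).
Local Notation beta := (@beta R).

Lemma beta_ge0 z : 0 <= beta z.
Proof. by rewrite /beta divr_ge0 ?Im_sqrt_ge0 ?modulus_ge0. Qed.

Lemma Im_sqrt_le z : Im_sqrt z <= Num.sqrt (modulus z) :> R.
Proof.
by rewrite -normc_sqrtz (le_trans _ (Im_le_normc _)) // ler_norm.
Qed.

Lemma sqrt_le_modulus z : Num.sqrt (modulus z) <= modulus z :> R.
Proof.
have [->|z0] := eqVneq z 0; first by rewrite modulus0 sqrtr0.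
have m1 := modulus_ge1 R z0; rewrite -[leRHS]sqr_sqrtr ?modulus_ge0 // expr2.
by rewrite ler_peMl ?sqrtr_ge0 // -[leLHS]sqrtr1 ler_wsqrtr.
Qed.

Lemma beta_le1 z : beta z <= 1.
Proof.
have [->|z0] := eqVneq z 0; first by rewrite /beta modulus0 invr0 mulr0.
have m1 := modulus_ge1 R z0.
rewrite /beta ler_pdivrMr ?(lt_le_trans ltr01) // mul1r.
exact: le_trans (Im_sqrt_le z) (sqrt_le_modulus z).
Qed.

Lemma beta_increment e z : unit_steps e -> far z ->
  beta (z + e) - beta z = - Im ((sqrtz R z)^-1 * ((nbr_ratio R e z)^-1 - 1)).
Proof.
move=> he fz; rewrite beta_step // betaE.
rewrite opprK mulrBr mulr1 ImcD ImcN opprD opprK //.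
Qed.

Lemma normc_sqrtzV_sqr z : normc (sqrtz R z)^-1 ^+ 2 = (modulus z)^-1.
Proof. by rewrite normcV normc_sqrtz exprVn sqr_sqrtr ?modulus_ge0. Qed.

Lemma ratio_norm_ge e z : unit_steps e -> far z -> 9 / 10 <= normc (nbr_ratio R e z).
Proof.
move=> he fz; have := Re_near1 (ratio_close he fz).
have := Re_le_normc (nbr_ratio R e z); have := ler_norm (Re (nbr_ratio R e z)).
by lra.
Qed.

Lemma beta_increment_sqr e z : unit_steps e -> far z ->
  (beta (z + e) - beta z) ^+ 2 * modulus z ^+ 3 <= 2.
Proof.
move=> he fz; have [sz m10] := andP fz; have m0 : 0 < modulus z :> R.
  by apply: lt_le_trans m10.
have n9 := ratio_norm_ge he fz.
have u0 := ratio_neq0 he fz.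
rewrite beta_increment // sqrrN.
have d : normc ((nbr_ratio R e z)^-1 - 1) <= 10 / 9 * (modulus z)^-1.
  have -> : (nbr_ratio R e z)^-1 - 1 = - (nbr_ratio R e z)^-1 * (nbr_ratio R e z - 1).
    by field.
  rewrite normcM normc_opp normcV ler_pM ?invr_ge0 ?normc_ge0 //; last first.
    exact: nbr_ratio_near1.
  by rewrite -[10 / 9]invf_div lef_pV2 // posrE; lra.
set x := (X in Im X).
have : Im x ^+ 2 <= (modulus z)^-1 * (10 / 9 * (modulus z)^-1) ^+ 2.
  have h : `|Im x| ^+ 2 <= normc x ^+ 2.
    by rewrite ler_pXn2r ?nnegrE ?normc_ge0 ?normr_ge0 // Im_le_normc.
  rewrite -[leLHS]real_normK ?num_real // (le_trans h) //.
  rewrite /x normcM exprMn normc_sqrtzV_sqr ler_wpM2l ?invr_ge0 ?modulus_ge0 //.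
  by rewrite ler_pXn2r ?nnegrE ?normc_ge0 // mulr_ge0 ?invr_ge0 ?modulus_ge0.
rewrite -(ler_pM2r (exprn_gt0 3 m0)) => /le_trans; apply.
rewrite [leLHS](_ : _ = 100 / 81); first by lra.
by field; rewrite gt_eqF.
Qed.

(** 1/u - 1 = - (e t) / (u (u + 1)), and u is within 1/10 of 1. *)
Lemma ratioV_expand e z : unit_steps e -> far z ->
  exists2 h : C, normc h <= 1 / 5 &
  (nbr_ratio R e z)^-1 - 1 = - (E e * (E z)^-1 / 2 * (1 + h)).
Proof.
move=> he fz; set u := nbr_ratio R e z.
have u0 : u != 0 := ratio_neq0 he fz.
have [sz _] := andP fz.
have uc : normc (u - 1) <= 1 / 10 := ratio_close he fz.
have n9 : 9 / 10 <= normc u := ratio_norm_ge he fz.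
have n19 : 19 / 10 <= normc (u + 1).
  have := Re_near1 uc; have := Re_le_normc (u + 1); rewrite RecD (_ : Re 1 = 1) //.
  by have := ler_norm (Re u + 1); lra.
have u1 : u + 1 != 0.
  by apply: contraTneq n19 => ->; rewrite normc0 -ltNge; lra.
have u2 : normc (u + 2) <= 31 / 10.
  rewrite -[u + 2](_ : (u - 1) + 3 = _); last by ring.
  have := normcD_le (u - 1) 3; rewrite -[X in normc X + _]/(u - 1).
  have -> : normc (3 : C) = 3.
    by rewrite -(cofreal_nat R 3) normc_real ger0_norm.
  lra.
exists (2 / (u * (u + 1)) - 1); last first.
  rewrite [1 + _]addrC subrK.
  have -> : E e * (E z)^-1 = u ^+ 2 - 1 by rewrite /u nbr_ratio_sqr //; ring.
  by field; rewrite u0 u1.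
have -> : 2 / (u * (u + 1)) - 1 = - ((u - 1) * (u + 2)) / (u * (u + 1)).
  by field; rewrite u0 u1.
have n0 : 0 < normc u * normc (u + 1) by rewrite mulr_gt0; lra.
rewrite normcM normcV normc_opp (normcM (u - 1)) (normcM u) ler_pdivrMr //.
have h1 := ler_pM (normc_ge0 _) (normc_ge0 _) uc u2.
have h2 : 9 / 10 * (19 / 10) <= normc u * normc (u + 1).
  by apply: ler_pM => //; lra.
lra.
Qed.

(** The horizontal and vertical increments of Im z^(-1/2) are, up to a fifth, the
    imaginary part and the real part of one complex number K of modulus
    |z|^(-3/2) / 2, so that they cannot both be small. *)
Lemma beta_gradient_ge z : far z ->
  1 / 10 <= ((beta (z + (1, 0)) - beta z) ^+ 2 + (beta (z + (0, 1)) - beta z) ^+ 2) *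
            modulus z ^+ 3.
Proof.
move=> fz; have [sz m10] := andP fz; have m0 : 0 < modulus z :> R.
  by apply: lt_le_trans m10.
have s1 : unit_steps (1, 0) by do 3!left.
have si : unit_steps (0, 1) by left; right.
have [e1 _ e3 _] := embed_steps R.
have [h hn hE] := ratioV_expand s1 fz.
have [k kn kE] := ratioV_expand si fz.
rewrite !beta_increment // hE kE e1 e3 !sqrrN.
set K := (sqrtz R z)^-1 * ((E z)^-1 / 2).
have -> : (sqrtz R z)^-1 * - (1 * (E z)^-1 / 2 * (1 + h)) = - (K + K * h).
  by rewrite /K; ring.
have -> : (sqrtz R z)^-1 * - (Complex 0 1 * (E z)^-1 / 2 * (1 + k)) =
    - (Complex 0 1 * K + Complex 0 1 * K * k) by rewrite /K; ring.
rewrite !ImcN !sqrrN !ImcD.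
have nK : normc K ^+ 2 * modulus z ^+ 3 = 1 / 4.
  rewrite /K normcM exprMn normc_sqrtzV_sqr normcM !normcV normc_embed.
  rewrite -(cofreal_nat R 2) normc_real ger0_norm //.
  by field; rewrite gt_eqF.
have iK : Im (Complex 0 1 * K) = Re K by rewrite ImcM /= mul0r mul1r add0r.
have bound (a b : C) : normc a = normc K -> normc b <= 1 / 5 ->
    Im (a * b) ^+ 2 <= normc K ^+ 2 / 25.
  move=> an bn.
  have : `|Im (a * b)| <= normc K / 5.
    rewrite (le_trans (Im_le_normc _)) // normcM an ler_wpM2l ?normc_ge0 //.
    by rewrite (le_trans bn) //; lra.
  rewrite -(ler_pXn2r (n := 2)) ?nnegrE ?divr_ge0 ?normc_ge0 //.
  rewrite real_normK ?num_real // => /le_trans; apply.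
  by rewrite exprMn; lra.
have bh := bound K h erefl hn.
have ni : normc (Complex 0 1 * K) = normc K.
  by rewrite normcM /normc /= expr0n expr1n add0r sqrtr1 mul1r.
have bk := bound (Complex 0 1 * K) k ni kn.
rewrite iK; move: bh bk nK (normc_sqr K).
set x := Im (K * h); set y := Im (_ * k); set a := Re K; set b := Im K.
set n := normc K ^+ 2; set r := modulus z ^+ 3 => bh bk nK nE.
have r0 : 0 < r by rewrite exprn_gt0.
have low : n * (42 / 100) <= (b + x) ^+ 2 + (a + y) ^+ 2.
  have : 0 <= (b + 2 * x) ^+ 2 + (a + 2 * y) ^+ 2 by rewrite addr_ge0 ?sqr_ge0.
  by rewrite nE in bh bk *; nra.
have := ler_wpM2r (ltW r0) low; rewrite mulrAC nK; lra.
Qed.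

(** A function comparable to beta whose Laplacian beats all the errors.  In the
    Laplacian of beta^3 the term 6 beta |grad beta|^2 has size
    Im (sqrt z) / |z|^4, one power of |z| above the error made on the harmonic
    part 2 beta. *)
Definition barrier z : R := 2 * beta z - beta z ^+ 3.

(** Expanding (beta + delta)^3 over the four increments: the mean of delta is small
    by beta_laplacian_far, the mean of delta^2 is bounded below by
    beta_gradient_ge, and the mean of delta^3 is small once opposite steps are
    paired. *)
Lemma barrier_laplacian_far : exists r0 : R, forall z, far z -> r0 <= modulus z ->
  1 / 40 * Im_sqrt z <= (barrier z - nbr_avg barrier z) * modulus z ^+ 4.
Proof.
have [K K0 HK] := beta_laplacian_far R.
have [L L0 HL] := beta_second_difference R.
exists (1 + 40 * (2 * K + 3 * L)) => z fz mr.
have [sz m10] := andP fz; have m0 : 0 < modulus z :> R by apply: lt_le_trans m10.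
have b0 := Im_sqrt_ge0 R z; have hK := HK z fz; have [hx hy] := HL z fz.
have g := beta_gradient_ge fz.
have s1 : unit_steps (1, 0) by do 3!left.
have s2 : unit_steps (-1, 0) by do 2!left; right.
have s3 : unit_steps (0, 1) by left; right.
have s4 : unit_steps (0, -1) by right.
have q1 := beta_increment_sqr s1 fz; have q2 := beta_increment_sqr s2 fz.
have q3 := beta_increment_sqr s3 fz; have q4 := beta_increment_sqr s4 fz.
have B0 := beta_ge0 z; have B1 := beta_le1 z.
have BE : beta z * modulus z = Im_sqrt z by rewrite /beta mulfVK // gt_eqF.
move: hK hx hy g q1 q2 q3 q4; rewrite /barrier /nbr_avg.
set c := beta z in B0 B1 BE *; set c1 := beta (z + (1, 0)).
set c2 := beta (z + (-1, 0)); set c3 := beta (z + (0, 1)); set c4 := beta (z + (0, -1)).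
set r := modulus z in m0 mr BE *; set b := Im_sqrt z in b0 BE *.
move=> hK hx hy g q1 q2 q3 q4; clearbody c c1 c2 c3 c4 r b.
pose d1 := c1 - c; pose d2 := c2 - c; pose d3 := c3 - c; pose d4 := c4 - c.
have -> : 2 * c - c ^+ 3 - (2 * c1 - c1 ^+ 3 + (2 * c2 - c2 ^+ 3) +
    (2 * c3 - c3 ^+ 3) + (2 * c4 - c4 ^+ 3)) / 4 =
  (2 - 3 * c ^+ 2) * (c - (c1 + c2 + c3 + c4) / 4) +
  3 * c * ((d1 ^+ 2 + d2 ^+ 2 + d3 ^+ 2 + d4 ^+ 2) / 4) +
  ((d1 + d2) * (d1 ^+ 2 - d1 * d2 + d2 ^+ 2) +
     (d3 + d4) * (d3 ^+ 2 - d3 * d4 + d4 ^+ 2)) / 4.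
  by rewrite /d1 /d2 /d3 /d4; field.
rewrite -/d1 -/d3 in g; rewrite -/d1 in q1; rewrite -/d2 in q2.
rewrite -/d3 in q3; rewrite -/d4 in q4.
have r30 : 0 < r ^+ 3 by rewrite exprn_gt0.
have r1 : 1 <= r by lra.
have t1 : - (2 * K * b) <= (2 - 3 * c ^+ 2) * (c - (c1 + c2 + c3 + c4) / 4) * r ^+ 5.
  set v := c - _ in hK *.
  have : `|(2 - 3 * c ^+ 2) * v * r ^+ 5| <= 2 * (K * b).
    rewrite -mulrA normrM ler_pM ?normr_ge0 //; last first.
      by rewrite normrM [`|r ^+ 5|]ger0_norm // exprn_ge0 // ltW.
    by rewrite ler_norml; clear -B0 B1; apply/andP; split; nra.
  by rewrite ler_norml => /andP[]; lra.
have t2 : 3 / 40 * b <= 3 * c * ((d1 ^+ 2 + d2 ^+ 2 + d3 ^+ 2 + d4 ^+ 2) / 4) * r ^+ 4.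
  rewrite -BE; rewrite [leRHS](_ : _ = c * r * (3 / 4) *
    ((d1 ^+ 2 + d3 ^+ 2) * r ^+ 3 + (d2 ^+ 2 + d4 ^+ 2) * r ^+ 3)); last by field.
  rewrite [leLHS](_ : _ = c * r * (3 / 4) * (1 / 10)); last by field.
  rewrite ler_wpM2l ?mulr_ge0 ?(ltW m0) //.
  have : 0 <= (d2 ^+ 2 + d4 ^+ 2) * r ^+ 3.
    by rewrite mulr_ge0 ?addr_ge0 ?sqr_ge0 // ltW.
  by clear -g; lra.
(* d1^3 + d2^3 = (d1 + d2) (d1^2 - d1 d2 + d2^2), where the first factor is a
   second difference. *)
have cub (x y : R) : x ^+ 2 * r ^+ 3 <= 2 -> y ^+ 2 * r ^+ 3 <= 2 ->
    `|x + y| * r ^+ 3 <= L * b ->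
    - (6 * L * b) <= (x + y) * (x ^+ 2 - x * y + y ^+ 2) * r ^+ 6.
  move=> hx' hy' hs.
  have : `|(x + y) * (x ^+ 2 - x * y + y ^+ 2) * r ^+ 6| <= L * b * 6.
    rewrite [X in `|X|](_ : _ = ((x + y) * r ^+ 3) *
      ((x ^+ 2 - x * y + y ^+ 2) * r ^+ 3)); last by ring.
    rewrite normrM ler_pM ?normr_ge0 //.
      by rewrite normrM [`|r ^+ 3|]ger0_norm // ltW.
    have e0 : 0 <= x ^+ 2 - x * y + y ^+ 2.
      have := sqr_ge0 (x - y); have := sqr_ge0 x; have := sqr_ge0 y.
      by clear; lra.
    rewrite ger0_norm; last by apply: mulr_ge0 => //; exact: ltW.
    have : x ^+ 2 - x * y + y ^+ 2 <= (3 / 2) * (x ^+ 2 + y ^+ 2).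
      by have := sqr_ge0 (x + y); clear; lra.
    by move/(ler_wpM2r (ltW r30)); clear -hx' hy'; lra.
  by rewrite ler_norml => /andP[]; clear; lra.
have t3 := cub d1 d2 q1 q2; have t4 := cub d3 d4 q3 q4.
have {}t3 : - (6 * L * b) <= (d1 + d2) * (d1 ^+ 2 - d1 * d2 + d2 ^+ 2) * r ^+ 6.
  by apply: t3; rewrite (_ : d1 + d2 = c1 + c2 - 2 * c) // /d1 /d2; ring.
have {}t4 : - (6 * L * b) <= (d3 + d4) * (d3 ^+ 2 - d3 * d4 + d4 ^+ 2) * r ^+ 6.
  by apply: t4; rewrite (_ : d3 + d4 = c3 + c4 - 2 * c) // /d3 /d4; ring.
move: t1 t2 t3 t4.
set X1 := (2 - 3 * c ^+ 2) * _; set X2 := 3 * c * _.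
set X3 := (d1 + d2) * _; set X4 := (d3 + d4) * _ => t1 t2 t3 t4.
have u1 : - (2 * K * b) <= X1 * r ^+ 4 * r.
  by rewrite [leRHS](_ : _ = X1 * r ^+ 5) //; ring.
have w3 (X : R) : - (6 * L * b) <= X * r ^+ 6 -> - (6 * L * b) <= X * r ^+ 4 * r.
  move=> h; rewrite -(ler_pM2r m0) [leRHS](_ : _ = X * r ^+ 6); last by ring.
  by apply: le_trans h; rewrite mulNr lerN2 ler_peMr // !mulr_ge0.
have u3 := w3 _ t3; have u4 := w3 _ t4.
rewrite -(ler_pM2r m0).
have bc : (2 * K + 3 * L) * b * 40 <= b * r.
  rewrite [leLHS](_ : _ = b * (40 * (2 * K + 3 * L))); last by ring.
  by rewrite ler_wpM2l //; clear -mr; lra.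
have u2 := ler_wpM2r (ltW m0) t2.
move: u1 u2 u3 u4 bc.
rewrite [X in _ -> _ -> _ -> _ -> _ -> _ <= X](_ : _ =
  X1 * r ^+ 4 * r + X2 * r ^+ 4 * r + (X3 * r ^+ 4 * r + X4 * r ^+ 4 * r) / 4);
  last by field.
move: (X1 * r ^+ 4 * r) (X2 * r ^+ 4 * r) (X3 * r ^+ 4 * r) (X4 * r ^+ 4 * r).
have br : 0 <= b * r by rewrite mulr_ge0 // ltW.
by move=> y1 y2 y3 y4; clear -br; lra.
Qed.

End barrier_far.

(** * The barrier and the harmonic square root *)

Section lattice_box.
Variable R : realType.
Implicit Types z : Z2.

Definition box (n : nat) : seq Z2 :=
  [seq (x, y) | x <- [seq (k%:Z - n%:Z)%R | k <- iota 0 n.*2.+1],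
                y <- [seq (k%:Z - n%:Z)%R | k <- iota 0 n.*2.+1]].

Lemma mem_box n z : (`|z.1| <= n)%N -> (`|z.2| <= n)%N -> z \in box n.
Proof.
have H (x : int) : (`|x| <= n)%N -> x \in [seq (k%:Z - n%:Z)%R | k <- iota 0 n.*2.+1].
  move=> xn; apply/mapP; exists (absz (x + n%:Z)); first by rewrite mem_iota; lia.
  lia.
case: z => x y /= hx hy; apply/allpairsP; exists (x, y) => /=.
by split=> //; exact: H.
Qed.

Lemma modulus_box (r : R) : exists n, forall z, modulus z < r ->
  (`|z.1| <= n)%N /\ (`|z.2| <= n)%N.
Proof.
exists (Num.bound r) => z zr.
have r0 : 0 <= r by exact: le_trans (modulus_ge0 _ z) (ltW zr).
have rn : r < (Num.bound r)%:R by rewrite archi_boundP.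
have coord (x : int) : `|x%:~R| <= modulus z :> R -> (`|x|%N <= Num.bound r)%N.
  move=> h; rewrite -(ler_nat R) natr_absz -intr_norm in h *.
  exact: le_trans h (ltW (lt_trans zr rn)).
split; apply: coord; rewrite -normc_embed.
  exact: Re_le_normc (embed R z).
exact: Im_le_normc (embed R z).
Qed.

(** Used to absorb the finitely many points near the origin into the constants of
    estimates valid far away. *)
Lemma bounded_in_disc (f : Z2 -> R) (r : R) :
  exists2 K : R, 0 <= K & forall z, modulus z < r -> f z <= K.
Proof.
have [n Hn] := modulus_box r.
exists (\sum_(z <- box n) `|f z|); first by rewrite sumr_ge0.
move=> z /Hn[h1 h2]; rewrite (le_trans (ler_norm _)) //.
rewrite (big_rem z) ?mem_box //=.
by rewrite lerDl sumr_ge0.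
Qed.

Lemma seq_argmax (T : eqType) (s : seq T) (f : T -> R) x0 : x0 \in s ->
  exists2 x, x \in s & forall y, y \in s -> f y <= f x.
Proof.
elim: s x0 => // a s IH x0 _.
have [->|[b bs]] : s = [::] \/ exists b, b \in s.
  by case: (s) => [|b t]; [left|right; exists b; rewrite mem_head].
  by exists a; rewrite ?mem_head // => y; rewrite inE => /eqP ->.
have [c cs cM] := IH b bs.
have [ac|ca] := leP (f a) (f c).
  exists c; first by rewrite inE cs orbT.
  by move=> y; rewrite inE => /orP[/eqP ->//|]; exact: cM.
exists a; rewrite ?mem_head // => y; rewrite inE => /orP[/eqP ->//|/cM].
by move/le_trans; apply; exact: ltW.
Qed.

End lattice_box.

Section averages.
Variable R : realType.
Implicit Types (z e : Z2) (f g : Z2 -> R).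

Lemma nbr_avg_le f g z :
  (forall e, unit_steps e -> f (z + e) <= g (z + e)) -> nbr_avg f z <= nbr_avg g z.
Proof.
move=> h; rewrite /nbr_avg ler_pM2r ?invr_gt0 // !lerD // h //.
- by do 3!left.
- by do 2!left; right.
- by left; right.
- by right.
Qed.

Lemma nbr_avg_lin (a c : R) f g z :
  nbr_avg (fun y => a * f y + c * g y) z = a * nbr_avg f z + c * nbr_avg g z.
Proof. by rewrite /nbr_avg; field. Qed.

Lemma nbr_avgZ (a : R) f z : nbr_avg (fun y => a * f y) z = a * nbr_avg f z.
Proof. by rewrite /nbr_avg; field. Qed.

Lemma nbr_avg_cst (a : R) z : nbr_avg (fun=> a) z = a.
Proof. by rewrite /nbr_avg; field. Qed.

Lemma nbr_avgD f g z :
  nbr_avg (fun y => f y + g y) z = nbr_avg f z + nbr_avg g z.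
Proof. by rewrite /nbr_avg; field. Qed.

Lemma nbr_avgB f g z :
  nbr_avg (fun y => f y - g y) z = nbr_avg f z - nbr_avg g z.
Proof. by rewrite /nbr_avg; field. Qed.

Lemma nbr_avg_sum n (F : nat -> Z2 -> R) z :
  nbr_avg (fun y => \sum_(i < n) F i y) z = \sum_(i < n) nbr_avg (F i) z.
Proof.
elim: n => [|n IH]; first by rewrite /nbr_avg !big_ord0; field.
rewrite big_ord_recr /= -IH -nbr_avgD.
by congr (_ / 4); rewrite !big_ord_recr.
Qed.

Lemma nbr_avg_ge0 f z : (forall y, 0 <= f y) -> 0 <= nbr_avg f z.
Proof. by move=> f0; rewrite /nbr_avg divr_ge0 // !addr_ge0. Qed.

(** The transition operator of the walk killed on the half-line. *)
Definition killed f z : R := if slit z then 0 else nbr_avg f z.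

Lemma killed_off f z : ~~ slit z -> killed f z = nbr_avg f z.
Proof. by rewrite /killed => /negbTE ->. Qed.

Lemma killed_slit f z : slit z -> killed f z = 0.
Proof. by rewrite /killed => ->. Qed.

Lemma killed_le f g z : (forall y, f y <= g y) -> killed f z <= killed g z.
Proof.
by move=> h; rewrite /killed; case: ifP => // _; apply: nbr_avg_le => e _.
Qed.

End averages.

Section barrier.
Variable R : realType.
Implicit Types (z e : Z2) (f g : Z2 -> R).
Local Notation far := (far R).
Local Notation beta := (@beta R).
Local Notation barrier := (@barrier R).

Lemma extend_far (F G : Z2 -> R) : (forall z, ~~ slit z -> 0 < G z) ->
  (exists2 K : R, 0 <= K & forall z, far z -> F z <= K * G z) ->
  exists2 K : R, 0 <= K & forall z, ~~ slit z -> F z <= K * G z.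
Proof.
move=> G0 [K K0 HK]; have [L L0 HL] := bounded_in_disc (fun z => F z / G z) 10.
exists (K + L) => [|z sz]; first by rewrite addr_ge0.
have g0 := G0 z sz; rewrite mulrDl.
have [m10|m10] := leP 10 (modulus z : R).
  by rewrite (le_trans (HK z _)) /far ?sz ?m10 // lerDl mulr_ge0 // ltW.
have := HL z m10; rewrite ler_pdivrMr // => /le_trans; apply.
by rewrite lerDr mulr_ge0 // ltW.
Qed.

Lemma phi_laplacian m : exists2 K : R, 0 <= K & forall z, ~~ slit z ->
  `|phi R m z - nbr_avg (phi R m) z| * modulus z ^+ 4
    <= K * (Im_sqrt z * modulus z ^+ m).
Proof.
apply: extend_far => [z sz|].
  rewrite mulr_gt0 ?Im_sqrt_gt0 // exprn_gt0 // (lt_le_trans ltr01) //.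
  exact: modulus_off_slit.
have [K K0 HK] := phi_laplacian_far R m; exists K => // z fz.
by rewrite mulrA; exact: HK.
Qed.

(** The probability that the walk started at z avoids the half-line up to time
    n. *)
Definition survive n z : R := iter n (@killed R) (fun y => (~~ slit y)%:R) z.

Lemma survive_ge0 n z : 0 <= survive n z.
Proof.
elim: n z => [|n IH] z; first exact: ler0n.
rewrite /survive iterS /killed; case: ifP => // _; exact: nbr_avg_ge0.
Qed.

Lemma survive_le1 n z : survive n z <= 1.
Proof.
elim: n z => [|n IH] z; first by rewrite /survive /=; case: slit.
rewrite /survive iterS /killed; case: ifP => // _.
by rewrite -[leRHS](nbr_avg_cst 1 z); apply: nbr_avg_le => e _; exact: IH.
Qed.

(** The walk goes straight to the origin with probability at least 4^-n. *)
Lemma survive_lt1 n z : (`|z.1| + `|z.2| <= n)%N -> survive n z <= 1 - 4^-1 ^+ n.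
Proof.
elim: n z => [|n IH] z hz.
  have -> : z = 0 by case: z hz => x y /= h; congr (_, _); lia.
  by rewrite /survive /= expr0 subrr.
have p1 : 4^-1 ^+ n.+1 <= 1 :> R by rewrite exprn_ile1 // invf_le1 // ler1n.
rewrite /survive iterS /killed; case: ifP => [_|/negbT sz]; first by rewrite subr_ge0.
rewrite -/(survive n).
have [b [c [d [a [-> h]]]]] : exists a b c d, nbr_avg (survive n) z =
    (survive n a + survive n b + survive n c + survive n d) / 4 /\
    (`|d.1| + `|d.2| <= n)%N.
  rewrite /nbr_avg.
  have [x0|x0|x0] := ltgtP z.1 0.
  - exists (z + (-1, 0)), (z + (0, 1)), (z + (0, -1)), (z + (1, 0)).
    split; last by move: hz x0; case: z {sz} => x y /=; lia.
    by congr (_ / 4); ring.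
  - exists (z + (1, 0)), (z + (0, 1)), (z + (0, -1)), (z + (-1, 0)).
    split; last by move: hz x0; case: z {sz} => x y /=; lia.
    by congr (_ / 4); ring.
  have [y0|y0|y0] := ltgtP z.2 0.
  - exists (z + (1, 0)), (z + (-1, 0)), (z + (0, -1)), (z + (0, 1)).
    split; last by move: hz y0; case: z {sz x0} => x y /=; lia.
    by congr (_ / 4); ring.
  - exists (z + (1, 0)), (z + (-1, 0)), (z + (0, 1)), (z + (0, -1)).
    by split; last by move: hz y0; case: z {sz x0} => x y /=; lia.
  by move: sz; rewrite /slit x0 y0 lexx eqxx.
have := IH _ h; have := survive_le1 n b; have := survive_le1 n c.
have := survive_le1 n d; rewrite exprS => h1 h2 h3 h4.
by rewrite ler_pdivrMr //; lra.
Qed.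

(** A multiple of the expected lifetime of the killed walk, truncated at N. *)
Definition local_barrier N z : R := 4 ^+ N * \sum_(n < N) survive n z.

Lemma local_barrier_ge0 N z : 0 <= local_barrier N z.
Proof.
by rewrite mulr_ge0 ?exprn_ge0 // sumr_ge0 // => i _; exact: survive_ge0.
Qed.

(** The sum telescopes.  The right-hand side is 4^N times the probability of
    being killed by time N, hence at least 1 at the points within N steps of
    the origin, and nonnegative everywhere. *)
Lemma local_barrier_laplacian N z : ~~ slit z ->
  local_barrier N z - nbr_avg (local_barrier N) z = 4 ^+ N * (1 - survive N z).
Proof.
move=> sz; rewrite /local_barrier nbr_avgZ nbr_avg_sum -mulrBr; congr (_ * _).
have -> : \sum_(i < N) nbr_avg (survive i) z = \sum_(i < N) survive i.+1 z.
  by apply: eq_bigr => i _; rewrite /survive iterS killed_off.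
have -> : 1 = survive 0 z by rewrite /survive /= sz.
elim: N => [|N IH]; first by rewrite !big_ord0 !subrr.
by rewrite !big_ord_recr /=; lra.
Qed.

Lemma barrier_ge_beta z : beta z <= barrier z.
Proof.
rewrite /barrier; have b0 := beta_ge0 R z; have b1 := beta_le1 R z.
have : beta z ^+ 3 <= beta z.
  by rewrite -[leRHS]mulr1 exprS ler_wpM2l // exprn_ile1.
lra.
Qed.

Lemma barrier_le_beta z : barrier z <= 2 * beta z.
Proof. by rewrite /barrier gerBl exprn_ge0 ?beta_ge0. Qed.

Lemma beta_gt0 z : ~~ slit z -> 0 < beta z.
Proof.
move=> sz; rewrite /beta divr_gt0 ?Im_sqrt_gt0 //.
by rewrite (lt_le_trans ltr01) ?modulus_off_slit.
Qed.

Lemma beta_slit z : slit z -> beta z = 0.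
Proof. by move=> sz; rewrite /beta Im_sqrt_slit // mul0r. Qed.

(** Superharmonicity of barrier fails near the origin.  It is restored by adding a
    multiple of q, the minimum of local_barrier and of a large multiple of
    barrier: there q is local_barrier, whose Laplacian is at most -1; elsewhere
    it is a minimum of superharmonic functions, and it stays below a multiple
    of beta. *)
Lemma barrier_global : exists (Psi : Z2 -> R) (K : R), [/\ 0 <= K,
  forall z, 0 <= Psi z <= K * beta z &
  forall z, ~~ slit z -> Im_sqrt z / modulus z ^+ 4 <= Psi z - nbr_avg Psi z].
Proof.
have [r0 Hr0] := barrier_laplacian_far R.
pose r1 := Num.max 10 r0.
have [n Hn] := modulus_box r1.
pose N := (n + n)%N.
have [M M0 HM] := bounded_in_disc (fun z => local_barrier N z / barrier z) r1.
pose q z := Num.min (local_barrier N z) (M * barrier z).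
have bar0 z : 0 <= barrier z := le_trans (beta_ge0 R z) (barrier_ge_beta z).
have bar_gt0 z : ~~ slit z -> 0 < barrier z.
  by move=> sz; exact: lt_le_trans (beta_gt0 sz) (barrier_ge_beta z).
have q0 z : 0 <= q z.
  by rewrite le_min local_barrier_ge0 mulr_ge0.
have q_le z : q z <= M * barrier z by rewrite ge_min lexx orbT.
have q_le' z : q z <= local_barrier N z by rewrite ge_min lexx.
have q_in z : ~~ slit z -> modulus z < r1 -> 1 <= q z - nbr_avg q z.
  move=> sz zr.
  have qE : q z = local_barrier N z.
    by apply/min_idPl; have := HM z zr; rewrite ler_pdivrMr ?bar_gt0.
  have : nbr_avg q z <= nbr_avg (local_barrier N) z by apply: nbr_avg_le => e _.
  have := local_barrier_laplacian N sz.
  have : survive N z <= 1 - 4^-1 ^+ N.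
    by apply: survive_lt1; have [a b] := Hn z zr; rewrite leq_add.
  have p4 : 4 ^+ N * 4^-1 ^+ N = 1 :> R by rewrite -exprMn divff ?expr1n.
  have p0 : 0 < 4 ^+ N :> R by rewrite exprn_gt0.
  move=> h1 h2 h3; rewrite qE.
  have : 1 <= 4 ^+ N * (1 - survive N z).
    by rewrite -[leLHS]p4 ler_pM2l //; lra.
  lra.
have q_out z : ~~ slit z -> r1 <= modulus z -> 0 <= q z - nbr_avg q z.
  move=> sz zr; rewrite subr_ge0 le_min; apply/andP; split.
    have : nbr_avg q z <= nbr_avg (local_barrier N) z by apply: nbr_avg_le => e _.
    have := local_barrier_laplacian N sz.
    have : 0 <= 4 ^+ N * (1 - survive N z).
      by rewrite mulr_ge0 ?exprn_ge0 // subr_ge0 survive_le1.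
    lra.
  have : nbr_avg q z <= M * nbr_avg barrier z.
    by rewrite -nbr_avgZ; apply: nbr_avg_le => e _.
  move/le_trans; apply; rewrite ler_wpM2l //.
  move: zr; rewrite ge_max => /andP[m10 mr0].
  have fz : far z by rewrite /far sz.
  have := Hr0 z fz mr0.
  have := Im_sqrt_ge0 R z => b0 h.
  have m4 : 0 < modulus z ^+ 4 :> R by rewrite exprn_gt0 // (lt_le_trans _ m10).
  by rewrite -subr_ge0 -(pmulr_lge0 _ m4); lra.
have [T T0 HT] := bounded_in_disc
  (fun z => Im_sqrt z / modulus z ^+ 4 - 40 * (barrier z - nbr_avg barrier z)) r1.
exists (fun z => 40 * barrier z + T * q z), (80 + T * M * 2); split.
- by rewrite addr_ge0 // !mulr_ge0.
- move=> z; rewrite addr_ge0 ?mulr_ge0 //=.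
  have h1 := barrier_le_beta z.
  have h2 := le_trans (q_le z) (ler_wpM2l M0 h1).
  have := ler_wpM2l T0 h2; lra.
move=> z sz; rewrite nbr_avg_lin.
have [zr|zr] := ltP (modulus z) r1.
  have := HT z zr; have := ler_wpM2l T0 (q_in z sz zr); lra.
have := mulr_ge0 T0 (q_out z sz zr).
move: zr; rewrite ge_max => /andP[m10 mr0].
have fz : far z by rewrite /far sz.
have m4 : 0 < modulus z ^+ 4 :> R by rewrite exprn_gt0 // (lt_le_trans _ m10).
have : Im_sqrt z / modulus z ^+ 4 <= 40 * (barrier z - nbr_avg barrier z).
  by rewrite ler_pdivrMr //; have := Hr0 z fz mr0; lra.
lra.
Qed.

(** The Laplacian of Im (sqrt z) is dominated by that of C Psi, so that
    Im (sqrt z) + C Psi decreases and Im (sqrt z) - C Psi increases under the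
    iterates of the killed walk.  The limit of the former is harmonic and
    trapped between the two. *)
Lemma harmonic_sqrt : exists (h : Z2 -> R) (K : R), [/\ 0 <= K,
  forall z, slit z -> h z = 0,
  forall z, ~~ slit z -> h z = nbr_avg h z &
  forall z, `|h z - Im_sqrt z| <= K * beta z].
Proof.
have [Psi [L [L0 PsiB PsiL]]] := barrier_global.
have [C C0 HC] := phi_laplacian 0.
have Psi0 z : 0 <= Psi z by have /andP[] := PsiB z.
have Psi_slit z : slit z -> Psi z = 0.
  move=> sz; apply/eqP; rewrite eq_le Psi0 andbT.
  by have /andP[_] := PsiB z; rewrite beta_slit // mulr0.
have lap z : ~~ slit z ->
    `|phi R 0 z - nbr_avg (phi R 0) z| <= C * (Psi z - nbr_avg Psi z).
  move=> sz; apply: le_trans (ler_wpM2l C0 (PsiL z sz)).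
  have m4 : 0 < modulus z ^+ 4 :> R.
    by rewrite exprn_gt0 // (lt_le_trans ltr01) // modulus_off_slit.
  by rewrite mulrA ler_pdivlMr //; have := HC z sz; rewrite expr0 mulr1.
pose up z := phi R 0 z + C * Psi z; pose lo z := phi R 0 z - C * Psi z.
have phi_slit z : slit z -> phi R 0 z = 0 by move=> sz; rewrite phi0 Im_sqrt_slit.
have Qup z : killed up z <= up z.
  have [sz|sz] := boolP (slit z).
    by rewrite killed_slit // /up phi_slit // Psi_slit // mulr0 addr0.
  rewrite killed_off // /up nbr_avgD nbr_avgZ.
  by have := lap z sz; rewrite ler_norml => /andP[]; lra.
have Qlo z : lo z <= killed lo z.
  have [sz|sz] := boolP (slit z).
    by rewrite killed_slit // /lo phi_slit // Psi_slit // mulr0 subr0.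
  rewrite killed_off // /lo nbr_avgB nbr_avgZ.
  by have := lap z sz; rewrite ler_norml => /andP[]; lra.
pose f n z := iter n (@killed R) up z.
have f_dec n z : f n.+1 z <= f n z.
  by elim: n z => [|n IH] z; [exact: Qup|rewrite /f !(iterS n.+1) !iterS; exact: killed_le].
have f_lo n z : lo z <= f n z.
  elim: n z => [|n IH] z.
    by rewrite /f /= /lo /up lerD2l; have := mulr_ge0 C0 (Psi0 z); lra.
  by apply: le_trans (Qlo z) _; exact: killed_le.
have f_cvg z : cvgn (fun n => f n z).
  apply: nonincreasing_is_cvgn; last by exists (lo z) => _ [n _ <-].
  by apply/nonincreasing_seqP => n; exact: f_dec.
pose h z : R := limn (fun n => f n z).
have hcvg z : f n z @[n --> \oo] --> h z by exact: f_cvg.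
have avg_cvg z : nbr_avg (f n) z @[n --> \oo] --> nbr_avg h z.
  rewrite /nbr_avg; apply: cvgM; last exact: cvg_cst.
  apply: cvgD; last exact: hcvg.
  apply: cvgD; last exact: hcvg.
  by apply: cvgD; exact: hcvg.
exists h, (C * L); split.
- by rewrite mulr_ge0.
- move=> z sz; apply/cvg_lim => //; rewrite -(cvg_shiftn 1) /=.
  under eq_fun do rewrite addn1 /f iterS killed_slit //.
  exact: cvg_cst.
- move=> z sz; apply/cvg_lim => //; rewrite -(cvg_shiftn 1) /=.
  under eq_fun do rewrite addn1 /f iterS killed_off //.
  exact: avg_cvg.
move=> z; have /andP[_ PB] := PsiB z.
have CP := ler_wpM2l C0 PB.
have h1 : h z <= up z.
  rewrite /h; apply: limr_le => //; apply: nearW => n.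
  by elim: n => [|n IH] //; exact: le_trans (f_dec n z) IH.
have h2 : lo z <= h z by apply: limr_ge => //; apply: nearW.
by move: h1 h2; rewrite /up /lo phi0 ler_norml => h1 h2; apply/andP; split; lra.
Qed.

End barrier.

(** * Maximum principle and logarithmic potential *)

Section maximum_principle.
Variable R : realType.
Implicit Types (z : Z2) (r : R).

Lemma modulus_sqr_avg z :
  nbr_avg (fun y => modulus y ^+ 2 : R) z = modulus z ^+ 2 + 1.
Proof.
rewrite /nbr_avg !modulus_sqr; case: z => x y /=.
by rewrite !(rmorphD, rmorphN) /= ?rmorph0 ?rmorph1; field.
Qed.

Lemma maximum_principle r (f : Z2 -> R) :
  (forall z, ~~ slit z -> modulus z < r -> f z <= nbr_avg f z) ->
  (forall z, modulus z < r + 1 -> slit z || (r <= modulus z) -> f z <= 0) ->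
  forall z, modulus z < r + 1 -> f z <= 0.
Proof.
move=> sub bd z0 z0r; rewrite leNgt; apply/negP => fz0.
have r1 : 0 < r + 1 := le_lt_trans (modulus_ge0 R z0) z0r.
pose eps := f z0 / (2 * (r + 1) ^+ 2).
have eps0 : 0 < eps by rewrite divr_gt0 // mulr_gt0 // exprn_gt0.
have epsE : eps * (r + 1) ^+ 2 = f z0 / 2.
  by rewrite /eps; field; rewrite gt_eqF.
(* A small multiple of |z|^2 makes the function strictly subharmonic, which
   forbids an interior maximum. *)
pose g z := f z + eps * (modulus z ^+ 2 - (r + 1) ^+ 2).
have sqlt z : modulus z < r + 1 -> modulus z ^+ 2 - (r + 1) ^+ 2 < 0.
  by move=> zr; rewrite subr_lt0 ltr_pXn2r // nnegrE ?modulus_ge0 // ltW.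
have [n Hn] := modulus_box (r + 1).
have zin z : modulus z < r + 1 -> z \in [seq y <- box n | modulus y < r + 1].
  move=> zr; rewrite mem_filter zr /=; have [a b] := Hn z zr; exact: mem_box.
have [z zs zM] := seq_argmax g (zin z0 z0r).
move: zs; rewrite mem_filter => /andP[zr _].
have gz : 0 < g z.
  apply: lt_le_trans (zM z0 (zin z0 z0r)).
  rewrite /g mulrBr epsE; have : 0 <= eps * modulus z0 ^+ 2.
    by rewrite mulr_ge0 ?sqr_ge0 // ltW.
  lra.
have [zb|] := boolP (slit z || (r <= modulus z)).
  have := bd z zr zb; move: gz; rewrite /g => gz fz.
  have : eps * (modulus z ^+ 2 - (r + 1) ^+ 2) < 0 by rewrite pmulr_rlt0 // sqlt.
  lra.
rewrite negb_or -ltNge => /andP[sz zr'].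
have : nbr_avg g z <= g z.
  rewrite -[leRHS](nbr_avg_cst (g z) z); apply: nbr_avg_le => e he; apply: zM.
  by apply: zin; rewrite (le_lt_trans (modulus_step R z he)) // ltrD2r.
rewrite /g nbr_avgD nbr_avgZ nbr_avgB modulus_sqr_avg nbr_avg_cst.
have := sub z sz zr'; lra.
Qed.

(** The shift by 1/2 makes the logarithm subharmonic on the whole lattice. *)
Definition log_potential (c z : Z2) : R := ln (modulus (z - c) ^+ 2 + 1 / 2).

(** Writing m for x^2 + y^2 + 1/2, the claim is that m^4 is at most
    ((m + 1)^2 - 4 x^2) ((m + 1)^2 - 4 y^2); the difference is
    4 m + 3 + 16 x^2 y^2. *)
Lemma log_potential_subharmonic c z :
  log_potential c z <= nbr_avg (log_potential c) z.
Proof.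
rewrite /log_potential /nbr_avg ler_pdivlMr // !modulus_sqr /=.
case: z => x0 y0; case: c => cx cy /=.
rewrite !(rmorphD, rmorphN) /= ?rmorph0 ?rmorph1.
set x : R := x0%:~R - cx%:~R; set y : R := y0%:~R - cy%:~R.
have -> : x0%:~R + 1 - cx%:~R = x + 1 :> R by rewrite /x; ring.
have -> : x0%:~R - 1 - cx%:~R = x - 1 :> R by rewrite /x; ring.
have -> : y0%:~R + 1 - cy%:~R = y + 1 :> R by rewrite /y; ring.
have -> : y0%:~R - 1 - cy%:~R = y - 1 :> R by rewrite /y; ring.
rewrite !addr0 -/x -/y.
have pos (a b : R) : a ^+ 2 + b ^+ 2 + 1 / 2 \in Num.pos.
  by rewrite posrE; have := sqr_ge0 a; have := sqr_ge0 b; lra.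
have -> (u : R) : u * 4 = u + u + u + u by ring.
rewrite -!lnM ?rpredM // ler_ln ?rpredM //.
set m := x ^+ 2 + y ^+ 2 + 1 / 2.
rewrite -subr_ge0 [X in 0 <= X](_ : _ = 4 * m + 3 + 16 * (x * y) ^+ 2).
  have : 0 < m by have := pos x y; rewrite posrE.
  have := sqr_ge0 (x * y); lra.
by rewrite /m; field.
Qed.

End maximum_principle.

(** * The harmonic measure of the half disc as a sine series *)

Section sine_series.
Variable R : realType.
Implicit Types (s x t : R).

(** At the point s e^(i t) of the upper half disc, 4 / pi times the full series is
    the harmonic measure of the semicircle.  Its terms are the odd powers of
    sqrt z, which have lattice counterparts. *)
Definition sine_sum n s t : R :=
  \sum_(j < n) s ^+ j.*2.+1 * sin (j.*2.+1%:R * t) / j.*2.+1%:R.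

Let dsine_sum n s t : R := \sum_(j < n) s ^+ j.*2 * sin (j.*2.+1%:R * t).

Let is_derive_pow n x : is_derive x 1 (fun s => s ^+ n) (n%:R * x ^+ n.-1).
Proof.
rewrite (_ : (fun s => s ^+ n) = id ^+ n); last by rewrite exprfctE.
apply: is_derive_eq (is_deriveX n (is_derive_id x 1)) _.
by rewrite /GRing.scale /= mulr1.
Qed.

Let is_derive_sine_sum n x t :
  is_derive x 1 (fun s => sine_sum n s t) (dsine_sum n x t).
Proof.
elim: n => [|n IH].
  rewrite /dsine_sum big_ord0 (_ : (fun s => _) = cst 0); last first.
    by apply/funext => s; rewrite /sine_sum big_ord0.
  exact: is_derive_cst.
rewrite /dsine_sum big_ord_recr /=.
rewrite (_ : (fun s => _) = (fun s => sine_sum n s t) +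
   (sin (n.*2.+1%:R * t) / n.*2.+1%:R) *: (fun s => s ^+ n.*2.+1)); last first.
  apply/funext => s; rewrite /sine_sum big_ord_recr /= /GRing.scale /=.
  by rewrite [RHS]/(_ + _ * _); congr (_ + _); ring.
apply: is_deriveD.
apply: is_derive_eq (is_deriveZ _ (is_derive_pow _ _)) _.
by rewrite /GRing.scale /= mulrA divfK ?pnatr_eq0 // mulrC.
Qed.

(** The derivative of the sine sum in s is a geometric sum. *)
Let dsine_sumE n x t :
  ((1 - x ^+ 2) ^+ 2 + 4 * x ^+ 2 * sin t ^+ 2) * dsine_sum n x t =
  (1 + x ^+ 2) * sin t -
  x ^+ n.*2 * (sin (n.*2.+1%:R * t) - x ^+ 2 * sin (n.*2.+1%:R * t - t *+ 2)).
Proof.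
elim: n => [|n IH].
  rewrite /dsine_sum big_ord0 double0 expr0 !mul1r (_ : t - t *+ 2 = - t); last first.
    by rewrite mulr2n opprD addrA subrr add0r.
  by rewrite sinN; ring.
rewrite /dsine_sum big_ord_recr /= mulrDr IH.
set T := n.*2.+1%:R * t.
have -> : n.+1.*2.+1%:R * t = T + t *+ 2.
  rewrite (_ : n.+1.*2.+1 = (n.*2.+1 + 2)%N); last by rewrite doubleS addn2.
  by rewrite natrD mulrDl [2 * t]mulr_natl.
rewrite addrK sinB (sinD T) sin_mulr2n cos_mulr2n doubleS.
rewrite (exprSr _ n.*2.+1) (exprSr _ n.*2).
have c2 : cos t ^+ 2 = 1 - sin t ^+ 2 by rewrite -(cos2Dsin2 t) addrK.
rewrite c2; ring.
Qed.

Let sum_sqr_gt0 x t : 0 <= x < 1 ->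
  (1 - x ^+ 2) ^+ 2 <= (1 - x ^+ 2) ^+ 2 + 4 * x ^+ 2 * sin t ^+ 2 /\
  0 < (1 - x ^+ 2) ^+ 2.
Proof.
move=> /andP[x0 x1]; have x2 : x ^+ 2 < 1 by rewrite expr_lt1.
split; last by rewrite exprn_gt0 // subr_gt0.
by rewrite lerDl mulr_ge0 ?sqr_ge0 // mulr_ge0 ?sqr_ge0.
Qed.

Let is_derive_atan_ratio x t : 0 <= x < 1 ->
  is_derive x 1 (fun s => atan (2 * s * sin t / (1 - s ^+ 2)))
    (2 * ((1 + x ^+ 2) * sin t / ((1 - x ^+ 2) ^+ 2 + 4 * x ^+ 2 * sin t ^+ 2))).
Proof.
move=> hx; have [D1 D0] := sum_sqr_gt0 t hx; case/andP: hx => x0 x1.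
have x2 : x ^+ 2 < 1 by rewrite expr_lt1.
have n1 : 1 - x ^+ 2 != 0 by rewrite gt_eqF // subr_gt0.
have h1 : is_derive x 1 (fun s => 1 - s ^+ 2) (- (2 * x)).
  rewrite (_ : (fun s => _) = cst 1 - (fun s => s ^+ 2)); last by apply/funext.
  apply: is_derive_eq (is_deriveB (is_derive_cst _ _ _) (is_derive_pow 2 x)) _.
  by rewrite sub0r expr1.
have h2 := @is_deriveV R (fun s => 1 - s ^+ 2) x _ 1 n1 h1.
have h3 : is_derive x 1 (fun s => 2 * s * sin t) (2 * sin t).
  rewrite (_ : (fun s => _) = (2 * sin t) \*: id); last first.
    by apply/funext => s; rewrite mulrAC.
  apply: is_derive_eq (is_deriveZ _ (is_derive_id x 1)) _.
  by rewrite /GRing.scale /= mulr1.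
have h4 := is_deriveM h3 h2.
have h5 := is_derive1_comp (is_derive1_atan _) h4.
apply: is_derive_eq h5 _; rewrite /GRing.scale /=.
have n2 : (1 - x ^+ 2) ^+ 2 + 4 * x ^+ 2 * sin t ^+ 2 != 0.
  by rewrite gt_eqF // (lt_le_trans D0).
have E : (1 + (2 * x * sin t / (1 - x ^+ 2)) ^+ 2)^-1 =
    (1 - x ^+ 2) ^+ 2 / ((1 - x ^+ 2) ^+ 2 + 4 * x ^+ 2 * sin t ^+ 2).
  rewrite -[RHS]invf_div; congr GRing.inv.
  by field; rewrite n1.
rewrite -[X in X * _]/((1 + (2 * x * sin t / (1 - x ^+ 2)) ^+ 2)^-1) E.
by field; rewrite n1 n2.
Qed.

(** The derivatives in s of both sides differ by the remainder of a geometric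
    series, and both sides vanish at s = 0. *)
Lemma sine_sum_atan n s t : 0 <= s < 1 ->
  `|sine_sum n s t - 1 / 2 * atan (2 * s * sin t / (1 - s ^+ 2))| <=
  2 * s ^+ n.*2 / (1 - s ^+ 2) ^+ 2.
Proof.
move=> hs; have [s0 s1] := andP hs.
pose g x := sine_sum n x t - 1 / 2 * atan (2 * x * sin t / (1 - x ^+ 2)).
pose dg x := dsine_sum n x t -
  (1 + x ^+ 2) * sin t / ((1 - x ^+ 2) ^+ 2 + 4 * x ^+ 2 * sin t ^+ 2).
have gd x : 0 <= x < 1 -> is_derive x 1 g (dg x).
  move=> hx; rewrite (_ : g = (fun s => sine_sum n s t) -
    (1 / 2) \*: (fun s => atan (2 * s * sin t / (1 - s ^+ 2)))); last by apply/funext.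
  apply: is_derive_eq (is_deriveB (is_derive_sine_sum n x t)
    (is_deriveZ _ (is_derive_atan_ratio t hx))) _.
  by rewrite /dg /GRing.scale /= mul1r mulKf // pnatr_eq0.
have gc : {within `[0, s], continuous g}.
  apply: derivable_within_continuous => x /[!in_itv]/= /andP[x0 xs].
  by have [] := gd x _; rewrite // x0 (le_lt_trans xs).
have [c /[!in_itv]/= /andP[c0 cs]] : exists2 c, c \in `[0, s] & g s - g 0 = dg c * (s - 0).
  apply: MVT_segment => // x /[!in_itv]/= /andP[x0 xs].
  by apply: gd; rewrite ltW // (lt_trans xs).
have g0 : g 0 = 0.
  rewrite /g mulr0 mul0r mul0r atan0 mulr0 subr0 /sine_sum big1 // => j _.
  by rewrite exprS mul0r mul0r mul0r.
rewrite g0 !subr0 -/(g s) => ->.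
have hc : 0 <= c < 1 by rewrite c0 (le_lt_trans cs).
have [D1 D0] := sum_sqr_gt0 t hc.
have Dn : (1 - c ^+ 2) ^+ 2 + 4 * c ^+ 2 * sin t ^+ 2 != 0.
  by rewrite gt_eqF // (lt_le_trans D0).
have dgE : dg c = - (c ^+ n.*2 * (sin (n.*2.+1%:R * t) -
    c ^+ 2 * sin (n.*2.+1%:R * t - t *+ 2))) /
    ((1 - c ^+ 2) ^+ 2 + 4 * c ^+ 2 * sin t ^+ 2).
  have DK y : ((1 - c ^+ 2) ^+ 2 + 4 * c ^+ 2 * sin t ^+ 2) *
      (y / ((1 - c ^+ 2) ^+ 2 + 4 * c ^+ 2 * sin t ^+ 2)) = y by rewrite mulrC divfK.
  by apply: (mulfI Dn); rewrite /dg mulrBr dsine_sumE !DK; ring.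
rewrite dgE normrM (ger0_norm s0) normrM normrN normrM.
have c2 : c ^+ 2 <= 1 by rewrite expr_le1 // (le_trans cs) // ltW.
have num : `|sin (n.*2.+1%:R * t) - c ^+ 2 * sin (n.*2.+1%:R * t - t *+ 2)| <= 2.
  have sin1 u : `|sin u : R| <= 1 by rewrite ler_norml sin_geN1 sin_le1.
  rewrite (le_trans (ler_normB _ _)) // (_ : 2 = 1 + 1) // lerD // normrM.
  by rewrite (ger0_norm (sqr_ge0 _)) mulr_ile1 ?sqr_ge0.
have den : `|((1 - c ^+ 2) ^+ 2 + 4 * c ^+ 2 * sin t ^+ 2)^-1| <= ((1 - s ^+ 2) ^+ 2)^-1.
  have [_ S0] := sum_sqr_gt0 t hs.
  rewrite normfV ger0_norm; last by rewrite (le_trans (ltW D0)).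
  rewrite lef_pV2 ?posrE // ?(lt_le_trans D0) //; apply: le_trans D1.
  have cs2 : c ^+ 2 <= s ^+ 2 by rewrite ler_pXn2r ?nnegrE.
  have s2 : s ^+ 2 <= 1 by rewrite expr_le1 // ltW.
  by rewrite ler_pXn2r ?nnegrE ?subr_ge0 // lerD2l lerN2.
have cn : `|c ^+ n.*2| <= s ^+ n.*2.
  by rewrite ger0_norm ?exprn_ge0 // lerXn2r ?nnegrE.
rewrite -[leRHS]mulr1 ler_pM ?mulr_ge0 ?normr_ge0 // ?(ltW s1) //.
by rewrite ler_pM ?mulr_ge0 ?normr_ge0 // mulrC ler_pM ?normr_ge0.
Qed.

End sine_series.

(** * Comparison functions in the slit disc *)

Section polar_form.
Variable R : realType.
Implicit Types z : Z2.

Lemma phi_polar m z : phi R m z =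
  Num.sqrt (modulus z) ^+ m.*2.+1 * sin (m.*2.+1%:R * (arg z / 2)).
Proof.
rewrite /phi; set u : R := Num.sqrt (modulus z); set t : R := arg z / 2.
have -> : sqrtz R z = Complex (u * cos t) (u * sin t) by [].
suff H n : (Complex (u * cos t) (u * sin t)) ^+ n =
    Complex (u ^+ n * cos (n%:R * t)) (u ^+ n * sin (n%:R * t)) by rewrite H.
elim: n => [|n IH].
  by rewrite !expr0 mul0r cos0 sin0 !mul1r.
rewrite exprS IH -[n.+1%:R]natr1 mulrDl mul1r cosD sinD exprS.
by apply/eqP; rewrite eq_complex /=; apply/andP; split; apply/eqP; ring.
Qed.

Lemma phi_slit m z : slit z -> phi R m z = 0.
Proof.
move=> sz; rewrite /phi Im_exp_real //=; exact: Im_sqrt_slit.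
Qed.

(** The left-hand side is the squared distance from z to the point |z| of the
    half-line. *)
Lemma modulus_sub_sqr z : (z.1%:~R - modulus z) ^+ 2 + z.2%:~R ^+ 2 =
  4 * modulus z * Im_sqrt z ^+ 2 :> R.
Proof.
have [xE yE] := embed_parts R z.
have mE : modulus z = Re (sqrtz R z) ^+ 2 + Im_sqrt z ^+ 2 :> R.
  by rewrite -[modulus z]sqr_sqrtr ?modulus_ge0 // -normc_sqrtz normc_sqr.
rewrite {1 2}mE xE yE; ring.
Qed.

End polar_form.


Section comparison.
Variable R : realType.
Implicit Types (z : Z2) (s t : R).
Variables (h Psi : Z2 -> R) (Kh L : R).
Hypothesis h_slit : forall z, slit z -> h z = 0.
Hypothesis h_harm : forall z, ~~ slit z -> h z = nbr_avg h z.
Hypothesis h_close : forall z, `|h z - Im_sqrt z| <= Kh * beta R z.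
Hypothesis Kh0 : 0 <= Kh.
Hypothesis Psi_le : forall z, 0 <= Psi z <= L * beta R z.
Hypothesis Psi_super : forall z, ~~ slit z ->
  Im_sqrt z / modulus z ^+ 4 <= Psi z - nbr_avg Psi z.

Let term s t k z : R :=
  (s / t ^+ 2) ^+ k.+1.*2.+1 * phi R k.+1 z / k.+1.*2.+1%:R.

(** The truncated sine series at sqrt z / t^2, for the disc of radius t^4, taken
    at the dilation factor s < 1 so that the series converges uniformly up to
    the circle.  The leading term is the exactly harmonic function h rather
    than Im (sqrt z), because at a fixed point it is the only term that matters
    in the limit.  Powers of t avoid fractional powers of the radius. *)
Definition comparison n s t z : R :=
  4 / pi * (s / t ^+ 2 * h z + \sum_(k < n) term s t k z).

Lemma four_pi : 0 <= (4 / pi : R) <= 2.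
Proof.
have p0 := pi_gt0 R; have p2 := pi_ge2 R.
apply/andP; split; first by rewrite divr_ge0 // ltW.
by rewrite ler_pdivrMr //; lra.
Qed.

Let double_exponent k : (4 * k + 6)%N = (2 * k.+1.*2.+1)%N.
Proof. by clear; lia. Qed.

(** The terms beyond the first have a Laplacian of order
    t^-6 Im (sqrt z) / |z|^3.  For |z| <= t^2 this is at most
    t^-4 Im (sqrt z) / |z|^4; for |z| > t^2 it is at most t^-11. *)
Let term_laplacian k : exists2 C : R, 0 <= C & forall s t z,
  0 <= s <= 1 -> 1 <= t -> ~~ slit z -> modulus z < t ^+ 4 ->
  `|term s t k z - nbr_avg (term s t k) z| <=
    C * (t^-1 ^+ 4 * (Im_sqrt z / modulus z ^+ 4) + t^-1 ^+ 11).
Proof.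
have [C C0 HC] := phi_laplacian R k.+1; exists C => // s t z /andP[s0 s1] t1 sz zt.
have t0 : 0 < t := lt_le_trans ltr01 t1.
have m1 := modulus_off_slit R sz; have m0 : 0 < modulus z :> R := lt_le_trans ltr01 m1.
have b0 := Im_sqrt_ge0 R z; have := HC z sz.
have -> : term s t k z - nbr_avg (term s t k) z =
    (s / t ^+ 2) ^+ k.+1.*2.+1 / k.+1.*2.+1%:R * (phi R k.+1 z - nbr_avg (phi R k.+1) z).
  by rewrite mulrBr -nbr_avgZ /nbr_avg /term; congr (_ - (_ + _ + _ + _) / _);
    rewrite mulrAC.
set D := phi R _ z - _; rewrite (exprS _ k) => HD.
have qt : Im_sqrt z <= Num.sqrt (modulus z) :> R := Im_sqrt_le R z.
have qE : modulus z = Num.sqrt (modulus z) ^+ 2 :> R by rewrite sqr_sqrtr ?ltW.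
have key : Im_sqrt z * modulus z <= t ^+ 2 * Im_sqrt z + t^-1 ^+ 5 * modulus z ^+ 4.
  have [rt|tr] := leP (modulus z) (t ^+ 2).
    rewrite mulrC (le_trans (ler_wpM2r b0 rt)) // lerDl.
    by rewrite mulr_ge0 ?exprn_ge0 ?invr_ge0 ?ltW.
  have tq : t <= Num.sqrt (modulus z).
    by rewrite -(ger0_norm (ltW t0)) -sqrtr_sqr ler_wsqrtr // ltW.
  apply: (@le_trans _ _ (t^-1 ^+ 5 * modulus z ^+ 4)); last first.
    by rewrite lerDr mulr_ge0 ?exprn_ge0 ?(ltW t0).
  rewrite (le_trans (ler_wpM2r (ltW m0) qt)) //.
  rewrite [in leRHS]qE [X in _ * X <= _]qE.
  set q := Num.sqrt _ in tq *; have q0 : 0 < q by exact: lt_le_trans tq.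
  rewrite -[leLHS]mul1r [leRHS](_ : _ = (t^-1 * q) ^+ 5 * (q * q ^+ 2)); last first.
    by rewrite exprMn; ring.
  rewrite ler_wpM2r ?mulr_ge0 ?exprn_ge0 ?(ltW q0) // exprn_ege1 //.
  by rewrite mulrC ler_pdivlMr // mul1r.
have m40 : 0 < modulus z ^+ 4 :> R by rewrite exprn_gt0.
have D1 : `|D| <= C * t ^+ (4 * k) *
    (t ^+ 2 * (Im_sqrt z / modulus z ^+ 4) + t^-1 ^+ 5).
  rewrite -(ler_pM2r m40) (le_trans HD) // -[leRHS]mulrA.
  have -> : (t ^+ 2 * (Im_sqrt z / modulus z ^+ 4) + t^-1 ^+ 5) * modulus z ^+ 4 =
      t ^+ 2 * Im_sqrt z + t^-1 ^+ 5 * modulus z ^+ 4.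
    by field; rewrite !gt_eqF.
  rewrite -[leRHS]mulrA ler_wpM2l // mulrA [leRHS]mulrC.
  apply: ler_pM => //.
  - exact: mulr_ge0 b0 (ltW m0).
  - exact: exprn_ge0 (ltW m0).
  - by rewrite exprM lerXn2r ?nnegrE ?exprn_ge0 ?(ltW m0) ?(ltW t0) // ltW.
have c1 : `|(s / t ^+ 2) ^+ k.+1.*2.+1 / k.+1.*2.+1%:R| <= t^-1 ^+ (4 * k) * t^-1 ^+ 6.
  rewrite ger0_norm; last by rewrite divr_ge0 // exprn_ge0 // divr_ge0 // exprn_ge0 // ltW.
  have -> : t^-1 ^+ (4 * k) * t^-1 ^+ 6 = (t^-1 ^+ 2) ^+ k.+1.*2.+1.
    by rewrite -exprD -exprM double_exponent.
  apply: (@le_trans _ _ ((s / t ^+ 2) ^+ k.+1.*2.+1)).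
    rewrite ler_pdivrMr ?ltr0n // ler_peMr ?ler1n //.
    by rewrite exprn_ge0 // divr_ge0 // exprn_ge0 // ltW.
  rewrite lerXn2r ?nnegrE ?exprn_ge0 ?invr_ge0 ?(ltW t0) //.
    by rewrite divr_ge0 // exprn_ge0 // ltW.
  by rewrite exprVn ler_pdivrMr ?exprn_gt0 // mulVf // gt_eqF // exprn_gt0.
rewrite normrM (le_trans (ler_pM (normr_ge0 _) (normr_ge0 _) c1 D1)) //.
have tk : t^-1 ^+ (4 * k) * t ^+ (4 * k) = 1 by rewrite -exprMn mulVf ?expr1n // gt_eqF.
rewrite [leLHS](_ : _ = (t^-1 ^+ (4 * k) * t ^+ (4 * k)) * C *
  ((t^-1 * t) ^+ 2 * t^-1 ^+ 4 * (Im_sqrt z / modulus z ^+ 4) + t^-1 ^+ 11)); last first.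
  by rewrite exprMn; ring.
by rewrite tk mulVf ?gt_eqF // expr1n !mul1r.
Qed.

Let sum_laplacian n : exists2 C : R, 0 <= C & forall s t z,
  0 <= s <= 1 -> 1 <= t -> ~~ slit z -> modulus z < t ^+ 4 ->
  `|\sum_(k < n) (term s t k z - nbr_avg (term s t k) z)| <=
    C * (t^-1 ^+ 4 * (Im_sqrt z / modulus z ^+ 4) + t^-1 ^+ 11).
Proof.
elim: n => [|n [C C0 HC]].
  by exists 0 => // s t z *; rewrite big_ord0 normr0 mul0r.
have [D D0 HD] := term_laplacian n; exists (C + D) => [|s t z hs ht hz hm].
  by rewrite addr_ge0.
rewrite big_ord_recr /= mulrDl (le_trans (ler_normD _ _)) // lerD //.
  exact: HC.
exact: HD.
Qed.

Lemma comparison_laplacian n : exists2 C : R, 0 <= C & forall s t z,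
  0 <= s <= 1 -> 1 <= t -> ~~ slit z -> modulus z < t ^+ 4 ->
  `|comparison n s t z - nbr_avg (comparison n s t) z| <=
    C * (t^-1 ^+ 4 * (Psi z - nbr_avg Psi z) + t^-1 ^+ 11).
Proof.
have [C C0 HC] := sum_laplacian n; have /andP[p0 p2] := four_pi.
exists (2 * C) => [|s t z hs ht sz zt]; first by rewrite mulr_ge0.
have t0 : 0 < t := lt_le_trans ltr01 ht.
have -> : comparison n s t z - nbr_avg (comparison n s t) z =
    4 / pi * \sum_(k < n) (term s t k z - nbr_avg (term s t k) z).
  rewrite /comparison nbr_avgZ nbr_avgD nbr_avgZ nbr_avg_sum sumrB -h_harm //.
  by rewrite -mulrBr; congr (_ * _); rewrite opprD addrACA subrr add0r.
rewrite normrM (ger0_norm p0) -mulrA ler_pM ?normr_ge0 //.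
rewrite (le_trans (HC s t z hs ht sz zt)) // ler_wpM2l // lerD2r.
by rewrite ler_wpM2l ?exprn_ge0 ?invr_ge0 ?(ltW t0) // Psi_super.
Qed.

(** A positive function that compensates the bound of comparison_laplacian: Psi
    for its first term and, since |z|^2 has discrete Laplacian 1, a paraboloid
    for the second.  Multiplied by t^2 it tends to zero at a fixed point. *)
Definition slack C t z : R :=
  C * (t^-1 ^+ 4 * Psi z + t^-1 ^+ 11 * ((t ^+ 4 + 1) ^+ 2 - modulus z ^+ 2)).

Lemma slack_ge0 C t z : 0 <= C -> 0 < t -> modulus z < t ^+ 4 + 1 -> 0 <= slack C t z.
Proof.
move=> C0 t0 zt; rewrite /slack mulr_ge0 // addr_ge0 // mulr_ge0 ?exprn_ge0 ?invr_ge0 ?(ltW t0) //.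
  by have /andP[] := Psi_le z.
rewrite subr_ge0 lerXn2r ?nnegrE ?modulus_ge0 ?addr_ge0 ?exprn_ge0 ?(ltW t0) //.
exact: ltW.
Qed.

Lemma slack_laplacian C t z : slack C t z - nbr_avg (slack C t) z =
  C * (t^-1 ^+ 4 * (Psi z - nbr_avg Psi z) + t^-1 ^+ 11).
Proof.
rewrite /slack nbr_avgZ nbr_avg_lin nbr_avgB nbr_avg_cst modulus_sqr_avg.
by ring.
Qed.

Lemma comparison_slit n s t z : slit z -> comparison n s t z = 0.
Proof.
move=> sz; rewrite /comparison h_slit // mulr0 add0r big1 ?mulr0 // => k _.
by rewrite /term phi_slit // mulr0 mul0r.
Qed.

Let small_power (x e : R) : 0 <= x < 1 -> 0 < e -> exists n, x ^+ n <= e.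
Proof.
move=> /andP[x0 x1] e0; have x1' : `|x| < 1 by rewrite ger0_norm.
have /cvgrPdist_le/(_ e e0)[n _ Hn] := cvg_expr x1'; exists n.
have := Hn n (leqnn n); rewrite /= sub0r normrN; exact: le_trans (ler_norm _).
Qed.

(** Just outside the circle, comparison is close to 2 / pi times an arctangent,
    a number of [0, 1[ that is close to 1 when s is, except near the half-line. *)
Lemma comparison_boundary (e s : R) : 0 < e -> 0 < s < 1 -> exists n (t0 : R), 1 <= t0 /\
  forall t z, t0 <= t -> ~~ slit z -> t ^+ 4 <= modulus z -> modulus z < t ^+ 4 + 1 ->
  exists2 s', s <= s' < 1 &
  `|comparison n s t z - 2 / pi * atan (2 * s' * sinhalf R z / (1 - s' ^+ 2))| <= e.
Proof.
move=> e0 /andP[s0 s1]; have /andP[p0 p2] := four_pi.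
(* The dilated modulus s' stays below u once t is large. *)
pose u := (1 + s) / 2; have u0 : 0 <= u by rewrite /u; lra.
have u1 : u < 1 by rewrite /u; lra.
have uD : 0 < 1 - u ^+ 2 by rewrite subr_gt0 expr_lt1.
have [n Hn] : exists n, u ^+ n <= e / 8 * (1 - u ^+ 2) ^+ 2.
  by apply: small_power; rewrite ?u0 // mulr_gt0 ?exprn_gt0 //; lra.
exists n, (1 + 2 / (1 - s) + 4 * Kh / e); split.
  by rewrite -addrA lerDl addr_ge0 ?divr_ge0 ?mulr_ge0 ?subr_ge0 // ltW.
move=> t z ht sz tz zt.
have a1 : 0 <= 2 / (1 - s) by rewrite divr_ge0 // subr_ge0 ltW.
have a2 : 0 <= 4 * Kh / e by rewrite divr_ge0 ?mulr_ge0 // ltW.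
have t1 : 1 <= t by lra.
have t0 : 0 < t by lra.
have t2 : t <= t ^+ 2 by rewrite expr2 ler_peMr // ltW.
have t20 : 0 < t ^+ 2 by rewrite exprn_gt0.
pose q : R := Num.sqrt (modulus z); pose s' := s * q / t ^+ 2.
have q0 : 0 <= q by exact: sqrtr_ge0.
have qt : t ^+ 2 <= q.
  rewrite -(ger0_norm (ltW t20)) -sqrtr_sqr ler_wsqrtr //.
  by rewrite -exprM.
have tq : q <= t ^+ 2 + 1.
  rewrite -(ler_pXn2r (n := 2)) ?nnegrE ?addr_ge0 ?(ltW t20) //.
  rewrite sqr_sqrtr ?modulus_ge0 // (le_trans (ltW zt)) // -subr_ge0.
  rewrite (_ : (t ^+ 2 + 1) ^+ 2 - (t ^+ 4 + 1) = 2 * t ^+ 2); last by ring.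
  by rewrite mulr_ge0 // ltW.
have ss' : s <= s' by rewrite /s' ler_pdivlMr // ler_wpM2l // ltW.
have s'u : s' <= u.
  rewrite /s' ler_pdivrMr // (le_trans (ler_wpM2l (ltW s0) tq)) //.
  have : 2 <= (1 - s) * t ^+ 2.
    rewrite mulrC -ler_pdivrMr ?subr_gt0 //; lra.
  by rewrite /u; lra.
have s'1 : s' < 1 by exact: le_lt_trans s'u u1.
have s'0 : 0 <= s' by apply: le_trans ss'; exact: ltW.
exists s'; first by rewrite ss'.
have hs' : 0 <= s' < 1 by rewrite s'0.
have est := sine_sum_atan n.+1 (arg z / 2) hs'.
have cE : comparison n s t z = 4 / pi * (s / t ^+ 2 * (h z - Im_sqrt z)) +
    4 / pi * sine_sum n.+1 s' (arg z / 2).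
  rewrite /comparison -mulrDr; congr (_ * _).
  rewrite /sine_sum big_ord_recl /= expr1 mul1r divr1 addrA; congr (_ + _).
    by rewrite /s' /q /Im_sqrt; ring.
  apply: eq_bigr => k _; rewrite /term phi_polar /bump /= add1n.
  by rewrite -/q (_ : s' = s / t ^+ 2 * q) ?(exprMn _ (s / t ^+ 2)) ?mulrA // /s' mulrAC.
set A := atan _ in est *.
have -> : comparison n s t z - 2 / pi * A =
    4 / pi * (s / t ^+ 2 * (h z - Im_sqrt z)) +
    4 / pi * (sine_sum n.+1 s' (arg z / 2) - 1 / 2 * A).
  have pn : (pi : R) != 0 by rewrite gt_eqF // pi_gt0.
  rewrite cE; move: (s / t ^+ 2 * _) (sine_sum _ _ _) => x y.
  by move: (@pi R) pn => v vn; field.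
rewrite (le_trans (ler_normD _ _)) // [leRHS](_ : e = e / 2 + e / 2); last by field.
rewrite lerD // normrM (ger0_norm p0).
  have hb : `|h z - Im_sqrt z| <= Kh.
    by rewrite (le_trans (h_close z)) // ler_piMr // beta_le1.
  rewrite (@le_trans _ _ (2 * (t^-1 * Kh))) //; last first.
    have -> : 2 * (t^-1 * Kh) = 2 * Kh / t by rewrite mulrCA mulrC.
    rewrite ler_pdivrMr //; have : 4 * Kh <= e * t.
      by rewrite [e * t]mulrC -ler_pdivrMr //; lra.
    lra.
  rewrite ler_pM ?normr_ge0 // normrM ler_pM ?normr_ge0 //.
  rewrite ger0_norm; last by rewrite divr_ge0 // ltW.
  rewrite -[leRHS]mul1r ler_pM ?invr_ge0 ?(ltW s0) ?(ltW s1) ?(ltW t20) //.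
  by rewrite lef_pV2 ?posrE.
rewrite (@le_trans _ _ (2 * (2 * s' ^+ n.+1.*2 / (1 - s' ^+ 2) ^+ 2))) //.
  by rewrite ler_pM ?normr_ge0.
have sn : s' ^+ n.+1.*2 <= u ^+ n.
  rewrite (@le_trans _ _ (s' ^+ n)) ?lerXn2r ?nnegrE //.
  by rewrite ler_wiXn2l ?(ltW s'1) // -addnn (leq_trans (leqnSn n)) ?leq_addr.
have sd : (1 - u ^+ 2) ^+ 2 <= (1 - s' ^+ 2) ^+ 2.
  have s'2 : s' ^+ 2 <= u ^+ 2 by rewrite lerXn2r ?nnegrE.
  rewrite lerXn2r ?nnegrE ?(ltW uD) ?lerD2l ?lerN2 //.
  by rewrite subr_ge0 expr_le1 // ltW.
have d0 : 0 < (1 - s' ^+ 2) ^+ 2 by apply: lt_le_trans sd; rewrite exprn_gt0.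
rewrite mulrA ler_pdivrMr //.
have e8 : 0 <= e / 8 by lra.
have := ler_wpM2l e8 sd; lra.
Qed.

End comparison.

(** * The corner of the slit disc *)

Section corner.
Variable R : realType.
Implicit Types z : Z2.

(** The walk started in the half disc has a small probability of reaching, before
    leaving a larger disc, a small ball around the point where the circle meets
    the half-line.  The logarithmic potential centred near that point gives
    the estimate with a gain 1 / log (1 / delta). *)
Lemma corner_function (e : R) : 0 < e -> exists delta r0 : R, [/\ 0 < delta, 1 <= r0 &
  forall r, r0 <= r -> exists g : Z2 -> R, [/\
    forall z, nbr_avg g z <= g z,
    forall z, modulus z < r + 1 -> 0 <= g z,
    forall z, ~~ slit z -> r <= modulus z -> modulus z < r + 1 ->
      sinhalf R z <= delta -> 1 <= g z &
    forall z, modulus z < r / 2 + 1 -> g z <= e]].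
Proof.
move=> e0; have l0 : 0 < ln (16 * 16 : R) by rewrite ln_gt0 //; lra.
pose A := ln (16 * 16 : R) / e; have A0 : 0 < A by rewrite divr_gt0.
pose delta := Num.sqrt (16 / 33 * expR (- A)).
have d2 : delta ^+ 2 = 16 / 33 * expR (- A).
  by rewrite sqr_sqrtr // mulr_ge0 ?expR_ge0 // divr_ge0.
have d0 : 0 < delta by rewrite sqrtr_gt0 mulr_gt0 ?expR_gt0 // divr_gt0.
exists delta, (8 + 3 / delta); split=> //.
  have : 0 <= 3 / delta by rewrite divr_ge0 // ltW.
  lra.
move=> r hr.
have r3 : 3 / delta <= r by apply: le_trans hr; rewrite lerDr.
have r8 : 8 <= r by apply: le_trans hr; rewrite lerDl divr_ge0 // ltW.
have rd : 3 <= r * delta by rewrite -ler_pdivrMr.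
have r0 : 0 < r by lra.
pose n := Num.truncn r.
have /andP[n1 n2] : n%:R <= r < n.+1%:R := truncn_itv (ltW r0).
rewrite -natr1 in n2; set m : R := n%:R in n1 n2.
pose c : Z2 := (n%:Z, 0).
have dist z : modulus (z - c) ^+ 2 = (z.1%:~R - m) ^+ 2 + z.2%:~R ^+ 2 :> R.
  by rewrite modulus_sqr /c /= subr0 rmorphB.
pose g z := (ln (16 * r ^+ 2) - log_potential R c z) / A.
have xle z : `|z.1%:~R| <= modulus z :> R.
  by rewrite -normc_embed; exact: Re_le_normc (embed R z).
have sq z := modulus_sqr R z.
have pos z : 0 < modulus (z - c) ^+ 2 + 1 / 2 :> R.
  by have := sqr_ge0 (modulus (z - c) : R); lra.
have r16 : 0 < 16 * r ^+ 2 by rewrite mulr_gt0 // exprn_gt0.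
exists g; split.
- move=> z; rewrite /g.
  rewrite (_ : nbr_avg _ z = (ln (16 * r ^+ 2) - nbr_avg (log_potential R c) z) / A).
    by rewrite ler_pM2r ?invr_gt0 // lerD2l lerN2 log_potential_subharmonic.
  by rewrite /nbr_avg; field; rewrite gt_eqF.
- move=> z zr; rewrite /g divr_ge0 ?(ltW A0) // subr_ge0 /log_potential.
  rewrite ler_ln ?posrE // dist.
  have x0 := xle z; have z0 := modulus_ge0 R z.
  have m0 : 0 <= m by exact: ler0n.
  have : (z.1%:~R - m) ^+ 2 + z.2%:~R ^+ 2 <= (modulus z + m) ^+ 2 :> R.
    rewrite !sqrrD sqrrN sq; have : - (z.1%:~R * m) <= modulus z * m :> R.
      by rewrite -mulNr ler_wpM2r // (le_trans (ler_norm _)) // normrN.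
    by rewrite !mulr2n !mulrN; lra.
  have : (modulus z + m) ^+ 2 <= (2 * r + 1) ^+ 2.
    by rewrite lerXn2r ?nnegrE //; clear -n1 r0 m0 z0 zr; lra.
  have : (2 * r + 1) ^+ 2 + 1 / 2 <= 16 * r ^+ 2 by clear -r8; nra.
  by clear; lra.
- move=> z sz rz zr sd; rewrite /g ler_pdivlMr // mul1r lerBrDr addrC -lerBrDr.
  have -> : ln (16 * r ^+ 2) - A = ln (16 * r ^+ 2 * expR (- A)).
    by rewrite [in RHS]lnM ?posrE ?expR_gt0 // expRK.
  rewrite /log_potential ler_ln ?posrE // ?mulr_gt0 ?expR_gt0 ?exprn_gt0 //.
  rewrite dist (_ : 16 * r ^+ 2 * expR (- A) = 33 * (r * delta) ^+ 2); last first.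
    by rewrite exprMn d2; field.
  have s0 := sinhalf_gt0 R sz.
  have := modulus_sub_sqr R z.
  rewrite Im_sqrtE exprMn sqr_sqrtr ?modulus_ge0 // => subE.
  have s2 : sinhalf R z ^+ 2 <= delta ^+ 2 by rewrite lerXn2r ?nnegrE ?(ltW s0) ?(ltW d0).
  have z2 : modulus z ^+ 2 <= (2 * r) ^+ 2 by rewrite lerXn2r ?nnegrE ?modulus_ge0 //; clear -zr r8; lra.
  have := ler_pM (sqr_ge0 _) (sqr_ge0 _) z2 s2.
  rewrite exprMn => prod.
  have sub4 : (z.1%:~R - modulus z) ^+ 2 + z.2%:~R ^+ 2 <=
      4 * (4 * r ^+ 2 * delta ^+ 2) :> R.
    rewrite subE; have -> : 4 * modulus z * (modulus z * sinhalf R z ^+ 2) =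
      4 * (modulus z ^+ 2 * sinhalf R z ^+ 2) by ring.
    by clear -prod; lra.
  have zm : (modulus z - m) ^+ 2 <= 4.
    rewrite [leRHS](_ : _ = 2 ^+ 2); last by ring.
    by rewrite lerXn2r ?nnegrE ?subr_ge0 //; clear -n1 n2 rz zr; lra.
  have rd2 : 9 <= (r * delta) ^+ 2.
    rewrite [leLHS](_ : _ = 3 ^+ 2); last by ring.
    by rewrite lerXn2r ?nnegrE ?mulr_ge0 ?(ltW r0) ?(ltW d0).
  have sum2 : (z.1%:~R - m) ^+ 2 <=
      2 * (z.1%:~R - modulus z) ^+ 2 + 2 * (modulus z - m) ^+ 2 :> R.
    have := sqr_ge0 ((z.1%:~R - modulus z) - (modulus z - m) : R).
    set a := z.1%:~R; set b := modulus z; clear; nra.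
  have y0 : 0 <= z.2%:~R ^+ 2 :> R by exact: sqr_ge0.
  by move: rd2; rewrite exprMn; clear -sub4 zm sum2 y0; lra.
- move=> z zr; rewrite /g ler_pdivrMr // [e * A]mulrC /A divfK ?gt_eqF //.
  rewrite lerBlDr -lerBlDl.
  have -> : ln (16 * r ^+ 2) - ln (16 * 16 : R) = ln (r ^+ 2 / 16).
    rewrite -ln_div ?posrE ?mulr_gt0 //; congr ln.
    by rewrite invfM mulrACA divff // mul1r.
  rewrite /log_potential ler_ln ?posrE ?divr_gt0 ?exprn_gt0 // dist.
  have x0 := xle z; have z0 := modulus_ge0 R z.
  have m0 : 0 <= m by exact: ler0n.
  have : (m - modulus z) ^+ 2 <= (z.1%:~R - m) ^+ 2 + z.2%:~R ^+ 2 :> R.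
    rewrite !sqrrB sq; have : z.1%:~R * m <= modulus z * m :> R.
      by rewrite ler_wpM2r // (le_trans (ler_norm _)).
    by rewrite !mulr2n; lra.
  have : (r / 4) ^+ 2 <= (m - modulus z) ^+ 2.
    by rewrite lerXn2r ?nnegrE //; clear -zr r8 n2 r0; lra.
  by rewrite expr_div_n; clear; lra.
Qed.

End corner.

(** * Exit probabilities of the walk *)

Section paths.
Variables (R : realType) (r : R).
Implicit Types (z e : Z2) (x : nat -> Z2).

(** The path x leaves the disc by time n without having touched the half-line. *)
Fixpoint exits n x : bool :=
  ~~ slit (x 0%N) && ((r <= modulus (x 0%N)) ||
    (if n is m.+1 then exits m (fun i => x i.+1) else false)).

Lemma exitsP n x : reflect
  (exists2 j, (j <= n)%N & r <= modulus (x j) /\ forall i, (i <= j)%N -> ~~ slit (x i))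
  (exits n x).
Proof.
elim: n x => [|n IH] x /=.
  rewrite orbF; apply: (iffP andP) => [[s0 r0]|[j]].
    by exists 0%N => //; split=> // i; rewrite leqn0 => /eqP ->.
  by rewrite leqn0 => /eqP -> [r0 s0]; split=> //; exact: s0.
apply: (iffP andP) => [[s0 /orP[r0|/IH[j jn [rj sj]]]]|[[|j] jn [rj sj]]].
- by exists 0%N => //; split=> // i; rewrite leqn0 => /eqP ->.
- by exists j.+1 => //; split=> // -[|i] // ij; exact: sj.
- by split; [exact: sj|rewrite rj].
split; first exact: sj.
by apply/orP; right; apply/IH; exists j => //; split=> // i ij; exact: sj.
Qed.

Lemma exits_mono n m x : (n <= m)%N -> exits n x -> exits m x.
Proof.
by move=> nm /exitsP[j jn h]; apply/exitsP; exists j => //; exact: leq_trans nm.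
Qed.

(** The probability of that event for the walk started at z, in the form given by
    the Markov property at time one. *)
Fixpoint exit_by n z : R :=
  if slit z then 0 else if r <= modulus z then 1 else
  if n is m.+1 then nbr_avg (exit_by m) z else 0.

(** The same probability conditionally on the first steps being s; it
    interpolates between exit_by, for s empty, and the indicator of exits. *)
Fixpoint exit_along n (s : seq Z2) z : R :=
  if s is e :: s' then
    if slit z then 0 else if r <= modulus z then 1 else exit_along n s' (z + e)
  else exit_by n z.

Lemma exit_along_rcons n s z : exit_along n.+1 s z =
  (exit_along n (rcons s (1, 0)) z + exit_along n (rcons s (-1, 0)) z +
   exit_along n (rcons s (0, 1)) z + exit_along n (rcons s (0, -1)) z) / 4.
Proof.
elim: s z => [|e s IH] z /=.
  by case: ifP => _; [field|case: ifP => _ //; field].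
by case: ifP => _; [field|case: ifP => _; [field|exact: IH]].
Qed.

Lemma exit_along_path s x :
  (forall j, (j < size s)%N -> x j.+1 = x j + nth 0 s j) ->
  exit_along 0 s (x 0%N) = (exits (size s) x)%:R.
Proof.
elim: s x => [|e s IH] x hx /=.
  by case: slit => //=; case: leP.
case: slit => //=; case: leP => //= _.
have -> : x 0%N + e = x 1%N by rewrite (hx 0%N).
by apply: (IH (fun i => x i.+1)) => j js; exact: (hx j.+1).
Qed.

End paths.

Section walk.
Variables (R : realType) (d : measure_display) (Omega : measurableType d).
Variables (S : nat -> Omega -> Z2) (P : probability Omega R) (z0 : Z2).
Hypothesis hS : simple_random_walk P z0 S.
Variable r : R.
Implicit Types (z e : Z2) (s : seq Z2).

Lemma measurable_walk j (A : set Z2) : measurable (S j @^-1` A).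
Proof.
have [mS _ _ _] := hS.
have -> : S j @^-1` A = \bigcup_w (S j @^-1` [set w] `&` [set _ | A w]).
  apply/seteqP; split=> [t At|t [w _ [/= -> //]]].
  by exists (S j t).
apply: countable_bigcupT_measurable; first exact: countableP.
move=> w; have [Aw|Aw] := pselect (A w).
  rewrite (_ : [set _ | A w] = setT) ?setIT //; last by apply/seteqP; split.
rewrite (_ : [set _ | A w] = set0) ?setI0 //.
by apply/seteqP; split.
Qed.

Lemma measurable_increment j e : measurable (increment S j @^-1` [set e]).
Proof.
have -> : increment S j @^-1` [set e] =
    \bigcup_w (S j @^-1` [set w] `&` S j.+1 @^-1` [set w + e]).
  apply/seteqP; split=> [t /= te|t [w _ [/= <- te]]].
    exists (S j t) => //; split=> //=.
    by rewrite -te /increment addrC subrK.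
  by rewrite /increment te addrC addKr.
apply: countable_bigcupT_measurable => [|w]; first exact: countableP.
by apply: measurableI; exact: measurable_walk.
Qed.

Definition cylinder s : set Omega :=
  S 0%N @^-1` [set z0] `&`
  \bigcap_(j in `I_(size s)) (increment S j @^-1` [set nth 0 s j]).

Lemma measurable_cylinder s : measurable (cylinder s).
Proof.
apply: measurableI; first exact: measurable_walk.
apply: bigcap_measurableType => // j _; exact: measurable_increment.
Qed.

Lemma probabilityI1 (A B : set Omega) : measurable A -> measurable B ->
  P B = 1%E -> P (A `&` B) = P A.
Proof.
move=> mA mB B1; rewrite [RHS](measureDI P mA mB) [X in (X + _)%E](_ : _ = 0%E) ?add0e //.
apply/eqP; rewrite eq_le measure_ge0 andbT.
have <- : P (~` B) = 0%E by rewrite probability_setC // B1 subee.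
apply: le_measure; first by rewrite inE; exact: measurableD.
  by rewrite inE; exact: measurableC.
by move=> t [].
Qed.

(** Each of the four steps has probability 1/4, so that an increment is almost
    surely one of them. *)
Lemma probability_split_step j (A : set Omega) : measurable A ->
  P A = (P (A `&` increment S j @^-1` [set (1, 0)%R]) +
         P (A `&` increment S j @^-1` [set (-1, 0)%R]) +
         P (A `&` increment S j @^-1` [set (0, 1)%R]) +
         P (A `&` increment S j @^-1` [set (0, -1)%R]))%E.
Proof.
move=> mA; have [_ _ Pstep _] := hS.
pose X e := increment S j @^-1` [set e].
have mX e : measurable (X e) by exact: measurable_increment.
have dX e f : e != f -> X e `&` X f = set0.
  move=> ef; apply/seteqP; split=> // t [/= te tf].
  by move: ef; rewrite -te -tf eqxx.
have mAX e : measurable (A `&` X e) by exact: measurableI.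
have U4 (B : set Omega) : measurable B ->
    P (B `&` (X (1, 0)%R `|` X (-1, 0)%R `|` X (0, 1)%R `|` X (0, -1)%R)) =
    (P (B `&` X (1, 0)%R) + P (B `&` X (-1, 0)%R) + P (B `&` X (0, 1)%R) +
     P (B `&` X (0, -1)%R))%E.
  move=> mB; have mBX e : measurable (B `&` X e) by exact: measurableI.
  have dB e f : e != f -> (B `&` X e) `&` (B `&` X f) = set0.
    by move=> ef; rewrite setIACA dX // setI0.
  rewrite !setIUr measureU //; [|by apply: measurableU => //; apply: measurableU|]; last first.
    by rewrite !setIUl !dB // !setU0.
  rewrite measureU //; [|by apply: measurableU|]; last first.
    by rewrite !setIUl !dB // !setU0.
  by rewrite measureU // dB.
rewrite -U4 // probabilityI1 //.
  by apply: measurableU => //; apply: measurableU => //; apply: measurableU.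
have := U4 setT measurableT; rewrite !setTI => ->; rewrite /X !Pstep.
- by rewrite -!EFinD; congr EFin; field.
- by right.
- by left; right.
- by do 2!left; right.
- by do 3!left.
Qed.

Lemma cylinder_rcons s e :
  cylinder (rcons s e) = cylinder s `&` increment S (size s) @^-1` [set e].
Proof.
apply/seteqP; split=> t.
  move=> [t0 ts]; split; first split=> //.
    move=> j js; have := ts j; rewrite /= size_rcons nth_rcons.
    by rewrite (js : (j < size s)%N); apply; exact: leqW.
  have := ts (size s); rewrite /= size_rcons nth_rcons ltnn eqxx; exact.
move=> [[t0 ts] te]; split=> // j; rewrite /= size_rcons nth_rcons ltnS leq_eqVlt.
move=> /orP[/eqP ->|js]; first by rewrite ltnn eqxx.
by rewrite js; exact: ts.
Qed.

Lemma probability_cylinder s : all (mem [:: (1, 0); (-1, 0); (0, 1); (0, -1)]) s ->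
  P (cylinder s) = (4^-1 ^+ size s)%:E.
Proof.
move=> us; have [_ P0 Pstep indep] := hS.
rewrite /cylinder setIC probabilityI1 //; last 2 first.
- by apply: bigcap_measurableType => // j _; exact: measurable_increment.
- exact: measurable_walk.
rewrite indep.
have -> : (4^-1 ^+ size s)%:E = (\prod_(j < size s) (4^-1 : R)%:E)%E.
  by rewrite prodEFin prodr_const card_ord.
apply: eq_bigr => j _; rewrite Pstep ?div1r //.
have := allP us _ (mem_nth 0 (ltn_ord j)); rewrite !inE /=.
by case/or4P => /eqP ->; [do 3!left|do 2!left; right|left; right|right].
Qed.

Definition exit_event n : set Omega := [set t | exits r n (fun j => S j t)].

Lemma measurable_exit_event n : measurable (exit_event n).
Proof.
have -> : exit_event n = \bigcup_(j in `I_n.+1)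
    (S j @^-1` [set w | r <= modulus w] `&`
     \bigcap_(i in `I_j.+1) (S i @^-1` [set w | ~~ slit w])).
  apply/seteqP; split=> [t /exitsP[j jn [rj sj]]|t [j jn [rj sj]]].
    by exists j => //; split=> // i ij; exact: sj.
  by apply/exitsP; exists j => //; split=> // i ij; exact: sj.
apply: bigcup_measurable => j _; apply: measurableI; first exact: measurable_walk.
by apply: bigcap_measurableType => // i _; exact: measurable_walk.
Qed.

(** By induction on the number k of steps that are not prescribed; when k = 0 the
    event is decided by s. *)
Lemma exit_event_cylinder k s :
  all (mem [:: (1, 0); (-1, 0); (0, 1); (0, -1)]) s ->
  P (cylinder s `&` exit_event (k + size s)) =
  (4^-1 ^+ size s * exit_along r k s z0)%:E.
Proof.
elim: k s => [|k IH] s us.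
  have st t : cylinder s t -> exit_along r 0 s z0 = (exits r (size s) (fun j => S j t))%:R.
    move=> [/= t0 ts]; rewrite -t0; apply: exit_along_path => j js.
    by have := ts j js; rewrite /= /increment => <-; rewrite addrC subrK.
  rewrite add0n; have [[t [ct et]]|ne] :=
      pselect (exists t, cylinder s t /\ exits r (size s) (fun j => S j t)).
    have e1 := st t ct; rewrite et in e1; rewrite e1 mulr1.
    rewrite -probability_cylinder //; congr (P _); apply/seteqP; split=> [u []//|u cu].
    split=> //; have := st u cu; rewrite e1 /exit_event /=.
    by case: exits => // /eqP; rewrite oner_eq0.
  rewrite (_ : _ `&` _ = set0); last first.
    by apply/seteqP; split=> // t [ct et]; apply: ne; exists t.
  rewrite measure0; have [t ct] : exists t, cylinder s t.
    apply: contrapT => no; have := probability_cylinder us.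
    rewrite (_ : cylinder s = set0) ?measure0; last first.
      by apply/seteqP; split=> // t ct; apply: no; exists t.
    by move=> [] /esym/eqP; rewrite expf_eq0 invr_eq0 pnatr_eq0 andbF.
  rewrite (st t ct).
  case E: exits; last by rewrite mulr0.
  by exfalso; apply: ne; exists t.
rewrite (@probability_split_step (size s)); last first.
  by apply: measurableI; [exact: measurable_cylinder|exact: measurable_exit_event].
have H e : e \in [:: (1, 0); (-1, 0); (0, 1); (0, -1)] ->
    P (cylinder s `&` exit_event (k.+1 + size s) `&` increment S (size s) @^-1` [set e]) =
    (4^-1 ^+ (size s).+1 * exit_along r k (rcons s e) z0)%:E.
  move=> he; rewrite setIAC -cylinder_rcons addSnnS.
  rewrite -[(size s).+1](size_rcons s e) IH // all_rcons us andbT.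
  exact: he.
rewrite !H ?inE ?eqxx ?orbT // -!EFinD; congr EFin.
by rewrite exit_along_rcons exprS; field.
Qed.

Lemma probability_exit_event n : P (exit_event n) = (exit_by r n z0)%:E.
Proof.
have := @exit_event_cylinder n [::] isT; rewrite addn0 expr0 mul1r /= => <-.
have [_ P0 _ _] := hS.
rewrite /cylinder /= setIC probabilityI1 //.
- exact: measurable_exit_event.
- apply: measurableI; first exact: measurable_walk.
  by apply: bigcap_measurableType => // j _; exact: measurable_increment.
rewrite (_ : \bigcap_(j in _) _ = setT) ?setIT //.
by apply/seteqP; split=> // t _ j.
Qed.

Lemma sigma_lt_tau t : (sigma S r t < tau_plus R S t)%E <->
  exists n, exit_event n t.
Proof.
split=> [/ereal_inf_lt[_ [j /= rj <-] jt]|[n /exitsP[j jn [rj sj]]]].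
  exists j; apply/exitsP; exists j => //; split=> // i ij.
  apply/negP => /slitP si.
  have : (tau_plus R S t <= i%:R%:E)%E by apply: ereal_inf_lbound; exists i.
  by move/(lt_le_trans jt); rewrite lte_fin ltr_nat ltnNge ij.
have h1 : (sigma S r t <= j%:R%:E)%E by apply: ereal_inf_lbound; exists j.
have h2 : (j.+1%:R%:E <= tau_plus R S t)%E.
  apply: le_ereal_inf_tmp => _ [i /= si <-]; rewrite lee_fin ler_nat ltnNge.
  by apply/negP => /sj; rewrite (introT (slitP _) si).
by apply: le_lt_trans h1 (lt_le_trans _ h2); rewrite lte_fin ltr_nat.
Qed.

Lemma exit_probability_cvg :
  exit_by r n z0 @[n --> \oo] --> fine (P [set t | (sigma S r t < tau_plus R S t)%E]).
Proof.
have -> : [set t | (sigma S r t < tau_plus R S t)%E] = \bigcup_n exit_event n.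
  by apply/seteqP; split=> [t /sigma_lt_tau[n ?]|t [n _ ?]]; [exists n|apply/sigma_lt_tau; exists n].
have : P (exit_event n) @[n --> \oo] --> P (\bigcup_n exit_event n).
  apply: nondecreasing_cvg_mu.
  - by move=> n; exact: measurable_exit_event.
  - by apply: bigcup_measurable => n _; exact: measurable_exit_event.
  - by move=> n m nm; apply/subsetPset => t; exact: exits_mono.
under eq_fun do rewrite probability_exit_event.
move=> h; have fU : P (\bigcup_n exit_event n) \is a fin_num.
  apply: fin_num_measure.
  by apply: bigcup_measurable => n _; exact: measurable_exit_event.
rewrite -(fineK fU) in h.
exact: (fine_cvg h).
Qed.

End walk.

Section exit_probability.
Variables (R : realType) (d : measure_display) (Omega : measurableType d).
Variables (S : nat -> Omega -> Z2) (P : Z2 -> probability Omega R).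
Hypothesis hS : forall z, simple_random_walk (P z) z S.
Implicit Types (z : Z2) (r : R).

Definition exit_probability r z : R :=
  fine (P z [set t | (sigma S r t < tau_plus R S t)%E]).

Let cvg_p r z : exit_by r n z @[n --> \oo] --> exit_probability r z.
Proof. exact: exit_probability_cvg. Qed.

Lemma exit_probability_ge0 r z : 0 <= exit_probability r z.
Proof. by rewrite /exit_probability fine_ge0. Qed.

Lemma exit_probability_slit r z : slit z -> exit_probability r z = 0.
Proof.
move=> sz; apply: cvg_unique (cvg_p (r := r) (z := z)) _ => //.
rewrite (_ : (fun n => exit_by r n z) = cst 0); first exact: cvg_cst.
by apply/funext => -[|n]; rewrite /= sz.
Qed.

Lemma exit_probability_outside r z : ~~ slit z -> r <= modulus z ->
  exit_probability r z = 1.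
Proof.
move=> /negbTE sz rz; apply: cvg_unique (cvg_p (r := r) (z := z)) _ => //.
rewrite (_ : (fun n => exit_by r n z) = cst 1); first exact: cvg_cst.
by apply/funext => -[|n]; rewrite /= sz rz.
Qed.

(** The recursion of exit_by passes to the limit in n. *)
Lemma exit_probability_harmonic r z : ~~ slit z -> modulus z < r ->
  exit_probability r z = nbr_avg (exit_probability r) z.
Proof.
move=> /negbTE sz zr.
have H : exit_by r n.+1 z @[n --> \oo] --> nbr_avg (exit_probability r) z.
  rewrite (_ : (fun n => exit_by r n.+1 z) = (fun n => nbr_avg (exit_by r n) z)).
    rewrite /nbr_avg; apply: cvgM; last exact: cvg_cst.
    apply: cvgD; last exact: cvg_p.
    apply: cvgD; last exact: cvg_p.
    by apply: cvgD; exact: cvg_p.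
  by apply/funext => n /=; rewrite sz leNgt zr.
apply: cvg_unique H => //.
have := cvg_p (r := r) (z := z); rewrite -(cvg_shiftn 1) /=.
by under eq_fun do rewrite addn1.
Qed.

Lemma exit_probability_le1 r z : exit_probability r z <= 1.
Proof.
have le1 n y : exit_by r n y <= 1.
  elim: n y => [|n IH] y /=; case: ifP => // _; case: ifP => // _.
  by rewrite -[leRHS](nbr_avg_cst 1 y); apply: nbr_avg_le => e _; exact: IH.
rewrite -(cvg_lim _ (cvg_p (r := r) (z := z))) //.
apply: limr_le; first by apply/cvg_ex; exists (exit_probability r z); exact: cvg_p.
exact: nearW.
Qed.

End exit_probability.

(** * The scaling limit *)

Section scaling_limit.
Variable R : realType.
Implicit Types (z : Z2) (s t : R).
Variables (h Psi : Z2 -> R) (Kh L : R).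
Hypothesis h_slit : forall z, slit z -> h z = 0.
Hypothesis h_harm : forall z, ~~ slit z -> h z = nbr_avg h z.
Hypothesis h_close : forall z, `|h z - Im_sqrt z| <= Kh * beta R z.
Hypothesis Kh0 : 0 <= Kh.
Hypothesis Psi_le : forall z, 0 <= Psi z <= L * beta R z.
Hypothesis Psi_super : forall z, ~~ slit z ->
  Im_sqrt z / modulus z ^+ 4 <= Psi z - nbr_avg Psi z.
Local Notation cmp := (comparison h).
Local Notation slk := (slack Psi).
Variable p : R -> Z2 -> R.
Hypothesis p_slit : forall r z, slit z -> p r z = 0.
Hypothesis p_out : forall r z, ~~ slit z -> r <= modulus z -> p r z = 1.
Hypothesis p_harm : forall r z, ~~ slit z -> modulus z < r -> p r z = nbr_avg (p r) z.
Hypothesis p_ge0 : forall r z, 0 <= p r z.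
Hypothesis p_le1 : forall r z, p r z <= 1.

Let atan_half (x : R) : 0 <= x -> 0 <= 2 / pi * atan x <= 1.
Proof.
move=> x0; have pi0 := pi_gt0 R.
have a0 : 0 <= atan x by rewrite -(atan0 R) le_atan.
rewrite mulr_ge0 ?divr_ge0 ?(ltW pi0) //= mulrAC ler_pdivrMr // mul1r.
by have := atan_ltpi2 x; lra.
Qed.

Let atan_large (e : R) : 0 < e -> exists2 X : R, 0 < X & forall x, X <= x ->
  1 - e <= 2 / pi * atan x.
Proof.
move=> e0; have pi2 := pi_ge2 R; have pi0 := pi_gt0 R.
have /cvgrPdist_le/(_ e e0)[M [_ HM]] := @cvgy_atan R.
exists (`|M| + 1) => [|x hx]; first by rewrite ltr_wpDl.
have Mx : M < x by rewrite (lt_le_trans _ hx) // (le_lt_trans (ler_norm _)) // ltrDl.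
have := HM x Mx; rewrite /= ler_norml => /andP[_ h'].
rewrite mulrAC ler_pdivlMr //; nra.
Qed.

(** The circle is seen as nearly at potential 1, except where
    sin(arg z / 2) < delta, provided that the dilation factor s is close enough
    to 1. *)
Let comparison_outside (e delta : R) : 0 < e -> 0 < delta ->
  exists n (s t0 : R), [/\ 1 - e < s, 0 < s < 1, 1 <= t0 &
  forall t z, t0 <= t -> ~~ slit z -> t ^+ 4 <= modulus z -> modulus z < t ^+ 4 + 1 ->
    - e <= cmp n s t z <= 1 + e /\ (delta <= sinhalf R z -> 1 - e <= cmp n s t z)].
Proof.
move=> e0 d0; have e20 : 0 < e / 2 by rewrite divr_gt0.
have [X X0 HX] := atan_large e20.
(* This bound on 1 - s makes the argument of the arctangent larger than X as
   soon as sin(arg z / 2) >= delta. *)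
pose eta := Num.min (e / 2) (Num.min (1 / 2) (delta / (2 * X))).
have eta0 : 0 < eta by rewrite !lt_min !divr_gt0 ?mulr_gt0.
have eta1 : eta <= e / 2 by rewrite ge_min lexx.
have eta2 : eta <= 1 / 2 by rewrite !ge_min lexx orbT.
have eta3 : eta * (2 * X) <= delta.
  by rewrite -ler_pdivlMr ?mulr_gt0 // !ge_min lexx !orbT.
clearbody eta; pose s := 1 - eta.
have s01 : 0 < s < 1 by rewrite /s; apply/andP; split; lra.
have [n [t0 [t01 bdry]]] := comparison_boundary h_close Kh0 e20 s01.
exists n, s, t0; split=> //; first by rewrite /s; lra.
move=> t z ht sz tz zt; have [s' /andP[ss' s'1]] := bdry t z ht sz tz zt.
have sg0 := sinhalf_gt0 R sz.
have s'0 : 1 / 2 <= s' by apply: le_trans ss'; rewrite /s; lra.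
have s'_eta : 1 - s' <= eta by move: ss'; rewrite /s; lra.
have s'_ge0 : 0 <= s' by lra.
have D0 : 0 < 1 - s' ^+ 2 by rewrite subr_gt0 expr_lt1.
have x0 : 0 <= 2 * s' * sinhalf R z / (1 - s' ^+ 2).
  by rewrite divr_ge0 ?(ltW D0) // mulr_ge0 ?(ltW sg0) // mulr_ge0.
have /andP[a0 a1] := atan_half x0.
have large : delta <= sinhalf R z ->
    1 - e / 2 <= 2 / pi * atan (2 * s' * sinhalf R z / (1 - s' ^+ 2)).
  move=> ds; apply: HX; rewrite ler_pdivlMr //.
  have h1 : 1 - s' ^+ 2 <= 2 * eta.
    rewrite (_ : 1 - s' ^+ 2 = (1 - s') * (1 + s')); last by ring.
    by rewrite mulrC ler_pM // ?subr_ge0 ?addr_ge0 ?(ltW s'1) //; lra.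
  apply: le_trans (ler_wpM2l (ltW X0) h1) _.
  rewrite (_ : X * (2 * eta) = eta * (2 * X)); last by ring.
  apply: le_trans eta3 (le_trans ds _).
  by rewrite ler_peMl ?(ltW sg0) //; lra.
move: large a0 a1; set a := 2 / pi * _ => large a0 a1.
rewrite ler_norml => /andP[c1 c2]; split.
  by apply/andP; split; lra.
by move=> /large; lra.
Qed.

(** The maximum principle for U - W - (1 + e) p, where U is harmonic up to an error
    dominated by the Laplacian of W. *)
Let lower_bound (r e : R) (U W : Z2 -> R) :
  (forall z, slit z -> U z = 0) ->
  (forall z, modulus z < r + 1 -> 0 <= W z) ->
  (forall z, ~~ slit z -> modulus z < r ->
     `|U z - nbr_avg U z| <= W z - nbr_avg W z) ->
  (forall z, ~~ slit z -> r <= modulus z -> modulus z < r + 1 -> U z <= 1 + e) ->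
  forall z, modulus z < r + 1 -> U z - W z <= (1 + e) * p r z.
Proof.
move=> U_slit W_ge0 lap U_out z zr; rewrite -subr_le0.
pose f z := U z - W z - (1 + e) * p r z; rewrite -/(f z).
move: z zr; apply: maximum_principle => [z sz zr|z zr].
  rewrite /f !nbr_avgB nbr_avgZ -p_harm //.
  by have := lap z sz zr; rewrite ler_norml => /andP[]; lra.
have w0 := W_ge0 z zr; have [sz _|sz /= rz] := boolP (slit z).
  by rewrite /f U_slit // p_slit // mulr0; lra.
by rewrite /f p_out // mulr1; have := U_out z sz rz zr; lra.
Qed.

(** The function U may be far from 1 on the part of the circle near the corner,
    where g >= 1 makes up for it.  To get rid of g, which does not vanish on the
    half-line, the maximum principle is used a second time in the disc of half
    radius: on its boundary circle g <= e, which is e times the probability of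
    leaving that smaller disc. *)
Let upper_bound (r e : R) (U W g : Z2 -> R) : 0 < r ->
  (forall z, slit z -> U z = 0) ->
  (forall z, modulus z < r + 1 -> 0 <= W z) ->
  (forall z, ~~ slit z -> modulus z < r ->
     `|U z - nbr_avg U z| <= W z - nbr_avg W z) ->
  (forall z, nbr_avg g z <= g z) ->
  (forall z, modulus z < r + 1 -> 0 <= g z) ->
  (forall z, ~~ slit z -> r <= modulus z -> modulus z < r + 1 -> 1 - e <= U z + g z) ->
  (forall z, modulus z < r / 2 + 1 -> g z <= e) ->
  forall z, modulus z < r / 2 + 1 ->
    (1 - e) * p r z <= U z + W z + e * p (r / 2) z.
Proof.
move=> r0 U_slit W_ge0 lap g_super g_ge0 U_out g_small.
pose f z := (1 - e) * p r z - U z - W z.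
have f_sub z : ~~ slit z -> modulus z < r -> f z <= nbr_avg f z.
  move=> sz zr; rewrite /f !nbr_avgB nbr_avgZ -p_harm //.
  by have := lap z sz zr; rewrite ler_norml => /andP[]; lra.
have f_slit z : slit z -> modulus z < r + 1 -> f z <= 0.
  move=> sz zr; rewrite /f U_slit // p_slit // mulr0.
  by have := W_ge0 z zr; lra.
have f_le_g : forall z, modulus z < r + 1 -> f z - g z <= 0.
  apply: maximum_principle => [z sz zr|z zr].
    by rewrite nbr_avgB; have := f_sub z sz zr; have := g_super z; lra.
  have g0 := g_ge0 z zr; have [sz _|sz /= rz] := boolP (slit z).
    by have := f_slit z sz zr; lra.
  have := U_out z sz rz zr; have := W_ge0 z zr.
  by rewrite /f p_out // mulr1; lra.
have f_le_p : forall z, modulus z < r / 2 + 1 -> f z - e * p (r / 2) z <= 0.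
  apply: maximum_principle => [z sz zr|z zr].
    have zr' : modulus z < r by lra.
    rewrite nbr_avgB nbr_avgZ -p_harm //.
    by have := f_sub z sz zr'; lra.
  have zr' : modulus z < r + 1 by lra.
  have [sz _|sz /= rz] := boolP (slit z).
    by rewrite p_slit // mulr0 subr0; exact: f_slit.
  rewrite p_out // mulr1.
  by have := f_le_g z zr'; have := g_small z zr; lra.
by move=> z zr; have := f_le_p z zr; rewrite /f; lra.
Qed.

Let squeeze (e : R) : 0 < e < 1 -> exists n (s C t0 : R), [/\ 1 - e < s < 1, 0 <= C, 1 <= t0 &
  forall t, t0 <= t ->
    (forall z, modulus z < t ^+ 4 + 1 ->
       cmp n s t z - slk C t z <= (1 + e) * p (t ^+ 4) z) /\
    (forall z, modulus z < t ^+ 4 / 2 + 1 ->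
       (1 - e) * p (t ^+ 4) z <=
       cmp n s t z + slk C t z + e * p (t ^+ 4 / 2) z)].
Proof.
move=> /andP[e0 e1].
have [delta [r0 [d0 r01 corner]]] := corner_function e0.
have [n [s [t1 [es s01 t11 outer]]]] := comparison_outside e0 d0.
have [C C0 lap] := comparison_laplacian h_harm Psi_super n.
have hs : 0 <= s <= 1 by case/andP: s01 => a b; rewrite !ltW.
exists n, s, C, (t1 + r0); split=> //.
- by rewrite es; case/andP: s01.
- by rewrite (le_trans t11) // lerDl (le_trans ler01).
move=> t ht.
have t1t : t1 <= t by apply: le_trans ht; rewrite lerDl (le_trans ler01).
have r0t : r0 <= t by apply: le_trans ht; rewrite lerDr (le_trans ler01).
have t_ge1 : 1 <= t := le_trans t11 t1t.
have t0 : 0 < t := lt_le_trans ltr01 t_ge1.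
have tr : r0 <= t ^+ 4.
  by rewrite (le_trans r0t) // exprS ler_peMr ?exprn_ege1 // ltW.
have [g [g_super g_ge0 g_corner g_small]] := corner _ tr.
have U_slit z : slit z -> cmp n s t z = 0 by exact: comparison_slit.
have W_ge0 z : modulus z < t ^+ 4 + 1 -> 0 <= slk C t z by exact: (slack_ge0 Psi_le).
have lapl z : ~~ slit z -> modulus z < t ^+ 4 ->
    `|cmp n s t z - nbr_avg (cmp n s t) z| <= slk C t z - nbr_avg (slk C t) z.
  by move=> sz zt; rewrite slack_laplacian; exact: lap.
split.
  apply: lower_bound => // z sz tz zt.
  by have [/andP[]] := outer t z t1t sz tz zt.
apply: (@upper_bound _ _ _ _ g) => //; first by rewrite exprn_gt0.
move=> z sz tz zt; have [/andP[c1 _] c2] := outer t z t1t sz tz zt.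
have [ds|sd] := leP delta (sinhalf R z).
  by have := c2 ds; have := g_ge0 z zt; lra.
by have := g_corner z sz tz zt (ltW sd); lra.
Qed.

(** At a fixed point the terms beyond the first are O(t^-6). *)
Let comparison_at n z : exists2 K : R, 0 <= K & forall s t, 0 <= s <= 1 -> 1 <= t ->
  `|t ^+ 2 * cmp n s t z - s * (4 / pi * h z)| <= K * t^-1.
Proof.
have /andP[p0 p2] := four_pi R.
exists (2 * \sum_(k < n) `|phi R k.+1 z|) => [|s t /andP[s0 s1] t1].
  by rewrite mulr_ge0 // sumr_ge0.
have t0 : 0 < t by lra.
have ti0 : 0 <= t^-1 by rewrite invr_ge0 ltW.
have ti1 : t^-1 <= 1 by rewrite invf_le1.
have c0 : 0 <= s / t ^+ 2 by rewrite divr_ge0 // exprn_ge0 // ltW.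
have ct : s / t ^+ 2 <= t^-1 ^+ 2.
  by rewrite exprVn ler_piMl // invr_ge0 exprn_ge0 // ltW.
rewrite /comparison.
set T := \sum_(k < n) _.
have -> : t ^+ 2 * (4 / pi * (s / t ^+ 2 * h z + T)) - s * (4 / pi * h z) =
    4 / pi * (t ^+ 2 * T).
  by move: T (4 / pi) => x c; field; rewrite gt_eqF.
rewrite normrM (ger0_norm p0) -[leRHS]mulrA; apply: ler_pM => //.
rewrite normrM ger0_norm ?exprn_ge0 ?(ltW t0) //.
have TB : `|T| <= t^-1 ^+ 3 * \sum_(k < n) `|phi R k.+1 z|.
  rewrite mulr_sumr (le_trans (ler_norm_sum _ _ _)) //; apply: ler_sum => k _.
  rewrite normrM normrM normfV (ger0_norm (exprn_ge0 _ c0)) (ger0_norm (ler0n R _)).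
  rewrite ler_pdivrMr ?ltr0n // (@le_trans _ _ (t^-1 ^+ 3 * `|phi R k.+1 z|)) //.
    rewrite ler_wpM2r // (@le_trans _ _ ((t^-1 ^+ 2) ^+ k.+1.*2.+1)) //.
      by rewrite lerXn2r ?nnegrE ?exprn_ge0.
    by rewrite -exprM ler_wiXn2l.
  by rewrite ler_peMr ?ler1n // mulr_ge0 ?exprn_ge0.
have t2 : 0 <= t ^+ 2 by rewrite exprn_ge0 // ltW.
rewrite (le_trans (ler_wpM2l t2 TB)) //.
rewrite [leLHS](_ : _ = (t * t^-1) ^+ 2 * ((\sum_(k < n) `|phi R k.+1 z|) * t^-1)).
  by rewrite (divff (lt0r_neq0 t0)) expr1n mul1r.
by rewrite exprMn; ring.
Qed.

Let slack_at C z : 0 <= C -> exists2 K : R, 0 <= K & forall t, 1 <= t ->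
  t ^+ 2 * slk C t z <= K * t^-1.
Proof.
move=> C0; have Psi0 : 0 <= Psi z by have /andP[] := Psi_le z.
exists (C * (Psi z + 4)) => [|t t1]; first by rewrite mulr_ge0 // addr_ge0.
have t0 : 0 < t by lra.
have ti0 : 0 <= t^-1 by rewrite invr_ge0 ltW.
have ti1 : t^-1 <= 1 by rewrite invf_le1.
have tti : t * t^-1 = 1 by rewrite divff // gt_eqF.
rewrite /slack mulrCA -[leRHS]mulrA ler_wpM2l //.
have t4 : (t ^+ 4 + 1) ^+ 2 - modulus z ^+ 2 <= 4 * t ^+ 8.
  have m0 : 0 <= modulus z ^+ 2 :> R by exact: sqr_ge0.
  have : (t ^+ 4 + 1) ^+ 2 <= (2 * t ^+ 4) ^+ 2.
    have : 1 <= t ^+ 4 by rewrite exprn_ege1.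
    by move=> h1; rewrite lerXn2r ?nnegrE //; lra.
  have -> : (2 * t ^+ 4) ^+ 2 = 4 * t ^+ 8 by ring.
  lra.
have i11 : 0 <= t^-1 ^+ 11 by rewrite exprn_ge0.
have t2 : 0 <= t ^+ 2 by rewrite exprn_ge0 // ltW.
have := ler_wpM2l t2 (ler_wpM2l i11 t4).
rewrite [X in _ <= X -> _](_ : _ = (t * t^-1) ^+ 10 * (4 * t^-1)); last first.
  by rewrite exprMn; ring.
rewrite tti expr1n mul1r => b1.
have b2 : t ^+ 2 * (t^-1 ^+ 4 * Psi z) <= Psi z * t^-1.
  rewrite [leLHS](_ : _ = (t * t^-1) ^+ 2 * (Psi z * (t^-1 * t^-1))); last first.
    by rewrite exprMn; ring.
  by rewrite tti expr1n mul1r ler_wpM2l // ler_piMr.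
rewrite mulrDr mulrDl; lra.
Qed.

Let pointwise_squeeze z (e : R) : 0 < e < 1 -> exists s r0 : R, [/\ 1 - e < s < 1, 1 <= r0 &
  forall r, r0 <= r ->
    s * (4 / pi * h z) - e <= (1 + e) * (Num.sqrt r * p r z) /\
    (1 - e) * (Num.sqrt r * p r z) <=
      s * (4 / pi * h z) + e + 2 * e * (Num.sqrt (r / 2) * p (r / 2) z)].
Proof.
move=> he; have /andP[e0 e1] := he.
have [n [s [C [t0 [hs C0 t01 sq]]]]] := squeeze he.
have [K1 K10 H1] := comparison_at n z; have [K2 K20 H2] := slack_at z C0.
pose t2 := t0 + (K1 + K2) / e + 2 * (modulus z + 1).
have t2_ge : [/\ t0 <= t2, (K1 + K2) / e <= t2 & 2 * (modulus z + 1) <= t2].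
  have a1 : 0 <= (K1 + K2) / e by rewrite divr_ge0 ?addr_ge0 // ltW.
  have a2 : 0 <= modulus z :> R by exact: modulus_ge0.
  by rewrite /t2; split; lra.
have [g1 g2 g3] := t2_ge; have t21 : 1 <= t2 by exact: le_trans t01 g1.
exists s, (t2 ^+ 4); split=> //; first by rewrite exprn_ege1.
move=> r hr; have r0 : 0 <= r by apply: le_trans hr; rewrite exprn_ge0 //; lra.
pose t := Num.sqrt (Num.sqrt r).
have t2E : t ^+ 2 = Num.sqrt r by rewrite sqr_sqrtr ?sqrtr_ge0.
have t4E : t ^+ 4 = r by rewrite (exprM _ 2 2) t2E sqr_sqrtr.
have tt2 : t2 <= t.
  rewrite -(ler_pXn2r (n := 4)) ?nnegrE ?sqrtr_ge0 ?t4E //; lra.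
clearbody t; have t1 : 1 <= t by exact: le_trans t21 tt2.
have t0' : 0 < t by lra.
have tpos : 0 <= t ^+ 2 by rewrite exprn_ge0 // ltW.
have tt4 : t <= t ^+ 4 by rewrite [leRHS]exprS ler_peMr ?exprn_ege1 // ltW.
have zr : modulus z < t ^+ 4 / 2 + 1 by lra.
have zr' : modulus z < t ^+ 4 + 1.
  have : 0 <= modulus z :> R by exact: modulus_ge0.
  by have := exprn_gt0 4 t0'; lra.
have [sq1 sq2] := sq t (le_trans g1 tt2).
have {}sq1 := ler_wpM2l tpos (sq1 z zr'); have {}sq2 := ler_wpM2l tpos (sq2 z zr).
have s01 : 0 <= s <= 1.
  by case/andP: hs => a b; apply/andP; split; lra.
have := H1 s t s01 t1; rewrite ler_norml => /andP[c1 c2]; have w := H2 t t1.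
have Ke : (K1 + K2) * t^-1 <= e.
  by rewrite ler_pdivrMr // mulrC -ler_pdivrMr // (le_trans g2).
have w0 : 0 <= t ^+ 2 * slk C t z by rewrite mulr_ge0 // (slack_ge0 Psi_le).
rewrite -t2E -t4E; split; first by lra.
have half : t ^+ 2 <= 2 * Num.sqrt (t ^+ 4 / 2).
  rewrite -(ler_pXn2r (n := 2)) ?nnegrE ?mulr_ge0 ?sqrtr_ge0 ?(ltW t0') // (exprMn 2 (2 : R)).
  rewrite sqr_sqrtr ?divr_ge0 ?exprn_ge0 ?(ltW t0') //.
  by have := exprn_ge0 4 (ltW t0'); rewrite -exprM; lra.
have := ler_wpM2r (p_ge0 (t ^+ 4 / 2) z) half => hp.
have := ler_wpM2l (ltW e0) hp; lra.
Qed.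

(** Write a(r) for the rescaled probability.  The squeeze bounds a(r) from both
    sides by 4 / pi * h z up to small multiples of 1, a(r) and a(r / 2), so that
    it suffices to know that a is bounded.  The upper bound itself gives it, by
    induction over dyadic scales. *)
Lemma exit_probability_scaling z :
  Num.sqrt r * p r z @[r --> +oo] --> 4 / pi * h z.
Proof.
pose a r := Num.sqrt r * p r z; pose G := 4 / pi * h z.
have a0 r : 0 <= a r by rewrite mulr_ge0 ?sqrtr_ge0.
have a_le r : a r <= Num.sqrt r by rewrite ler_piMr ?sqrtr_ge0.
have [M M0 HM] : exists2 M : R, 0 <= M & forall r, 0 < r -> a r <= M.
  have h8 : 0 < (1 / 8 : R) < 1 by apply/andP; split; lra.
  have [s [r0 [hs r01 H]]] := pointwise_squeeze z h8.
  exists (Num.max (2 * (2 * `|G| + 1)) (Num.sqrt r0)); first by rewrite le_max sqrtr_ge0 orbT.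
  set M := Num.max _ _.
  have M1 : 2 * (2 * `|G| + 1) <= M by rewrite le_max lexx.
  have M2 : Num.sqrt r0 <= M by rewrite le_max lexx orbT.
  suff Hk k : forall r, 0 < r -> r <= 2 ^+ k * r0 -> a r <= M.
    move=> r r_gt0; apply: (Hk (Num.bound r)) => //.
    have : r < (Num.bound r)%:R by rewrite archi_boundP // ltW.
    have : (Num.bound r)%:R <= 2 ^+ Num.bound r :> R.
      by rewrite -natrX ler_nat ltnW // ltn_expl.
    have : 2 ^+ Num.bound r <= 2 ^+ Num.bound r * r0 :> R.
      by rewrite ler_peMr // exprn_ge0.
    lra.
  elim: k => [|k IH] r r_gt0.
    by rewrite expr0 mul1r => rr; rewrite (le_trans (a_le r)) // (le_trans _ M2) // ler_wsqrtr.
  move=> rk; have [rr|rr] := leP r r0.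
    by rewrite (le_trans (a_le r)) // (le_trans _ M2) // ler_wsqrtr.
  have [_ up] := H r (ltW rr).
  have h2 : a (r / 2) <= M.
    by apply: IH; [rewrite divr_gt0|move: rk; rewrite exprS; lra].
  have sG : s * G <= `|G|.
    rewrite (le_trans (ler_norm _)) // normrM ler_piMl ?normr_ge0 //.
    by rewrite ger0_norm; case/andP: hs => ? ?; lra.
  have G0 := normr_ge0 G.
  by move: up; rewrite -/(a r) -/(a (r / 2)) -/G; lra.
apply/cvgrPdist_le => eta eta0.
have D0 : 0 < `|G| + 2 + 3 * M.
  by have := normr_ge0 G; lra.
pose e := Num.min (1 / 2) (eta / (`|G| + 2 + 3 * M)).
have e0 : 0 < e by rewrite lt_min !divr_gt0.
have e1 : e <= 1 / 2 by rewrite ge_min lexx.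
have e2 : e * (`|G| + 2 + 3 * M) <= eta by rewrite -ler_pdivlMr // ge_min lexx orbT.
have he : 0 < e < 1 by rewrite e0 /=; lra.
have [s [r0 [hs r01 H]]] := pointwise_squeeze z he.
exists r0; split; first exact: num_real.
move=> r rr; have r_gt0 : 0 < r by lra.
have [lo up] := H r (ltW rr); have h2 := HM (r / 2) (divr_gt0 r_gt0 (ltr0n _ 2)).
have h1 := HM r r_gt0; have h0 := a0 r.
have sG : `|s * G - G| <= e * `|G|.
  rewrite -[X in _ - X]mul1r -mulrBl normrM ler_wpM2r // ler_norml.
  by case/andP: hs => hs1 hs2; apply/andP; split; lra.
move: lo up sG; rewrite -/(a r) -/(a (r / 2)) -/G !ler_norml => lo up /andP[s1 s2].
have m1 := ler_wpM2l (ltW e0) h1; have m2 := ler_wpM2l (ltW e0) h2.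
have m3 := mulr_ge0 (ltW e0) h0.
by apply/andP; split; lra.
Qed.

End scaling_limit.

Theorem proposition3p10 (R : realType) (d : measure_display)
    (Omega : measurableType d) (S : nat -> Omega -> Z2)
    (P : Z2 -> probability Omega R)
    (hS : forall z : Z2, simple_random_walk (P z) z S) :
  exists v : Z2 -> R,
    (forall z : Z2,
       Num.sqrt r * fine (P z [set t | (sigma S r t < tau_plus R S t)%E])
         @[r --> +oo] --> v z) /\
    (exists c : R, forall z : Z2, z != 0 ->
       `|v z - 4 / pi * Im_sqrt z| <=
         c * (sin (arg z / 2) / Num.sqrt (modulus z))).
Proof.
have [h [K [K0 h_slit h_harm h_close]]] := harmonic_sqrt R.
have [Psi [L [_ Psi_le Psi_super]]] := barrier_global R.
exists (fun z => 4 / pi * h z); split.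
  move=> z.
  exact: (exit_probability_scaling h_slit h_harm h_close K0 Psi_le Psi_super
    (fun r y => @exit_probability_slit _ _ _ S P hS r y)
    (fun r y => @exit_probability_outside _ _ _ S P hS r y)
    (fun r y => @exit_probability_harmonic _ _ _ S P hS r y)
    (fun r y => @exit_probability_ge0 _ _ _ S P r y)
    (fun r y => @exit_probability_le1 _ _ _ S P hS r y)).
exists (4 / pi * K) => z z0; have /andP[p0 _] := four_pi R.
have -> : sin (arg z / 2) / Num.sqrt (modulus z) = beta R z.
  by rewrite sin_half_argE // /beta -mulrA -invfM -expr2 sqr_sqrtr ?modulus_ge0.
by rewrite -mulrBr normrM (ger0_norm p0) -[leRHS]mulrA ler_wpM2l.
Qed.
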